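(* For every integer $N\geq 1$ there exists an $(\mathbb{R}^+,\mathbb{C})$ splitting method of order (at least) $N$. That is, there exist $k\geq 1$, $\alpha=(\alpha_1,\dots,\alpha_k)\in(\mathbb{R}^+)^k$ and $\beta=(\beta_1,\dots,\beta_k)\in\mathbb{C}^k$ (depending only on $N$) such that, for every $d\geq 1$ and all holomorphic vector fields $f_0,f_1:\mathbb{C}^d\to\mathbb{C}^d$, for every $x_0\in\mathbb{C}^d$ there exists $C=C(f_0,f_1,x_0)$ such that, for all $T>0$ small enough, $$\left| e^{T(f_0+f_1)}x_0 - e^{\alpha_1 T f_0}e^{\beta_1 T f_1}\cdots e^{\alpha_k T f_0}e^{\beta_k T f_1}x_0\right|\leq C\,T^{N+1}.$$
   Context: $\mathbb{R}^+=[0,\infty)$. For a holomorphic vector field $g$ on $\mathbb{C}^d$, $e^{g}$ denotes the time-one flow of $\dot x=g(x)$ (where defined); for $s\in\mathbb{C}$, $e^{sg}$ is the time-one flow of the vector field $sg$ (equivalently the flow of $g$ at complex time $s$). Products of flows are compositions of maps (the rightmost flow is applied first to $x_0$). For fixed $x_0$ all flows involved are well defined near $x_0$ when $T$ is small. *)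

(* Defs.v *)
From HB Require Import structures.
From mathcomp Require Import all_boot all_order all_algebra complex.
From mathcomp Require Import all_classical all_reals all_analysis.

Set Implicit Arguments.
Unset Strict Implicit.
Unset Printing Implicit Defensive.

Import Order.TTheory GRing.Theory Num.Theory numFieldNormedType.Exports.
Local Open Scope classical_set_scope.
Local Open Scope ring_scope.
Local Open Scope complex_scope.

(* R[i] with the topology, norm and module structure over itself that
   MathComp-Analysis puts on every numFieldType. *)
#[non_forgetful_inheritance]
HB.instance Definition _ (R : rcfType) := PseudoPointedMetric.copy R[i] R[i]^o.
#[non_forgetful_inheritance]
HB.instance Definition _ (R : rcfType) := GRing.ComAlgebra.copy R[i] R[i]^o.
#[non_forgetful_inheritance]
HB.instance Definition _ (R : rcfType) := Vector.copy R[i] R[i]^o.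
#[non_forgetful_inheritance]
HB.instance Definition _ (R : rcfType) := NormedModule.copy R[i] R[i]^o.

(* [differentiable] is Frechet differentiability over the base field, here
   R[i], so the differential is required to be C-linear. *)
Definition holomorphic (R : realType) (d : nat)
    (f : 'cV[R[i]]_d -> 'cV[R[i]]_d) : Prop :=
  forall x : 'cV[R[i]]_d, differentiable f x.

(* 'cV[R[i]]_d is a normed module over R[i] but not over R, so [derivable] and
   [derive] do not apply to a curve in it with a real parameter. *)
Definition has_velocity (R : realType) (d : nat)
    (gamma : R -> 'cV[R[i]]_d) (t : R) (v : 'cV[R[i]]_d) : Prop :=
  (h^-1)%:C *: (gamma (t + h) - gamma t) @[h --> (0 : R)^'] --> v.

(* Graph of the partial map x |-> e^g x. Values of gamma outside [0, 1] only
   matter through the existence of two-sided derivatives at 0 and 1, which an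
   affine extension of a solution on [0, 1] provides. *)
Definition is_flow (R : realType) (d : nat)
    (g : 'cV[R[i]]_d -> 'cV[R[i]]_d) (x y : 'cV[R[i]]_d) : Prop :=
  exists gamma : R -> 'cV[R[i]]_d,
    [/\ gamma 0 = x,
        (forall t : R, 0 <= t <= 1 -> has_velocity gamma t (g (gamma t))) &
        gamma 1 = y].

(* Graph of e^{a_1 T f0} e^{b_1 T f1} ... e^{a_k T f0} e^{b_k T f1}, where
   ab = [:: (a_1, b_1); ...; (a_k, b_k)]; the tail is applied first. *)
Fixpoint is_splitting (R : realType) (d : nat)
    (f0 f1 : 'cV[R[i]]_d -> 'cV[R[i]]_d) (T : R) (ab : seq (R * R[i]))
    (x z : 'cV[R[i]]_d) : Prop :=
  match ab with
  | [::] => z = x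
  | (a, b) :: ab' =>
      exists u v : 'cV[R[i]]_d,
        [/\ is_splitting f0 f1 T ab' x u,
            is_flow (fun p => (b * T%:C) *: f1 p) u v &
            is_flow (fun p => (a * T)%:C *: f0 p) v z]
  end.

Definition splitting_order_at_least (R : realType) (N k : nat)
    (alpha : k.-tuple R) (beta : k.-tuple R[i]) : Prop :=
  forall (d : nat) (f0 f1 : 'cV[R[i]]_d -> 'cV[R[i]]_d),
    (0 < d)%N -> holomorphic f0 -> holomorphic f1 ->
    forall x0 : 'cV[R[i]]_d, exists C : R,
      \forall T \near (0 : R)^'+,
        [/\ exists y, is_flow (fun p => T%:C *: (f0 p + f1 p)) x0 y,
            exists z, is_splitting f0 f1 T (zip alpha beta) x0 z &
            forall y z,
              is_flow (fun p => T%:C *: (f0 p + f1 p)) x0 y ->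
              is_splitting f0 f1 T (zip alpha beta) x0 z ->
              `|y - z| <= (C * T ^+ N.+1)%:C].

(* Main.v *)
Require Import Defs.
From HB Require Import structures.
From mathcomp Require Import all_boot all_order all_algebra complex.
From mathcomp Require Import all_classical all_reals all_analysis.
From mathcomp Require Import cyclic separable cyclotomic ring lra.
Import Order.TTheory GRing.Theory Num.Theory numFieldNormedType.Exports.
Set Implicit Arguments.
Unset Strict Implicit.
Unset Printing Implicit Defensive.
Local Open Scope classical_set_scope.
Local Open Scope ring_scope.
Local Open Scope complex_scope.

(** The order of a splitting method is a condition on noncommutative power
series.  Let X0 and X1 be two letters, written false and true, and let a
word w act on holomorphic functions by the iterated Lie derivatives along f0
and f1.  Taylor's formula says that following the flow of T (p f0 + q f1)
changes a function phi into the sum of T^|w| c(w) (L_w phi), where c is the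
exponential series of p X0 + q X1, up to O(T^(n+1)) when words longer than n
are dropped; composing flows multiplies the series.  So it suffices to find
a_j >= 0 and complex b_j such that exp(a_1 X0) exp(b_1 X1) ... agrees with
exp(X0 + X1) on words of length at most N ([generated_reachable]).

This is proved by induction on N.  Call such a product reachable, and look at
the group generated by the exponentials of t X0, b X1 and t (X0 + X1), for t
real and b complex.  Suppose that every element g with a positive coefficient
of X0, its time, is reached up to degree N - 1.  Then some reachable series
equals g below degree N and differs from it by some z in degree N; such
errors, the defects of g, are central up to degree N, hence they add up under
products.

The defects of exp(t X0) form a complex vector space that does not depend on
t > 0.  Indeed replacing X1 by l X1 fixes exp(t X0) and multiplies the
coefficient of z at a word with k letters X1 by l^k; multiplying the series
obtained for l_1, ..., l_m multiplies that coefficient by the power sum of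
exponent k of the l_j, and complex numbers with prescribed power sums of
exponents 1, ..., N exist ([powersums_onto], [drift_defect_scale]).  In
particular errors can be cancelled although the times a_j are nonnegative.
It follows that the defects of any g of positive time form a coset of that
space.  The elements whose coset is trivial are closed under products and
cancellation, and contain exp(t X0) exp(b X1) by definition.  They also
contain exp(t (X0 + X1)) for t > 0: if z is a defect of it, then both 2 z and
2^N z are defects of its square, the second one by homogeneity.  So they
exhaust the elements of positive time ([reached_large]) and the induction
proceeds.

The rest of the file is the analysis behind Taylor's formula.  The fields are
only assumed to be complex differentiable at each point.  Goursat's lemma for
h(w) = (phi(x + e^w v) - phi(x)) e^(-w), which has period 2 i pi, expresses
the derivative of phi along v as a mean of phi over a circle
([boundary_entire], [cauchy_derivative]); this formula shows that partial
derivatives of holomorphic functions are continuous, and then holomorphic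
([pd_hol]), so Lie derivatives can be iterated.  Picard iteration gives the
flows ([picard]), an a priori bound keeps every solution in a small ball
([solution_stays]), and there repeated use of the mean value inequality bounds
the Taylor remainder of that solution ([taylor]). *)

(** * Noncommutative power series in two letters *)

Section Convolution.
Context {K : fieldType}.
Implicit Types (a b c e f g : seq bool -> K) (w : seq bool).

(** Product of noncommutative power series, given by their coefficients: the
coefficient of a word sums over its cuttings into a prefix and a suffix.
Recursion on the word makes associativity a short induction. *)
Fixpoint smul a b w : K :=
  match w with
  | [::] => a [::] * b [::]
  | x :: w' => a [::] * b w + smul (fun v => a (x :: v)) b w'
  end.

Definition unit_series w : K := (w == [::])%:R.

Lemma smul0 a b : smul a b [::] = a [::] * b [::]. Proof. by []. Qed.

Lemma smul_cons a b x w :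
  smul a b (x :: w) = a [::] * b (x :: w) + smul (fun v => a (x :: v)) b w.
Proof. by []. Qed.

Lemma smulDl a a' b w :
  smul (fun v => a v + a' v) b w = smul a b w + smul a' b w.
Proof.
elim: w a a' => [|x w IH] a a' /=; first by rewrite mulrDl.
by rewrite IH mulrDl addrACA.
Qed.

Lemma smulDr a b b' w :
  smul a (fun v => b v + b' v) w = smul a b w + smul a b' w.
Proof.
elim: w a => [|x w IH] a /=; first by rewrite mulrDr.
by rewrite IH mulrDr addrACA.
Qed.

Lemma smulZl k a b w : smul (fun v => k * a v) b w = k * smul a b w.
Proof.
elim: w a => [|x w IH] a /=; first by rewrite mulrA.
by rewrite IH mulrDr mulrA.
Qed.

Lemma smulA a b c : smul a (smul b c) = smul (smul a b) c.
Proof.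
apply/funext => w; elim: w a => [|x w IH] a; first by rewrite !smul0 mulrA.
rewrite !smul_cons IH.
rewrite (_ : (fun v => smul a b (x :: v)) = (fun v => a [::] * b (x :: v) +
   smul (fun u => a (x :: u)) b v)) //.
by rewrite smulDl smulZl mulrDr mulrA addrA.
Qed.

Lemma smul_small_r a f w :
  (forall v, (size v <= size w)%N -> f v = 0) -> smul a f w = 0.
Proof.
elim: w a => [|x w IH] a hf /=; first by rewrite hf // mulr0.
rewrite hf // mulr0 add0r; apply: IH => v hv; apply: hf; exact: leqW.
Qed.

(** A factor without terms below degree n only meets the constant term of the
other factor up to degree n; this is why errors of top degree are central. *)
Lemma smul_low_l n e b w : (forall v, (size v < n)%N -> e v = 0) ->
  (size w <= n)%N -> smul e b w = e w * b [::].
Proof.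
elim: w e n => [|x w IH] e [|n] //= he hw.
rewrite he // mul0r add0r (IH _ n) // => v hv; exact: he.
Qed.

Lemma smul_low_r n a f w : (forall v, (size v < n)%N -> f v = 0) ->
  (size w <= n)%N -> smul a f w = a [::] * f w.
Proof.
case: w => [|x w] //= hf hw.
rewrite smul_small_r ?addr0 // => v hv; apply: hf.
exact: leq_ltn_trans hv hw.
Qed.

Lemma smul1l a : smul unit_series a = a.
Proof.
apply/funext => -[|x w]; first by rewrite smul0 /unit_series eqxx mul1r.
rewrite smul_cons {1}/unit_series eqxx mul1r -[RHS]addr0; congr (_ + _).
have h0 : forall v, (fun v => unit_series (x :: v)) v = 0 by [].
by rewrite (@smul_low_l (size w)) // h0 mul0r.
Qed.

Lemma smul1r a : smul a unit_series = a.
Proof.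
apply/funext => w; elim: w a => [|x w IH] a.
  by rewrite smul0 /unit_series eqxx mulr1.
by rewrite smul_cons IH {1}/unit_series /= mulr0 add0r.
Qed.

Definition letters (p q : K) w : K := \prod_(x <- w) (if x then q else p).

Lemma letters_cons p q x w :
  letters p q (x :: w) = (if x then q else p) * letters p q w.
Proof. by rewrite /letters big_cons. Qed.

Lemma letters_nil p q : letters p q [::] = 1.
Proof. by rewrite /letters big_nil. Qed.

Lemma lettersM p q p' q' w :
  letters p q w * letters p' q' w = letters (p * p') (q * q') w.
Proof.
rewrite /letters -big_split; apply: eq_bigr => x _ /=; by case: x.
Qed.

Lemma letters_same p w : letters p p w = p ^+ size w.
Proof.
elim: w => [|x w IH]; first by rewrite letters_nil.
by rewrite letters_cons IH exprS; case: x.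
Qed.

Lemma letters_1q q w : letters 1 q w = q ^+ count_mem true w.
Proof.
elim: w => [|x w IH]; first by rewrite letters_nil.
by rewrite letters_cons IH /=; case: x => /=; rewrite ?exprS // mul1r.
Qed.

(** Rescaling the letters, X0 by p and X1 by q, is multiplicative. *)
Lemma smul_letters p q a b w :
  smul (fun v => letters p q v * a v) (fun v => letters p q v * b v) w =
  letters p q w * smul a b w.
Proof.
elim: w a => [|x w IH] a; first by rewrite !smul0 letters_nil !mul1r.
rewrite !smul_cons letters_nil mul1r.
set l := if x then q else p.
rewrite (_ : (fun v => letters p q (x :: v) * a (x :: v)) =
  (fun v => l * (letters p q v * a (x :: v)))); last first.
  by apply/funext => v; rewrite letters_cons mulrA.
by rewrite smulZl IH letters_cons -/l; ring.
Qed.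

Lemma smul_size (A B : nat -> K) w :
  smul (fun v => A (size v)) (fun v => B (size v)) w =
  \sum_(k < (size w).+1) A k * B (size w - k)%N.
Proof.
elim: w A => [|x w IH] A; first by rewrite smul0 big_ord1.
rewrite big_ord_recl smul_cons /= subn0 (IH (fun k => A k.+1)).
by [].
Qed.

(** The exponential series of p X0 + q X1. *)
Definition sexp (p q : K) w : K := letters p q w / (size w)`!%:R.

Lemma sexp_nil p q : sexp p q [::] = 1.
Proof. by rewrite /sexp letters_nil divr1. Qed.

Lemma sexp00 : sexp 0 0 = unit_series.
Proof.
apply/funext => -[|x w]; first by rewrite sexp_nil.
by rewrite /sexp letters_cons /unit_series; case: x; rewrite !mul0r.
Qed.

Lemma letters_sexp l m p q w : letters l m w * sexp p q w = sexp (l * p) (m * q) w.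
Proof. by rewrite /sexp mulrA lettersM. Qed.

End Convolution.

Section ExpLaw.
Context {K : numFieldType}.

Lemma factr_neq0 n : (n`!%:R : K) != 0.
Proof. by rewrite pnatr_eq0 -lt0n fact_gt0. Qed.

(** One-parameter group law; it reduces to the binomial formula because all
coefficients only depend on the length, up to the factor [letters]. *)
Lemma sexpD (p q s t : K) :
  smul (sexp (s * p) (s * q)) (sexp (t * p) (t * q)) = sexp ((s + t) * p) ((s + t) * q).
Proof.
have E r : sexp (r * p) (r * q) =
   (fun w => letters p q w * (r ^+ size w / (size w)`!%:R)).
  by apply/funext => w; rewrite /sexp -lettersM letters_same -mulrA mulrCA.
rewrite !E; apply/funext => w; rewrite smul_letters; congr (_ * _).
rewrite (smul_size (fun n => s ^+ n / n`!%:R) (fun n => t ^+ n / n`!%:R)).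
rewrite addrC exprDn mulr_suml; apply: eq_bigr => -[k /=]; rewrite ltnS => hk _.
rewrite -[_ *+ _]mulr_natr -(bin_fact hk) !natrM; have := factr_neq0 k.
have := factr_neq0 (size w - k).
have hb : ('C(size w, k)%:R : K) != 0 by rewrite pnatr_eq0 -lt0n bin_gt0.
by move=> h1 h2; field; rewrite hb h1 h2.
Qed.

Lemma sexp0D (a b : K) : smul (sexp a 0) (sexp b 0) = sexp (a + b) 0.
Proof. by have := sexpD 1 0 a b; rewrite !mulr1 !mulr0. Qed.

Lemma sexp1D (a b : K) : smul (sexp 0 a) (sexp 0 b) = sexp 0 (a + b).
Proof. by have := sexpD 0 1 a b; rewrite !mulr1 !mulr0. Qed.

Lemma sexpdD (a b : K) : smul (sexp a a) (sexp b b) = sexp (a + b) (a + b).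
Proof. by have := sexpD 1 1 a b; rewrite !mulr1. Qed.

End ExpLaw.

(** * Complex numbers with prescribed power sums *)

Section PowerSums.
Context {K : numClosedFieldType}.

Lemma closed_prim_root (n : nat) : (0 < n)%N -> exists z : K, n.-primitive_root z.
Proof.
pose p : {poly K} := 'X^n - 1; have [r Dp] := closed_field_poly_normal p.
move=> n_gt0; rewrite (monicP _) ?monicXnsubC // scale1r in Dp.
have rn1 : all n.-unity_root r.
  by apply/allP => z; rewrite -root_prod_XsubC -Dp.
have sz_r : (n < (size r).+1)%N.
  by rewrite -(size_prod_XsubC r id) -Dp size_XnsubC.
have [|z _ hz] := hasP (has_prim_root n_gt0 rn1 _ sz_r); last by exists z.
by rewrite -separable_prod_XsubC -Dp separable_Xn_sub_1 // pnatr_eq0 -lt0n.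
Qed.

(** The geometric sum of the k-th powers has a ratio different from 1 and
ends where it starts. *)
Lemma prim_root_powersum (n k : nat) (z : K) : n.-primitive_root z -> (0 < k < n)%N ->
  \sum_(i < n) (z ^+ i) ^+ k = 0.
Proof.
move=> hz /andP[k0 kn].
have hzk : z ^+ k != 1 by rewrite -(prim_order_dvd hz) gtnNdvd.
have : (z ^+ k - 1) * \sum_(i < n) (z ^+ k) ^+ i = 0.
  by rewrite -subrX1 exprAC (prim_expr_order hz) expr1n subrr.
move/eqP; rewrite mulf_eq0 subr_eq0 (negbTE hzk) /= => /eqP h.
by rewrite -[RHS]h; apply: eq_bigr => i _; rewrite exprAC.
Qed.

(** The n-th roots of unity times r have vanishing power sums of exponents
below n, and the one of exponent n is n r^n: appending them prescribes the
next power sum without disturbing the previous ones.  The number m of terms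
must not depend on c, since every term costs some time when the lemma is
applied. *)
Lemma powersums_onto (n : nat) : exists m : nat, forall c : nat -> K, exists l : seq K,
  size l = m /\ forall k, (0 < k <= n)%N -> \sum_(x <- l) x ^+ k = c k.
Proof.
elim: n => [|n [m IH]].
  by exists 0%N => c; exists [::]; split => // -[].
exists (m + n.+1)%N => c; have [l [sl hl]] := IH c.
have [z hz] := @closed_prim_root n.+1 isT.
have n0 : (n.+1%:R : K) != 0 by rewrite pnatr_eq0.
pose r := n.+1.-root ((c n.+1 - \sum_(x <- l) x ^+ n.+1) / n.+1%:R).
exists (l ++ [seq r * z ^+ i | i <- index_iota 0 n.+1]); split.
  by rewrite size_cat sl size_map size_iota subn0.
move=> k /andP[k0 kn]; rewrite big_cat big_map big_mkord /=.
rewrite (eq_bigr (fun i : 'I_n.+1 => r ^+ k * (z ^+ i) ^+ k)); last first.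
  by move=> i _; rewrite exprMn.
rewrite -mulr_sumr; move: kn; rewrite leq_eqVlt => /orP[/eqP -> | kn].
  have -> : \sum_(i < n.+1) (z ^+ i) ^+ n.+1 = n.+1%:R.
    rewrite (eq_bigr (fun=> 1)) ?sumr_const ?card_ord //.
    by move=> i _; rewrite exprAC (prim_expr_order hz) expr1n.
  rewrite rootCK //.
  by field.
by rewrite (prim_root_powersum hz) ?k0 // mulr0 addr0 hl // k0.
Qed.

End PowerSums.

(** * Products of exponentials with nonnegative times *)

Section Reachability.
Context {R : rcfType}.
Local Notation K := R[i].
Implicit Types (g h s z : seq bool -> K) (t : R) (w : seq bool).

(** Series of the composition described by [is_splitting]: the head of the list
is the flow applied last, and the leftmost factor. *)
Fixpoint split_series (ab : seq (R * K)) : seq bool -> K :=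
  if ab is (a, b) :: ab' then smul (sexp a%:C 0) (smul (sexp 0 b) (split_series ab'))
  else unit_series.

Definition reachable s :=
  exists2 ab : seq (R * K), all (fun p => 0 <= p.1) ab & s = split_series ab.

Lemma split_series_cat ab ab' :
  split_series (ab ++ ab') = smul (split_series ab) (split_series ab').
Proof.
elim: ab => [|[a b] ab IH] /=; first by rewrite smul1l.
by rewrite IH !smulA.
Qed.

Lemma reachable_unit : reachable unit_series. Proof. by exists [::]. Qed.

Lemma reachableM s s' : reachable s -> reachable s' -> reachable (smul s s').
Proof.
move=> [ab hab ->] [ab' hab' ->]; exists (ab ++ ab'); first by rewrite all_cat hab.
by rewrite split_series_cat.
Qed.

Lemma reachable_step a b : 0 <= a -> reachable (smul (sexp a%:C 0) (sexp 0 b)).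
Proof. by move=> a0; exists [:: (a, b)]; rewrite /= ?a0 // smul1r. Qed.

Lemma reachable_sexp0 a : 0 <= a -> reachable (sexp a%:C 0).
Proof. by move=> a0; have := reachable_step 0 a0; rewrite sexp00 smul1r. Qed.

Lemma letters_split_series (l : R) (m : K) (ab : seq (R * K)) :
  (fun w => letters l%:C m w * split_series ab w) =
  split_series [seq (l * p.1, m * p.2) | p <- ab].
Proof.
elim: ab => [|[a b] ab IH] /=.
  apply/funext => -[|x w]; first by rewrite letters_nil mul1r.
  by rewrite /unit_series /= mulr0.
rewrite -IH; apply/funext => w.
rewrite -smul_letters; congr (smul _ _ w); apply/funext => v.
  by rewrite letters_sexp mulr0 rmorphM.
rewrite -smul_letters; congr (smul _ _ v); apply/funext => u.
by rewrite letters_sexp mulr0.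
Qed.

Lemma reachable_letters l m s : 0 <= l -> reachable s ->
  reachable (fun w => letters l%:C m w * s w).
Proof.
move=> l0 [ab hab ->]; rewrite letters_split_series.
exists [seq (l * p.1, m * p.2) | p <- ab] => //.
rewrite all_map; apply: sub_all hab => p /= hp; exact: mulr_ge0.
Qed.

Lemma reachable_nil s : reachable s -> s [::] = 1.
Proof.
move=> [ab _ ->]; elim: ab => [|[a b] ab IH] /=; first by rewrite /unit_series eqxx.
by rewrite !sexp_nil IH !mulr1.
Qed.

Lemma sexp_false (p q : K) : sexp p q [:: false] = p.
Proof. by rewrite /sexp /letters big_seq1 divr1. Qed.

Lemma sexp_true (p q : K) : sexp p q [:: true] = q.
Proof. by rewrite /sexp /letters big_seq1 divr1. Qed.

(** Substituting 0 for X1 turns a product of exponentials into a single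
exponential of X0, determined by its coefficient of X0. *)
Lemma reachable_no_true s w : reachable s -> count_mem true w = 0%N ->
  s w = sexp (s [:: false]) 0 w.
Proof.
move=> [ab hab ->].
have E : (fun w => letters 1%:C 0 w * split_series ab w) =
   sexp (\sum_(p <- ab) p.1)%:C 0.
  rewrite letters_split_series; elim: ab {hab} => [|[a b] ab IH].
    by rewrite /= big_nil sexp00.
  by rewrite /= IH big_cons mul0r sexp00 smul1l sexp0D mul1r rmorphD.
have h1 v : count_mem true v = 0%N -> letters 1%:C 0 v = 1 :> K.
  by move=> hv; rewrite rmorph1 letters_1q hv expr0.
have h v : count_mem true v = 0%N -> split_series ab v =
   sexp (\sum_(p <- ab) p.1)%:C 0 v.
  by move=> hv; rewrite -E h1 // mul1r.
by move=> hw; rewrite !h // sexp_false.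
Qed.

(** The target exp(X0 + X1) is put among the generators, so that it belongs to
the group by definition; [reached_diagonal] is the price. *)
Inductive generated : (seq bool -> K) -> Prop :=
| gen_sexp0 t : generated (sexp t%:C 0)
| gen_sexp1 b : generated (sexp 0 b)
| gen_sexpd t : generated (sexp t%:C t%:C)
| genM g h : generated g -> generated h -> generated (smul g h).

Lemma generated_nil g : generated g -> g [::] = 1.
Proof.
elim => [t|b|t|{}g h _ IHg _ IHh]; rewrite ?sexp_nil //.
by rewrite smul0 IHg IHh mulr1.
Qed.

Lemma smul_false g h : g [::] = 1 -> h [::] = 1 ->
  smul g h [:: false] = g [:: false] + h [:: false].
Proof. by move=> g1 h1; rewrite smul_cons smul0 g1 h1 mul1r mulr1 addrC. Qed.

(** The coefficient of X0, real and additive on the group. *)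
Definition time g : R := complex.Re (g [:: false]).

Lemma time_sexp (t : R) q : time (sexp t%:C q) = t.
Proof. by rewrite /time sexp_false. Qed.

Lemma time_sexp1 q : time (sexp 0 q) = 0.
Proof. by rewrite /time sexp_false. Qed.

Lemma ReD (x y : K) : complex.Re (x + y) = complex.Re x + complex.Re y.
Proof. by case: x => a b; case: y. Qed.

Lemma timeM g h : g [::] = 1 -> h [::] = 1 -> time (smul g h) = time g + time h.
Proof. by move=> g1 h1; rewrite /time smul_false // ReD. Qed.

Lemma generated_false g : generated g -> g [:: false] = (time g)%:C.
Proof.
elim => [t|b|t|{}g h Gg IHg Gh IHh]; rewrite ?time_sexp ?time_sexp1 ?sexp_false //.
have [g1 h1] := (generated_nil Gg, generated_nil Gh).
by rewrite timeM // smul_false // IHg IHh rmorphD.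
Qed.

Lemma generated_inv g : generated g ->
  exists h, [/\ generated h, smul g h = unit_series & smul h g = unit_series].
Proof.
elim => [t|b|t|{}g h Gg [g' [Gg' g1 g2]] Gh [h' [Gh' h1 h2]]].
- exists (sexp (- t)%:C 0); split; first exact: gen_sexp0.
    by rewrite sexp0D -rmorphD subrr rmorph0 sexp00.
  by rewrite sexp0D -rmorphD addNr rmorph0 sexp00.
- exists (sexp 0 (- b)); split; first exact: gen_sexp1.
    by rewrite sexp1D subrr sexp00.
  by rewrite sexp1D addNr sexp00.
- exists (sexp (- t)%:C (- t)%:C); split; first exact: gen_sexpd.
    by rewrite sexpdD -rmorphD subrr rmorph0 sexp00.
  by rewrite sexpdD -rmorphD addNr rmorph0 sexp00.
- exists (smul h' g'); split; first exact: genM.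
    by rewrite -smulA (smulA h) h1 smul1l.
  by rewrite -smulA (smulA g') g2 smul1l.
Qed.

Section Defects.
Variable N : nat.
Hypothesis N2 : (2 <= N)%N.

(** The part of degree N by which a reachable series misses g, when they agree
in lower degrees. *)
Definition defect g z := exists2 s, reachable s &
  (forall w, (size w < N)%N -> s w = g w) /\
  (forall w, size w = N -> s w = g w + z w).

(** Errors of top degree are central, so they add up. *)
Lemma defectM g h z z' : g [::] = 1 -> h [::] = 1 ->
  defect g z -> defect h z' -> defect (smul g h) (fun w => z w + z' w).
Proof.
move=> g1 h1 [s Ss [sl sN]] [s' Ss' [sl' sN']].
exists (smul s s'); first exact: reachableM.
have es : s = (fun w => g w + (s w - g w)) by apply/funext => w; ring.
have es' : s' = (fun w => h w + (s' w - h w)) by apply/funext => w; ring.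
have e0 v : (size v < N)%N -> s v - g v = 0 by move=> hv; rewrite sl // subrr.
have e0' v : (size v < N)%N -> s' v - h v = 0 by move=> hv; rewrite sl' // subrr.
have E w : (size w <= N)%N -> smul s s' w =
    smul g h w + (s' w - h w) + (s w - g w).
  move=> hw; rewrite {1}es smulDl.
  rewrite (@smul_low_l _ N (fun v => s v - g v)) //.
  rewrite (reachable_nil Ss') mulr1; congr (_ + _).
  rewrite {1}es' smulDr; congr (_ + _).
  by rewrite (@smul_low_r _ N) // g1 mul1r.
split => w hw; first by rewrite E 1?ltnW // e0 // e0' // !addr0.
by rewrite E ?hw // sN // sN' //; ring.
Qed.

Lemma defect_ext g z z' : (forall w, size w = N -> z w = z' w) ->
  defect g z -> defect g z'.
Proof. by move=> h [s Ss [sl sN]]; exists s => //; split => // w hw; rewrite sN // h. Qed.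

Lemma defect_reachable s : reachable s -> defect s (fun=> 0).
Proof. by move=> Ss; exists s => //; split => // w; rewrite addr0. Qed.

Lemma defect_letters l m g z : 0 <= l -> defect g z ->
  defect (fun w => letters l%:C m w * g w) (fun w => letters l%:C m w * z w).
Proof.
move=> l0 [s Ss [sl sN]]; exists (fun w => letters l%:C m w * s w).
  exact: reachable_letters.
by split => w hw; [rewrite sl|rewrite sN // mulrDr].
Qed.

(** On a power of X0 both series have the same coefficient, because their
coefficients of X0 agree; here N >= 2 matters. *)
Lemma drift_defect_no_true t z w : defect (sexp t%:C 0) z -> size w = N ->
  count_mem true w = 0%N -> z w = 0.
Proof.
move=> [s Ss [sl sN]] hw cw; have := sN _ hw.
rewrite (reachable_no_true Ss cw) sl // sexp_false => h.
by apply: (addrI (sexp t%:C 0 w)); rewrite addr0.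
Qed.

Lemma drift_defect_sum (t : R) (z : seq bool -> K) (l : seq K) : 0 <= t ->
  defect (sexp 1%:C 0) z ->
  defect (sexp ((size l)%:R * t)%:C 0)
    (fun w => \sum_(x <- l) letters t%:C (t%:C * x) w * z w).
Proof.
move=> t0 hz; elim: l => [|x l IH].
  rewrite mul0r rmorph0 sexp00; apply: defect_ext (defect_reachable reachable_unit).
  by move=> w _; rewrite big_nil.
have -> : sexp ((size (x :: l))%:R * t)%:C 0 =
   smul (sexp t%:C 0) (sexp ((size l)%:R * t)%:C 0).
  by rewrite sexp0D -rmorphD /= -natr1; congr (sexp _%:C 0); ring.
have h := defect_letters (t%:C * x) t0 hz.
have E : (fun w => letters t%:C (t%:C * x) w * sexp 1%:C 0 w) = sexp t%:C 0.
  by apply/funext => w; rewrite letters_sexp mulr0 rmorph1 mulr1.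
rewrite E in h; apply: defect_ext (defectM _ _ h IH); rewrite ?sexp_nil //.
by move=> w _; rewrite big_cons.
Qed.

Lemma drift_defect_unit t z : 0 < t -> defect (sexp t%:C 0) z ->
  defect (sexp 1%:C 0) (fun w => (t^-1)%:C ^+ N * z w).
Proof.
move=> t0 hz; have ti0 : 0 <= t^-1 by rewrite invr_ge0 ltW.
have := defect_letters (t^-1)%:C ti0 hz.
have -> : (fun w => letters (t^-1)%:C (t^-1)%:C w * sexp t%:C 0 w) = sexp 1%:C 0.
  apply/funext => w; rewrite letters_sexp mulr0 -rmorphM mulVf ?gt_eqF //.
by apply: defect_ext => w hw; rewrite letters_same hw.
Qed.

(** The source of all cancellations.  The automorphism that multiplies X1 by l
fixes the drift exp(t X0) and multiplies the coefficient of z at w by the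
power of l whose exponent is the number of letters X1 in w.  The product over
l_1, ..., l_m multiplies that coefficient by a power sum of positive exponent,
which can be any constant; the total time is as short as wanted after
rescaling X0. *)
Lemma drift_defect_scale t t' z (c : K) : 0 < t -> 0 < t' ->
  defect (sexp t%:C 0) z -> defect (sexp t'%:C 0) (fun w => c * z w).
Proof.
move=> t0 t'0 hz1; have hz := drift_defect_unit t0 hz1.
have [m hm] := @powersums_onto K N.
have m0 : (0 < m)%N.
  rewrite lt0n; apply/eqP => m0; have [l [sl hl]] := hm (fun=> 1).
  move: sl; rewrite m0 => /size0nil l0; have := hl 1%N (ltnW N2).
  by rewrite l0 big_nil => /eqP; rewrite eq_sym oner_eq0.
(* each of the m factors gets an m-th of the time t' *)
pose d := t' / m%:R.
have d0 : 0 < d by rewrite divr_gt0 // ltr0n.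
have [l [sl hl]] := hm (fun=> c * ((t / d)%:C ^+ N)).
have := drift_defect_sum l (ltW d0) hz.
rewrite sl mulrC divfK ?pnatr_eq0 -?lt0n //.
apply: defect_ext => w hw.
have [cw|cw] := eqVneq (count_mem true w) 0%N.
  rewrite (drift_defect_no_true hz1 hw cw) big1 ?mulr0 // => x _.
  by rewrite !mulr0.
rewrite -mulr_suml.
rewrite (eq_bigr (fun x => d%:C ^+ N * x ^+ count_mem true w)); last first.
  move=> x _; rewrite -[in LHS](mulr1 d%:C) -mulrA mul1r -lettersM.
  by rewrite letters_same hw letters_1q.
rewrite -mulr_sumr hl; last first.
  by rewrite lt0n cw -hw -count_predT sub_count.
rewrite !mulrA -(mulrC c) -!mulrA; congr (c * _); rewrite !mulrA -!exprMn -!rmorphM.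
have -> : d * (t / d) * t^-1 = 1 by field; rewrite !gt_eqF.
by rewrite rmorph1 expr1n mul1r.
Qed.

Hypothesis IH : forall g, generated g -> 0 < time g ->
  exists2 s, reachable s & forall w, (size w < N)%N -> s w = g w.

Lemma defect_exists g : generated g -> 0 < time g -> exists z, defect g z.
Proof.
move=> Gg tg; have [s Ss sl] := IH Gg tg.
exists (fun w => s w - g w), s => //; split => // w _; ring.
Qed.

(** Time 1 is a normalization: by [drift_defect_any_time] the drift has the same
defects at all positive times. *)
Definition drift_defect z := defect (sexp 1%:C 0) z.

Lemma drift_defect_any_time t z : 0 < t -> drift_defect z <-> defect (sexp t%:C 0) z.
Proof.
move=> t0; split => hz.
  by apply: defect_ext (drift_defect_scale 1 _ t0 hz) => // w _; rewrite mul1r.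
by apply: defect_ext (drift_defect_scale 1 t0 _ hz) => // w _; rewrite mul1r.
Qed.

Lemma drift_defectZ c z : drift_defect z -> drift_defect (fun w => c * z w).
Proof. by move=> hz; apply: drift_defect_scale hz. Qed.

Lemma drift_defectD z z' : drift_defect z -> drift_defect z' -> drift_defect (fun w => z w + z' w).
Proof.
move=> hz hz'; apply/(@drift_defect_any_time (1 + 1)) => //.
by rewrite rmorphD -sexp0D; apply: defectM; rewrite ?sexp_nil.
Qed.

Lemma drift_defect_ext z z' : (forall w, size w = N -> z w = z' w) ->
  drift_defect z -> drift_defect z'.
Proof. exact: defect_ext. Qed.

(** Both z and z' become defects of a pure drift after multiplication of g by
g^-1 exp(T X0), an element of positive time that has some defect too. *)
Lemma defect_sub g z z' : generated g -> 0 < time g ->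
  defect g z -> defect g z' -> drift_defect (fun w => z w - z' w).
Proof.
move=> Gg tg hz hz'.
have [gi [Ggi g1 g2]] := generated_inv Gg.
pose T := time g + 1.
have Gh : generated (smul gi (sexp T%:C 0)) by apply: genM => //; exact: gen_sexp0.
have ti : time gi = - time g.
  have := timeM (generated_nil Gg) (generated_nil Ggi).
  rewrite g1 -sexp00 time_sexp1 => h; lra.
have th : 0 < time (smul gi (sexp T%:C 0)).
  by rewrite timeM ?sexp_nil ?(generated_nil Ggi) // ti time_sexp /T; lra.
have [y hy] := defect_exists Gh th.
have E : smul g (smul gi (sexp T%:C 0)) = sexp T%:C 0 by rewrite smulA g1 smul1l.
have T0 : 0 < T by rewrite /T; lra.
have h1 := defectM (generated_nil Gg) (generated_nil Gh) hz hy.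
have h2 := defectM (generated_nil Gg) (generated_nil Gh) hz' hy.
rewrite E in h1 h2.
move/(drift_defect_any_time _ T0): h1; move/(drift_defect_any_time _ T0): h2 => h2 h1.
apply: drift_defect_ext (drift_defectD h1 (drift_defectZ (-1) h2)) => w _; ring.
Qed.

(** Spend the last half of the time of g on a pure drift whose defect
is the wanted correction. *)
Lemma defect_add g z z' : generated g -> 0 < time g ->
  defect g z -> drift_defect z' -> defect g (fun w => z w + z' w).
Proof.
move=> Gg tg hz hz'.
pose e := time g / 2.
have e0 : 0 < e by rewrite /e; lra.
have Gh : generated (smul g (sexp (- e)%:C 0)) by apply: genM => //; exact: gen_sexp0.
have th : 0 < time (smul g (sexp (- e)%:C 0)).
  by rewrite timeM ?sexp_nil ?(generated_nil Gg) // time_sexp /e; lra.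
have [y hy] := defect_exists Gh th.
have E : smul (smul g (sexp (- e)%:C 0)) (sexp e%:C 0) = g.
  by rewrite -smulA sexp0D -rmorphD addNr rmorph0 sexp00 smul1r.
have e1 : (sexp e%:C 0 : seq bool -> K) [::] = 1 by rewrite sexp_nil.
have V0 : defect (sexp e%:C 0) (fun=> 0).
  exact/defect_reachable/reachable_sexp0/ltW.
have h1 := defectM (generated_nil Gh) e1 hy V0.
rewrite E in h1.
have h2 := defect_sub Gg tg hz h1.
have h3 := drift_defectD h2 hz'; move/(drift_defect_any_time _ e0): h3 => h3.
have := defectM (generated_nil Gh) e1 hy h3; rewrite E.
apply: defect_ext => w _; ring.
Qed.

Definition reached g := defect g (fun=> 0).

Lemma reachedM g h : generated g -> generated h ->
  reached g -> reached h -> reached (smul g h).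
Proof.
move=> Gg Gh hg hh.
have := defectM (generated_nil Gg) (generated_nil Gh) hg hh.
by apply: defect_ext => w _; rewrite addr0.
Qed.

Lemma reached_of_drift_defect g z : generated g -> 0 < time g ->
  defect g z -> drift_defect z -> reached g.
Proof.
move=> Gg tg hz /(drift_defectZ (-1)) hV.
apply: defect_ext (defect_add Gg tg hz hV) => w _; ring.
Qed.

Lemma reached_cancel_l g h : generated g -> generated h -> 0 < time g -> 0 < time h ->
  reached (smul g h) -> reached g -> reached h.
Proof.
move=> Gg Gh tg th rgh rg; have [z hz] := defect_exists Gh th.
apply: (reached_of_drift_defect Gh th hz).
have := defectM (generated_nil Gg) (generated_nil Gh) rg hz => h1.
have tgh : 0 < time (smul g h).
  by rewrite timeM ?generated_nil // addr_gt0.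
apply: drift_defect_ext (defect_sub (genM Gg Gh) tgh h1 rgh) => w _; ring.
Qed.

Lemma reached_cancel_r g h : generated g -> generated h -> 0 < time g -> 0 < time h ->
  reached (smul g h) -> reached h -> reached g.
Proof.
move=> Gg Gh tg th rgh rg; have [z hz] := defect_exists Gg tg.
apply: (reached_of_drift_defect Gg tg hz).
have := defectM (generated_nil Gg) (generated_nil Gh) hz rg => h1.
have tgh : 0 < time (smul g h).
  by rewrite timeM ?generated_nil // addr_gt0.
apply: drift_defect_ext (defect_sub (genM Gg Gh) tgh h1 rgh) => w _; ring.
Qed.

(** A defect z of exp(t (X0 + X1)) produces two defects of its square: 2 z by
multiplication and 2^N z by dilating both letters.  Their difference is a
nonzero multiple of z. *)
Lemma reached_diagonal t : 0 < t -> reached (sexp t%:C t%:C).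
Proof.
move=> t0; have Gt := gen_sexpd t; have tt : 0 < time (sexp t%:C t%:C) by rewrite time_sexp.
have [z hz] := defect_exists Gt tt; apply: (reached_of_drift_defect Gt tt hz).
have e1 : (sexp t%:C t%:C : seq bool -> K) [::] = 1 by rewrite sexp_nil.
have h1 := defectM e1 e1 hz hz; rewrite sexpdD -rmorphD in h1.
have h2 := defect_letters 2%:C (ler0n R 2) hz.
have E : (fun w => letters 2%:C 2%:C w * sexp t%:C t%:C w) =
  sexp (t + t)%:C (t + t)%:C.
  by apply/funext => w; rewrite letters_sexp -rmorphM; congr (sexp _%:C _%:C w); ring.
rewrite E in h2.
have t2 : 0 < time (sexp (t + t)%:C (t + t)%:C) by rewrite time_sexp addr_gt0.
have h3 := defect_sub (gen_sexpd _) t2 h2 h1.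
have c0 : (2%:C ^+ N - 2 : K) != 0.
  rewrite -rmorphXn /= -(rmorph_nat (real_complex R)) -rmorphB.
  rewrite (fmorph_eq0 (real_complex R)) gt_eqF // subr_gt0.
  by rewrite -natrX ltr_nat -{1}(expn1 2) ltn_exp2l.
apply: drift_defect_ext (drift_defectZ (2%:C ^+ N - 2)^-1 h3) => w hw.
rewrite letters_same hw.
rewrite (_ : 2%:C ^+ N * z w - (z w + z w) = (2%:C ^+ N - 2) * z w) ?mulKf //.
by rewrite mulrBl mulr_natl mulr2n.
Qed.

Lemma reached_drift t g : generated g -> 0 < t -> 0 < time g ->
  reached (smul (sexp t%:C 0) g) -> reached g.
Proof.
move=> Gg t0 tg h; apply: (reached_cancel_l (gen_sexp0 t) Gg) => //.
  by rewrite time_sexp.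
exact/defect_reachable/reachable_sexp0/ltW.
Qed.

(** Being reached passes to products and can be cancelled, so it behaves like
membership in a subgroup once enough drift is added to make all times
positive.  It therefore extends from the generators to the group. *)
Lemma reached_large g : generated g ->
  exists2 M, 0 < M & forall t, M <= t -> reached (smul (sexp t%:C 0) g).
Proof.
have rd t : 0 < t -> reached (sexp t%:C 0).
  by move=> t0; exact/defect_reachable/reachable_sexp0/ltW.
elim => [t|b|t|{}g h Gg [M M0 hM] Gh [M' M'0 hM']].
- exists (`|t| + 1); first by rewrite ltr_wpDl.
  move=> u hu; rewrite sexp0D -rmorphD; apply: rd.
  have := ler_norm (- t); rewrite normrN; lra.
- exists 1 => // t t1; apply/defect_reachable/reachable_step; lra.
- exists (`|t| + 1); first by rewrite ltr_wpDl.
  move=> u hu.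
  have u0 : 0 < u by have := normr_ge0 t; lra.
  have ut : 0 < u + t by have := ler_norm (- t); rewrite normrN; lra.
  have [t0|t0|t0] := ltrgtP t 0.
  + apply: (@reached_cancel_r _ (sexp (- t)%:C (- t)%:C)).
    * by apply: genM; [exact: gen_sexp0|exact: gen_sexpd].
    * exact: gen_sexpd.
    * by rewrite timeM ?sexp_nil // !time_sexp.
    * by rewrite time_sexp oppr_gt0.
    * by rewrite -smulA sexpdD -rmorphD subrr rmorph0 sexp00 smul1r; apply: rd.
    * by apply: reached_diagonal; rewrite oppr_gt0.
  + apply: reachedM; [exact: gen_sexp0|exact: gen_sexpd|exact: rd|].
    exact: reached_diagonal.
  + by rewrite t0 rmorph0 sexp00 smul1r; apply: rd.
- pose T := M + M' + `|time g| + `|time h|.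
  have T0 : 0 < T by rewrite /T; have := normr_ge0 (time g);
     have := normr_ge0 (time h); lra.
  exists T => // t tT; have t0 : 0 < t by lra.
  (* T is so large that g, h and their product have positive time after a drift by t *)
  have Gt : generated (sexp t%:C 0) by exact: gen_sexp0.
  have [gn hn] := (generated_nil Gg, generated_nil Gh).
  have mg := ler_norm (- time g); have mh := ler_norm (- time h).
  rewrite !normrN in mg mh.
  have [g0 h0] := (normr_ge0 (time g), normr_ge0 (time h)).
  have rg : reached (smul (sexp t%:C 0) g) by apply: hM; rewrite /T in tT; lra.
  have rh : reached (smul (sexp t%:C 0) h) by apply: hM'; rewrite /T in tT; lra.
  have thr : 0 < time (smul h (sexp t%:C 0)).
    by rewrite timeM ?sexp_nil // time_sexp /T in tT *; lra.

  (* the drift can be moved from the left of h to its right *)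
  have rh' : reached (smul h (sexp t%:C 0)).
    apply: (reached_drift _ t0 thr); first exact: genM.
    by rewrite smulA; apply: reachedM => //; [exact: genM|exact: rd].
  have r1 : reached (smul (smul (smul (sexp t%:C 0) g) h) (sexp t%:C 0)).
    by rewrite -smulA; apply: reachedM => //; apply: genM.
  apply: (reached_cancel_r _ Gt _ _ _ (rd _ t0)).
  + by apply: genM => //; apply: genM.
  + rewrite !timeM ?time_sexp ?sexp_nil // ?smul0 ?gn ?hn ?mulr1 //.
    by rewrite /T in tT; lra.
  + by rewrite time_sexp.
  + by rewrite smulA.
Qed.

Lemma reached_all g : generated g -> 0 < time g -> reached g.
Proof.
move=> Gg tg; have [M M0 hM] := reached_large Gg.
by apply: (reached_drift Gg M0 tg); apply: hM.
Qed.

End Defects.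

(** Degree 1 is a direct computation: a series of positive time t has the same
terms of degree at most 1 as exp(t X0) exp(b X1). *)
Theorem generated_reachable N g : (1 <= N)%N -> generated g -> 0 < time g ->
  exists2 s, reachable s & forall w, (size w <= N)%N -> s w = g w.
Proof.
case: N => // N _; elim: N g => [|N IH] g Gg tg.
  exists (smul (sexp (time g)%:C 0) (sexp 0 (g [:: true]))).
    exact/reachable_step/ltW.
  case=> [|[] [|? ?]] //= _.
  - by rewrite !sexp_nil (generated_nil Gg) mulr1.
  - by rewrite !sexp_nil !sexp_true mul1r mul0r addr0.
  - by rewrite !sexp_nil !sexp_false mul1r add0r mulr1 (generated_false Gg).
have [//| |s Ss [sl sN]] := @reached_all N.+2 _ _ g Gg tg.
  by move=> h Gh th; have [s Ss hs] := IH h Gh th; exists s.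
exists s => // w; rewrite leq_eqVlt => /orP[/eqP hw|]; last exact: sl.
by rewrite sN // addr0.
Qed.

End Reachability.

(** * Compactness of intervals *)

Section Cousin.
Context {R : realType}.

(** Induction over a compact interval: a property of intervals that is stable
under concatenation and holds for short intervals around each point holds for
the whole interval. *)
Lemma cousin (P : R -> R -> Prop) (a b : R) : a <= b ->
  (forall x y z, a <= x -> x <= y -> y <= z -> z <= b -> P x y -> P y z -> P x z) ->
  (forall t, a <= t <= b -> exists2 d, 0 < d & forall x y,
     a <= x -> x <= t -> t <= y -> y <= b -> y - x <= d -> P x y) ->
  P a b.
Proof.
move=> ab Pcat Ploc.
pose E := [set x | a <= x <= b /\ P a x].
have Ea : E a.
  split; first by rewrite lexx.
  by have [|d d0] := Ploc a; rewrite ?lexx //; apply; rewrite ?lexx // subrr ltW.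
have hE : has_sup E by split; [exists a|exists b => x [/andP[]]].
set s := sup E.
have as_ : a <= s by apply: sup_ubound => //; exact: hE.2.
have sb : s <= b by apply: ge_sup; [exists a|move=> x [/andP[]]].
have [|d d0 hd] := Ploc s; first by rewrite as_.
have [x [/andP[ax xb] Px] sx] := sup_adherent d0 hE.
rewrite -/s in sx.
have xs : x <= s by apply: sup_ubound; [exact: hE.2|split => //; rewrite ax].
pose y := Num.min b (x + d).
have yb : y <= b by rewrite /y ge_min lexx.
have yxd : y <= x + d by rewrite /y ge_min lexx orbT.
have sy : s <= y by rewrite /y le_min sb /=; lra.
have Py : P a y.
  apply: (Pcat a x y) => //; first lra.
  by apply: hd => //; lra.
have ysup : y <= s.
  apply: sup_ubound; first exact: hE.2.
  by split => //; apply/andP; split => //; lra.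
have [bx|bx] := leP b (x + d); first by move: Py; rewrite /y (min_idPl bx).
by move: ysup; rewrite /y (min_idPr (ltW bx)) => ?; lra.
Qed.

End Cousin.

(** Norms with values in the reals, for which estimates take place in a totally
ordered field; the additive groups are R, C and C^d. *)
Record seminorm (R : realType) (V : zmodType) := SemiNorm {
  snorm :> V -> R;
  snorm_ge0 : forall x, 0 <= snorm x;
  snormD : forall x y, snorm (x + y) <= snorm x + snorm y;
  snormN : forall x, snorm (- x) = snorm x;
  snorm0 : snorm 0 = 0 }.

Section Frechet.
Context {R : realType}.
Implicit Types (V W : zmodType).

Lemma snormB V (N : seminorm R V) x y : N (x - y) <= N x + N y.
Proof. by rewrite (le_trans (snormD _ _ _)) // snormN. Qed.

Lemma snorm_sum V (N : seminorm R V) (I : Type) (r : seq I) (F : I -> V) :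
  N (\sum_(i <- r) F i) <= \sum_(i <- r) N (F i).
Proof.
elim: r => [|i r IH]; first by rewrite !big_nil snorm0.
by rewrite !big_cons (le_trans (snormD _ _ _)) // lerD2l.
Qed.

Definition cont V W (N : seminorm R V) (M : seminorm R W) (u : V -> W) x :=
  forall e : R, 0 < e -> exists2 d : R, 0 < d &
    forall k, N k <= d -> M (u (x + k) - u x) <= e.

(** A is only required to be bounded, so that differentiability over the reals
and over the complex numbers, of functions with values in C or C^d, are
instances of the same notion; additivity of A is asked for where it is used. *)
Definition frechet V W (N : seminorm R V) (M : seminorm R W) (u : V -> W) x
    (A : V -> W) :=
  (exists2 a : R, 0 <= a & forall k, M (A k) <= a * N k) /\
  forall e : R, 0 < e -> exists2 d : R, 0 < d &
    forall k, N k <= d -> M (u (x + k) - u x - A k) <= e * N k.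

Section Basic.
Context {V W : zmodType} {N : seminorm R V} {M : seminorm R W}.
Implicit Types (u v : V -> W) (A B : V -> W).

Lemma frechet_lip u x A : frechet N M u x A ->
  exists2 a : R, 0 < a & exists2 d : R, 0 < d &
    forall k, N k <= d -> M (u (x + k) - u x) <= a * N k.
Proof.
move=> [[a a0 ha] h]; exists (a + 1); first lra.
have [d d0 hd] := h 1 ltr01; exists d => // k kd.
rewrite -[_ - u x](subrK (A k)) (le_trans (snormD _ _ _)) //.
have := ha k; have := hd k kd; lra.
Qed.

Lemma frechet_cont u x A : frechet N M u x A -> cont N M u x.
Proof.
move=> /frechet_lip[a a0 [d d0 hd]] e e0.
exists (Num.min d (e / a)); first by rewrite lt_min d0 divr_gt0.
move=> k; rewrite le_min => /andP[kd ke].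
by rewrite (le_trans (hd _ kd)) // mulrC -ler_pdivlMr.
Qed.

Lemma eq_frechet u v x A B : u =1 v -> A =1 B ->
  frechet N M u x A -> frechet N M v x B.
Proof. by move=> /funext -> /funext ->. Qed.

Lemma frechet_cst c x : frechet N M (fun=> c) x (fun=> 0).
Proof.
split; first by exists 0 => // k; rewrite snorm0 mul0r.
move=> e e0; exists 1 => // k _; rewrite !subrr snorm0.
by rewrite mulr_ge0 ?snorm_ge0 // ltW.
Qed.

Lemma frechet_lin A x a : 0 <= a -> (forall h k, A (h + k) = A h + A k) ->
  (forall k, M (A k) <= a * N k) -> frechet N M A x A.
Proof.
move=> a0 Aadd hA; split; first by exists a.
move=> e e0; exists 1 => // k _; rewrite Aadd (addrC (A x)) addrK subrr snorm0.
by rewrite mulr_ge0 ?snorm_ge0 // ltW.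
Qed.

Lemma frechetD u v x A B : frechet N M u x A -> frechet N M v x B ->
  frechet N M (fun y => u y + v y) x (fun k => A k + B k).
Proof.
move=> [[a a0 ha] hu] [[b b0 hb] hv]; split.
  exists (a + b); first exact: addr_ge0.
  by move=> k; rewrite (le_trans (snormD _ _ _)) // mulrDl lerD.
move=> e e0; have e2 : 0 < e / 2 by lra.
have [d d0 hd] := hu _ e2; have [d' d'0 hd'] := hv _ e2.
exists (Num.min d d'); first by rewrite lt_min d0.
move=> k; rewrite le_min => /andP[kd kd'].
have -> : u (x + k) + v (x + k) - (u x + v x) - (A k + B k) =
  (u (x + k) - u x - A k) + (v (x + k) - v x - B k).
  by rewrite addrACA -opprD (addrACA (u (x + k))) -opprD.
rewrite (le_trans (snormD _ _ _)) //; have := hd _ kd; have := hd' _ kd'; lra.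
Qed.

Lemma frechetN u x A : frechet N M u x A ->
  frechet N M (fun y => - u y) x (fun k => - A k).
Proof.
move=> [[a a0 ha] hu]; split; first by exists a => // k; rewrite snormN.
move=> e e0; have [d d0 hd] := hu _ e0; exists d => // k kd.
by rewrite -snormN !opprD !opprK hd.
Qed.

Lemma frechetB u v x A B : frechet N M u x A -> frechet N M v x B ->
  frechet N M (fun y => u y - v y) x (fun k => A k - B k).
Proof. by move=> hu /frechetN; exact: frechetD. Qed.

Lemma contD u v x : cont N M u x -> cont N M v x -> cont N M (fun y => u y + v y) x.
Proof.
move=> hu hv e e0; have e2 : 0 < e / 2 by lra.
have [d d0 hd] := hu _ e2; have [d' d'0 hd'] := hv _ e2.
exists (Num.min d d'); first by rewrite lt_min d0.
move=> k; rewrite le_min => /andP[kd kd'].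
rewrite opprD addrACA (le_trans (snormD _ _ _)) //.
have := hd _ kd; have := hd' _ kd'; lra.
Qed.

Lemma contN u x : cont N M u x -> cont N M (fun y => - u y) x.
Proof.
move=> hu e e0; have [d d0 hd] := hu _ e0; exists d => // k kd.
by rewrite -snormN opprB opprK addrC hd.
Qed.

Lemma contB u v x : cont N M u x -> cont N M v x -> cont N M (fun y => u y - v y) x.
Proof. by move=> hu /contN; exact: contD. Qed.

Lemma cont_cst c x : cont N M (fun=> c) x.
Proof. by move=> e e0; exists 1 => // k _; rewrite subrr snorm0 ltW. Qed.

End Basic.

Lemma cont_sum V W (N : seminorm R V) (M : seminorm R W) (I : Type) (r : seq I)
  (F : I -> V -> W) x : (forall i, cont N M (F i) x) ->
  cont N M (fun y => \sum_(i <- r) F i y) x.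
Proof.
move=> hF; elim: r => [|i r IH].
  rewrite (_ : (fun y => _) = fun=> 0); first exact: cont_cst.
  by apply/funext => y; rewrite big_nil.
rewrite (_ : (fun y => _) = fun y => F i y + \sum_(j <- r) F j y); last first.
  by apply/funext => y; rewrite big_cons.
exact: contD.
Qed.

Section Composition.
Context {V W X : zmodType} {N : seminorm R V} {M : seminorm R W} {L : seminorm R X}.

Lemma cont_comp (u : V -> W) (v : W -> X) x :
  cont N M u x -> cont M L v (u x) -> cont N L (v \o u) x.
Proof.
move=> hu hv e e0; have [d d0 hd] := hv _ e0; have [d' d'0 hd'] := hu _ d0.
exists d' => // k kd /=; have := hd _ (hd' _ kd).
by rewrite (addrC (u x)) subrK.
Qed.

(** The usual chain rule; only the outer differential has to be additive. *)
Lemma frechet_comp (u : V -> W) (v : W -> X) x A B :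
  (forall h k, B (h + k) = B h + B k) ->
  frechet N M u x A -> frechet M L v (u x) B ->
  frechet N L (v \o u) x (B \o A).
Proof.
move=> Badd hu hv.
have [[a a0 ha] hu2] := hu; have [[b b0 hb] hv2] := hv.
have [l l0 [dl dl0 hl]] := frechet_lip hu.
split.
  exists (b * a); first exact: mulr_ge0.
  by move=> k /=; rewrite (le_trans (hb _)) // -mulrA ler_wpM2l.
move=> e e0.
pose e1 := e / 2 / l; pose e2 := e / 2 / (b + 1).
have e10 : 0 < e1 by rewrite !divr_gt0.
have e20 : 0 < e2 by rewrite !divr_gt0 // ltr_wpDl.
have [d1 d10 hd1] := hv2 _ e10; have [d2 d20 hd2] := hu2 _ e20.
exists (Num.min (d1 / l) (Num.min d2 dl)).
  by rewrite !lt_min d20 dl0 divr_gt0.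
move=> k; rewrite !le_min => /andP[k1 /andP[k2 kl]] /=.
pose q := u (x + k) - u x.
have hq : M q <= l * N k by exact: hl.
have hq1 : M q <= d1 by rewrite (le_trans hq) // mulrC -ler_pdivlMr.
have eq1 : u (x + k) = u x + q by rewrite /q (addrC (u x)) subrK.
have eqB : B q = B (q - A k) + B (A k) by rewrite -Badd subrK.
rewrite eq1.
have -> : v (u x + q) - v (u x) - B (A k) =
  (v (u x + q) - v (u x) - B q) + B (q - A k).
  by rewrite eqB opprD !addrA addrAC (addrAC _ (- B (q - A k))) addrNK.
rewrite (le_trans (snormD _ _ _)) //.
have i1 := hd1 _ hq1.
have i2 := hb (q - A k).
have i3 := hd2 _ k2; rewrite -/q in i3.
have i4 : e1 * M q <= e / 2 * N k.
  by rewrite (le_trans (ler_wpM2l (ltW e10) hq)) // mulrA /e1 divfK ?gt_eqF.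
have b1 : 0 < b + 1 by lra.
have i5 : b * M (q - A k) <= e / 2 * N k.
  rewrite (@le_trans _ _ ((b + 1) * M (q - A k))) //.
    by rewrite ler_wpM2r ?snorm_ge0 //; lra.
  by rewrite mulrC -ler_pdivlMr // mulrAC.
lra.
Qed.

End Composition.

End Frechet.

(** * Differential calculus with real-valued norms *)

Section Norms.
Context {R : realType}.
Local Notation K := R[i].

Definition absn : seminorm R R :=
  @SemiNorm R R (fun x => `|x|) (@normr_ge0 _ _) (@ler_normD _ _) (@normrN _ _)
    (normr0 _).

Definition cnorm (z : K) : R := `|complex.Re z| + `|complex.Im z|.

Lemma cnorm_ge0 z : 0 <= cnorm z. Proof. exact: addr_ge0. Qed.
Lemma cnormD x y : cnorm (x + y) <= cnorm x + cnorm y.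
Proof. by case: x y => a b [c d]; rewrite /cnorm /= addrACA lerD // ler_normD. Qed.
Lemma cnormN x : cnorm (- x) = cnorm x.
Proof. by case: x => a b; rewrite /cnorm /= !normrN. Qed.
Lemma cnorm0 : cnorm 0 = 0. Proof. by rewrite /cnorm /= normr0 addr0. Qed.

(** The l1 norm of the plane, submultiplicative and linear in the absolute
values of the real and imaginary parts. *)
Definition cn : seminorm R K := SemiNorm cnorm_ge0 cnormD cnormN cnorm0.

Lemma cnE z : cn z = `|complex.Re z| + `|complex.Im z|. Proof. by []. Qed.

Lemma cnM x y : cn (x * y) <= cn x * cn y.
Proof.
case: x y => a b [c d]; rewrite !cnE /= mulrDl !mulrDr -!normrM.
have := ler_normB (a * c) (b * d); have := ler_normD (a * d) (b * c).
lra.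
Qed.

Lemma cn_real (r : R) : cn r%:C = `|r|.
Proof. by rewrite cnE /= normr0 addr0. Qed.

Lemma cn_realM (r : R) z : cn (r%:C * z) = `|r| * cn z.
Proof.
by case: z => a b; rewrite !cnE /= !mul0r subr0 addr0 !normrM mulrDr.
Qed.

Lemma cn_iM z : cn ('i%C * z) = cn z.
Proof.
by case: z => a b; rewrite !cnE /= !mul0r !mul1r !add0r normrN addrC.
Qed.

Lemma cn_eq0 z : cn z <= 0 -> z = 0.
Proof.
case: z => a b; rewrite cnE /= => h.
have := normr_ge0 a; have := normr_ge0 b => hb ha.
have a0 : `|a| = 0 by lra.
have b0 : `|b| = 0 by lra.
by rewrite (normr0_eq0 a0) (normr0_eq0 b0).
Qed.

Section Product.
Context {V : zmodType} {N : seminorm R V}.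
Implicit Types u v : V -> K.

Lemma contM u v x : cont N cn u x -> cont N cn v x -> cont N cn (fun y => u y * v y) x.
Proof.
move=> hu hv e e0.
pose c := cn (u x) + cn (v x) + 1.
have c0 : 0 < c by have := cnorm_ge0 (u x); have := cnorm_ge0 (v x); rewrite /c /=; lra.
pose e1 := Num.min 1 (e / c).
have e10 : 0 < e1 by rewrite lt_min ltr01 divr_gt0.
have [d d0 hd] := hu _ e10; have [d' d'0 hd'] := hv _ e10.
exists (Num.min d d'); first by rewrite lt_min d0.
move=> k; rewrite le_min => /andP[/hd kd /hd' kd'].
set p := u (x + k) - u x in kd; set q := v (x + k) - v x in kd'.
have -> : u (x + k) * v (x + k) - u x * v x = u x * q + p * v x + p * q.
  by rewrite /p /q; ring.
have h1 : e1 <= 1 by rewrite ge_min lexx.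
have h2 : e1 * c <= e by rewrite -ler_pdivlMr // ge_min lexx orbT.
have t1 := snormD cn (u x * q + p * v x) (p * q).
have t2 := snormD cn (u x * q) (p * v x).
have m1 := cnM (u x) q; have m2 := cnM p (v x); have m3 := cnM p q.
have a1 : cn (u x) * cn q <= cn (u x) * e1 by rewrite ler_wpM2l ?snorm_ge0.
have a2 : cn p * cn (v x) <= e1 * cn (v x) by rewrite ler_wpM2r ?snorm_ge0.
have a3 : cn p * cn q <= e1 * 1.
  by rewrite ler_pM ?snorm_ge0 // (le_trans kd').
by rewrite /c in h2; lra.
Qed.

Lemma frechetM u v x A B : frechet N cn u x A -> frechet N cn v x B ->
  frechet N cn (fun y => u y * v y) x (fun k => u x * B k + A k * v x).
Proof.
move=> hu hv; have [[a a0 ha] hu2] := hu; have [[b b0 hb] hv2] := hv.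
have [l l0 [d1 d10 hl]] := frechet_lip hu; have [m m0 [d2 d20 hm]] := frechet_lip hv.
split.
  exists (cn (u x) * b + a * cn (v x)).
    by rewrite addr_ge0 // mulr_ge0 ?snorm_ge0.
  move=> k; rewrite (le_trans (snormD _ _ _)) // mulrDl lerD //.
    by rewrite (le_trans (cnM _ _)) // -mulrA ler_wpM2l ?snorm_ge0.
  by rewrite (le_trans (cnM _ _)) // mulrAC ler_wpM2r ?snorm_ge0.
move=> e e0.
pose c := cn (u x) + cn (v x) + 1.
have c0 : 0 < c by have := cnorm_ge0 (u x); have := cnorm_ge0 (v x); rewrite /c /=; lra.
have e10 : 0 < e / c by rewrite divr_gt0.
have [d3 d30 hd3] := hu2 _ e10; have [d4 d40 hd4] := hv2 _ e10.
exists (Num.min (Num.min d1 d2) (Num.min (Num.min d3 d4) (e / c / (l * m)))).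
  by rewrite !lt_min d10 d20 d30 d40 !divr_gt0 // mulr_gt0.
move=> k; rewrite !le_min => /andP[/andP[/hl k1 /hm k2] /andP[/andP[/hd3 k3 /hd4 k4] k5]].
set p := u (x + k) - u x in k1; set q := v (x + k) - v x in k2.
set r := _ - A k in k3; set s := _ - B k in k4.
have -> : u (x + k) * v (x + k) - u x * v x - (u x * B k + A k * v x) =
   u x * s + r * v x + p * q.
  by rewrite /p /q /r /s; ring.
have t1 := snormD cn (u x * s + r * v x) (p * q).
have t2 := snormD cn (u x * s) (r * v x).
have m1 := cnM (u x) s; have m2 := cnM r (v x); have m3 := cnM p q.
have a1 : cn (u x) * cn s <= cn (u x) * (e / c * N k) by rewrite ler_wpM2l ?snorm_ge0.
have a2 : cn r * cn (v x) <= (e / c * N k) * cn (v x) by rewrite ler_wpM2r ?snorm_ge0.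
have a3 : cn p * cn q <= e / c * N k.
  apply: (@le_trans _ _ ((l * N k) * (m * N k))).
    by rewrite ler_pM ?snorm_ge0.
  rewrite mulrACA mulrA ler_wpM2r ?snorm_ge0 // mulrC -ler_pdivlMr //.
  exact: mulr_gt0.
have -> : e * N k = e / c * N k * c by field; rewrite gt_eqF.
by rewrite /c; lra.
Qed.

Lemma contZ c u x : cont N cn u x -> cont N cn (fun y => c * u y) x.
Proof. by apply: contM; exact: cont_cst. Qed.

Lemma frechetZ c u x A : frechet N cn u x A ->
  frechet N cn (fun y => c * u y) x (fun k => c * A k).
Proof.
move=> h; apply: eq_frechet (frechetM (frechet_cst c x) h) => // k.
by rewrite mul0r addr0.
Qed.

End Product.

(** The bound passes from short intervals to [a, b] by concatenation, up to an
arbitrarily small loss in the constant. *)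
Lemma mean_value (W : zmodType) (M : seminorm R W) (u : R -> W) (B a b : R) :
  a <= b ->
  (forall t, a <= t <= b -> exists2 A, frechet absn M u t A &
      forall h, M (A h) <= B * `|h|) ->
  M (u b - u a) <= B * (b - a).
Proof.
move=> ab hu; apply/ler_addgt0Pr => e e0.
have [->|anb] := eqVneq a b; first by rewrite !subrr snorm0 mulr0 add0r ltW.
have ba : 0 < b - a by rewrite subr_gt0 lt_neqAle anb.
pose e1 := e / (b - a).
have e10 : 0 < e1 by rewrite divr_gt0.
rewrite (_ : B * (b - a) + e = (B + e1) * (b - a)); last first.
  by rewrite /e1; field; rewrite gt_eqF.
apply: (@cousin R (fun x y => M (u y - u x) <= (B + e1) * (y - x))) => //.
  move=> x y z _ _ _ _ hxy hyz.
  have -> : u z - u x = (u z - u y) + (u y - u x) by rewrite addrA subrK.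
  rewrite (le_trans (snormD _ _ _)) //.
  have -> : (B + e1) * (z - x) = (B + e1) * (z - y) + (B + e1) * (y - x) by ring.
  exact: lerD.
move=> t tab; have [A [_ hA] hB] := hu t tab.
have [d d0 hd] := hA _ e10.
have h k : `|k| <= d -> M (u (t + k) - u t) <= (B + e1) * `|k|.
  move=> kd; rewrite -[_ - u t](subrK (A k)) (le_trans (snormD _ _ _)) //.
  by rewrite mulrDl addrC lerD // ?hB // hd.
exists d => // x y _ xt ty _ xyd.
have -> : u y - u x = (u y - u t) + (u t - u x) by rewrite addrA subrK.
rewrite (le_trans (snormD _ _ _)) //.
have -> : (B + e1) * (y - x) = (B + e1) * `|y - t| + (B + e1) * `|x - t|.
  by rewrite -mulrDr ger0_norm ?subr_ge0 // ler0_norm ?subr_le0 // opprB addrA subrK.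
apply: lerD.
  have -> : u y - u t = u (t + (y - t)) - u t by rewrite (addrC t) subrK.
  by apply: h; rewrite ger0_norm; lra.
rewrite -snormN opprB.
have -> : u x - u t = u (t + (x - t)) - u t by rewrite (addrC t) subrK.
by apply: h; rewrite ler0_norm; lra.
Qed.

Lemma is_derive_frechet (f : R -> R) (t v : R) : is_derive t 1 f v ->
  frechet absn absn f t (fun h => h * v).
Proof.
move=> [df fv]; split.
  by exists `|v| => // k /=; rewrite normrM mulrC.
move=> e e0.
have : h^-1 *: (f (h *: 1 + t) - f t) @[h --> (0 : R)^'] --> v.
  by rewrite -fv; exact: df.
move/cvgrPdist_le => /(_ _ e0) [d /= d0 hd].
exists (d / 2); first by rewrite divr_gt0.
move=> k kd; have [->|k0] := eqVneq k 0.
  by rewrite mul0r addr0 !subrr normr0 mulr0.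
have := hd k; rewrite /= sub0r normrN => /(_ _ k0) h.
have {}h : `|v - k^-1 *: (f (k *: 1 + t) - f t)| <= e.
  by apply: h; rewrite (le_lt_trans kd) // ltr_pdivrMr // mulr2n; lra.
move: h; rewrite distrC /GRing.scale /= mulr1 (addrC k t) => h.
have -> : f (t + k) - f t - k * v = k * (k^-1 * (f (t + k) - f t) - v).
  by rewrite mulrBr mulVKf.
by rewrite normrM mulrC ler_wpM2r.
Qed.

End Norms.
(* sealed, so that estimates treat the value of the norm as an atom *)
Global Opaque cn.

(** * Primitives and integrals of continuous curves *)

Section Primitive.
Context {R : realType}.
Local Notation K := R[i].
Local Notation absn := (@absn R).
Local Notation cn := (@cn R).

Lemma cont_continuous (f : R -> R) : (forall x, cont absn absn f x) -> continuous f.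
Proof.
move=> hf x; apply/cvgrPdist_le => e e0; have [d d0 hd] := hf x e e0.
near=> y.
have -> : y = x + (y - x) by rewrite addrC subrK.
rewrite distrC; apply: hd; rewrite /= distrC.
by near: y; exact: cvgr_dist_le.
Unshelve. all: by end_near. Qed.

(** The fundamental theorem of calculus for the integral from a. *)
Lemma primitive_above (f : R -> R) (a : R) : (forall x, cont absn absn f x) ->
  exists F : R -> R, forall x, a < x -> frechet absn absn F x (fun h => h * f x).
Proof.
move=> /cont_continuous cf.
pose F (x : R) := (\int[lebesgue_measure]_(t in [set` `[a, x]]) f t)%R.
exists F => x ax; apply: is_derive_frechet.
have intf : lebesgue_measure.-integrable `[a, x + 1] (EFin \o f).
  apply: continuous_compact_integrable; first exact: segment_compact.
  exact: continuous_subspaceT.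
have xx : x < x + 1 by rewrite ltrDl.
have [dF F'] := continuous_FTC1_closed xx intf ax (cf x).
by split; [exact: dF|rewrite -derive1E; exact: F'].
Qed.

Lemma frechet0_const (W : zmodType) (M : seminorm R W) (u : R -> W) (a b : R) :
  a <= b -> (forall t, a <= t <= b -> frechet absn M u t (fun=> 0)) ->
  M (u b - u a) <= 0.
Proof.
move=> ab h; rewrite -(mul0r (b - a)); apply: mean_value => // t tab.
by exists (fun=> 0); [exact: h|move=> k; rewrite snorm0 mul0r].
Qed.

(** The primitives on the half-lines above a glue as a decreases, once they
are normalized to vanish at 0. *)
Lemma primitive (f : R -> R) : (forall x, cont absn absn f x) ->
  exists F : R -> R, forall x, frechet absn absn F x (fun h => h * f x).
Proof.
move=> cf.
have /choice[F hF] : forall a, exists F : R -> R, forall x, a < x ->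
    frechet absn absn F x (fun h => h * f x).
  by move=> a; exact: primitive_above.
pose G x := F (- (`|x| + 1)) x - F (- (`|x| + 1)) 0.
have GE a x : a < x -> a < 0 -> G x = F a x - F a 0.
  move=> ax a0.
  (* on the common domain the two primitives differ by a constant *)
  pose c := - (`|x| + 1); rewrite /G -/c.
  have cx : c < x by rewrite /c; have := ler_norm (- x); rewrite normrN; lra.
  have c0 : c < 0 by rewrite /c; have := normr_ge0 x; lra.
  have D t : a < t -> c < t -> frechet absn absn (fun s => F c s - F a s) t (fun=> 0).
    move=> at_ ct; apply: eq_frechet (frechetB (hF _ _ ct) (hF _ _ at_)) => // k.
    by rewrite subrr.
  have E s t : s <= t -> a < s -> c < s -> F c t - F a t = F c s - F a s.
    move=> st as_ cs; apply/eqP; rewrite -subr_eq0 -normr_le0.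
    apply: (frechet0_const (M := absn) (u := fun s => F c s - F a s) st).
    by move=> r /andP[sr rt]; apply: D; [exact: lt_le_trans sr|exact: lt_le_trans sr].
  have [x0|x0] := leP 0 x.
    by have := E 0 x x0 a0 c0; lra.
  by have := E x 0 (ltW x0) ax cx; lra.
exists G => x.
pose a := - (`|x| + 1).
have ax : a < x by rewrite /a; have := ler_norm (- x); rewrite normrN; lra.
have a0 : a < 0 by rewrite /a; have := normr_ge0 x; lra.
have [h1 h2] := hF _ _ ax; split=> // e e0.
have [d d0 hd] := h2 e e0.
exists (Num.min d ((x - a) / 2)).
  by rewrite lt_min d0 /= divr_gt0 // subr_gt0.
move=> k; rewrite le_min => /andP[kd ka].
have axk : a < x + k.
  have := ler_norm (- k); rewrite normrN; have : `|k| <= (x - a) / 2 by [].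
  lra.
by rewrite (GE a) // (GE a) // opprB addrA subrK; exact: hd.
Qed.

Definition rder (u : R -> K) (t : R) (v : K) :=
  frechet absn cn u t (fun h => h%:C * v).

Lemma cont_Re (V : zmodType) (N : seminorm R V) (u : V -> K) x :
  cont N cn u x -> cont N absn (fun y => complex.Re (u y)) x.
Proof.
move=> h e e0; have [d d0 hd] := h e e0; exists d => // k /hd.
case: (u (x + k)) (u x) => [a b] [c d']; rewrite cnE /=.
by have := normr_ge0 (b - d'); lra.
Qed.

Lemma cont_Im (V : zmodType) (N : seminorm R V) (u : V -> K) x :
  cont N cn u x -> cont N absn (fun y => complex.Im (u y)) x.
Proof.
move=> h e e0; have [d d0 hd] := h e e0; exists d => // k /hd.
case: (u (x + k)) (u x) => [a b] [c d']; rewrite cnE /=.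
by have := normr_ge0 (a - c); lra.
Qed.

Lemma rder_pair (f g : R -> R) t a b :
  frechet absn absn f t (fun h => h * a) -> frechet absn absn g t (fun h => h * b) ->
  rder (fun s => f s +i* g s) t (a +i* b).
Proof.
move=> [_ hf] [_ hg]; split.
  by exists (cn (a +i* b)) => [|k]; rewrite ?snorm_ge0 // cn_realM mulrC.
move=> e e0; have e2 : 0 < e / 2 by lra.
have [d d0 hd] := hf _ e2; have [d' d'0 hd'] := hg _ e2.
exists (Num.min d d'); first by rewrite lt_min d0.
move=> k; rewrite le_min => /andP[/hd kd /hd' kd'].
rewrite cnE /= !mul0r subr0 addr0.
by move: kd kd' => /=; lra.
Qed.

Lemma cprimitive (u : R -> K) : (forall t, cont absn cn u t) ->
  exists U, forall t, rder U t (u t).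
Proof.
move=> cu; have [F hF] := primitive (fun x => cont_Re (cu x)).
have [G hG] := primitive (fun x => cont_Im (cu x)).
exists (fun s => F s +i* G s) => t; have := rder_pair (hF t) (hG t).
by case: (u t).
Qed.

Lemma rderB u v t a b : rder u t a -> rder v t b -> rder (fun s => u s - v s) t (a - b).
Proof.
by move=> hu hv; apply: eq_frechet (frechetB hu hv) => // k; rewrite mulrBr.
Qed.

Lemma rderZ c u t a : rder u t a -> rder (fun s => c * u s) t (c * a).
Proof. by move=> hu; apply: eq_frechet (frechetZ c hu) => // k; rewrite mulrCA. Qed.

(** Integral of a continuous curve, through a chosen primitive; the result does
not depend on the choice. *)
Definition cint (u : R -> K) (a b : R) : K :=
  let U := get [set U : R -> K | forall t, rder U t (u t)] in U b - U a.

Lemma cintE u U a b : (forall t, rder U t (u t)) -> cint u a b = U b - U a.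
Proof.
move=> hU; rewrite /cint; set U' := get _.
have hU' : forall t, rder U' t (u t).
  by apply: (@getPex _ [set U | forall t, rder U t (u t)]); exists U.
have E s t : s <= t -> U' t - U t = U' s - U s.
  move=> st; apply/eqP; rewrite -subr_eq0; apply/eqP/cn_eq0.
  apply: (frechet0_const (M := cn) (u := fun s => U' s - U s) st) => r _.
  apply: eq_frechet (rderB (hU' r) (hU r)) => // k.
  by rewrite subrr mulr0.
have {}E : U' b - U b = U' a - U a.
  by have [ab|ab] := leP a b; [exact: E|rewrite -(E b a) // ltW].
by rewrite -[U' b](subrK (U b)) E; ring.
Qed.

Lemma cint_cat u a b c : cint u a c = cint u a b + cint u b c.
Proof. by rewrite /cint; ring. Qed.

Lemma cintB u v a b : (forall t, cont absn cn u t) -> (forall t, cont absn cn v t) ->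
  cint (fun t => u t - v t) a b = cint u a b - cint v a b.
Proof.
move=> /cprimitive[U hU] /cprimitive[V hV].
rewrite (cintE a b hU) (cintE a b hV) (@cintE _ (fun t => U t - V t)); first by ring.
by move=> t; exact: rderB.
Qed.

Lemma cintZ c u a b : (forall t, cont absn cn u t) ->
  cint (fun t => c * u t) a b = c * cint u a b.
Proof.
move=> /cprimitive[U hU]; rewrite (cintE a b hU) (@cintE _ (fun t => c * U t)).
  by ring.
by move=> t; exact: rderZ.
Qed.

Lemma cint_bound u a b B : (forall t, cont absn cn u t) -> a <= b ->
  (forall t, a <= t <= b -> cn (u t) <= B) -> cn (cint u a b) <= B * (b - a).
Proof.
move=> /cprimitive[U hU] ab hB; rewrite (cintE a b hU).
apply: mean_value => // t tab; exists (fun h => h%:C * u t); first exact: hU.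
by move=> h; rewrite cn_realM mulrC ler_wpM2r // hB.
Qed.

End Primitive.

(** * Integrals along boundaries of rectangles *)

Section Goursat.
Context {R : realType}.
Local Notation K := R[i].
Local Notation absn := (@absn R).
Local Notation cn := (@cn R).

(** The left ends increase and are bounded by all right ends. *)
Lemma nested_intervals (x l : nat -> R) : (forall n, 0 <= l n) ->
  (forall n, x n <= x n.+1) -> (forall n, x n.+1 + l n.+1 <= x n + l n) ->
  exists p : R, forall n, x n <= p <= x n + l n.
Proof.
move=> l0 xS lS.
have xle m n : (m <= n)%N -> x m <= x n by move=> mn; apply: (homo_leq (@lexx _ _) (@le_trans _ _)).
have lle m n : (m <= n)%N -> x n + l n <= x m + l m.
  move=> mn; apply: (homo_leq (r := fun a b : R => b <= a) (f := fun n => x n + l n)) => //.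
  by move=> b a c ab bc; exact: le_trans bc ab.
have hS m : ubound [set x n | n in setT] (x m + l m).
  move=> _ [n _ <-]; have [mn|nm] := leqP m n.
    by rewrite (le_trans _ (lle _ _ mn)) // lerDl.
  by rewrite (le_trans (xle _ _ (ltnW nm))) // lerDl.
exists (sup [set x n | n in setT]) => n; apply/andP; split.
  apply: sup_ubound; last by exists n.
  by exists (x 0%N + l 0%N); exact: hS.
by apply: ge_sup; [exists (x 0%N), 0%N|exact: hS].
Qed.

Lemma small_pow2 (c d : R) : 0 < d -> exists n : nat, c / 2 ^+ n <= d.
Proof.
move=> d0; have [n hn] : exists n : nat, `|c| / d < n%:R.
  by exists (Num.bound (`|c| / d)); rewrite archi_boundP // divr_ge0 // ltW.
exists n; rewrite ler_pdivrMr ?exprn_gt0 //.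
rewrite (le_trans (ler_norm _)) // mulrC -ler_pdivrMr // (le_trans (ltW hn)) //.
by rewrite -natrX ler_nat ltnW // ltn_expl.
Qed.

(** Repeated choice of a quarter of the rectangle on which P persists: the
rectangles shrink to a point. *)
Lemma bisection (P : R -> R -> R -> R -> Prop) (x0 y0 L H : R) : 0 <= L -> 0 <= H ->
  P x0 L y0 H ->
  (forall x l y h : R, 0 <= l -> 0 <= h -> P x l y h ->
     exists i j : bool, P (x + i%:R * (l / 2)) (l / 2) (y + j%:R * (h / 2)) (h / 2)) ->
  exists p q : R, forall n, exists x y : R,
    [/\ x <= p <= x + L / 2 ^+ n, y <= q <= y + H / 2 ^+ n &
        P x (L / 2 ^+ n) y (H / 2 ^+ n)].
Proof.
move=> L0 H0 P0 step.
pose l n : R := L / 2 ^+ n; pose h n : R := H / 2 ^+ n.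
have l0 n : 0 <= l n by rewrite divr_ge0 // exprn_ge0.
have h0 n : 0 <= h n by rewrite divr_ge0 // exprn_ge0.
have lE n : l n / 2 = l n.+1 by rewrite /l exprSr invfM mulrA.
have hE n : h n / 2 = h n.+1 by rewrite /h exprSr invfM mulrA.
have /choice[g hg] : forall nz : nat * (R * R), exists z : R * R,
    let: (n, xy) := nz in P xy.1 (l n) xy.2 (h n) ->
    exists i j : bool, z = (xy.1 + i%:R * (l n.+1), xy.2 + j%:R * (h n.+1)) /\
     P z.1 (l n.+1) z.2 (h n.+1).
  move=> [n xy]; have [hP|nP] := pselect (P xy.1 (l n) xy.2 (h n)); last by exists xy.
  have [i [j hij]] := step _ _ _ _ (l0 n) (h0 n) hP; rewrite lE hE in hij.
  by exists (xy.1 + i%:R * (l n.+1), xy.2 + j%:R * (h n.+1)) => _; exists i, j.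
pose z := fix z n : R * R := if n is m.+1 then g (m, z m) else (x0, y0).
have Pz n : P (z n).1 (l n) (z n).2 (h n).
  elim: n => [|n IH]; first by rewrite /l /h expr0 !divr1.
  by have /= := hg (n, z n); move=> /(_ IH) [i [j [_ ]]].
have zS n : exists i j : bool,
    z n.+1 = ((z n).1 + i%:R * (l n.+1), (z n).2 + j%:R * (h n.+1)).
  have /= := hg (n, z n); move=> /(_ (Pz n)) [i [j [-> _]]]; by exists i, j.
have [p hp] : exists p, forall n, (z n).1 <= p <= (z n).1 + l n.
  apply: nested_intervals => // n; have [i [j ->]] /= := zS n; have := l0 n.+1.
    by case: i => /=; lra.
  by rewrite -(lE n); case: i => /=; lra.
have [q hq] : exists q, forall n, (z n).2 <= q <= (z n).2 + h n.
  apply: nested_intervals => // n; have [i [j ->]] /= := zS n; have := h0 n.+1.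
    by case: j => /=; lra.
  by rewrite -(hE n); case: j => /=; lra.
by exists p, q => n; exists (z n).1, (z n).2.
Qed.

Definition entire (h : K -> K) := forall w, exists a, frechet cn cn h w (fun k => a * k).

Lemma entire_cont h w : entire h -> cont cn cn h w.
Proof. by move=> /(_ w)[a]; exact: frechet_cont. Qed.

Lemma cont_horiz (y s : R) : cont absn cn (fun s => s +i* y) s.
Proof.
move=> e e0; exists e => // k; rewrite cnE /= subrr normr0 addr0.
by rewrite (addrC s) addrK.
Qed.

Lemma cont_vert (x t : R) : cont absn cn (fun t => x +i* t) t.
Proof.
move=> e e0; exists e => // k; rewrite cnE /= subrr normr0 add0r.
by rewrite (addrC t) addrK.
Qed.

(** The integral of h along the boundary of the rectangle, counterclockwise. *)
Definition boundary (h : K -> K) (x x' y y' : R) : K :=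
  cint (fun s => h (s +i* y)) x x' + 'i%C * cint (fun t => h (x' +i* t)) y y'
  - cint (fun s => h (s +i* y')) x x' - 'i%C * cint (fun t => h (x +i* t)) y y'.

Lemma boundary_hcat h x x' x'' y y' :
  boundary h x x'' y y' = boundary h x x' y y' + boundary h x' x'' y y'.
Proof.
rewrite /boundary (cint_cat _ x x' x'') (cint_cat (fun s => h (s +i* y')) x x' x'').
by ring.
Qed.

Lemma boundary_vcat h x x' y y' y'' :
  boundary h x x' y y'' = boundary h x x' y y' + boundary h x x' y' y''.
Proof.
rewrite /boundary (cint_cat _ y y' y'') (cint_cat (fun t => h (x +i* t)) y y' y'').
by ring.
Qed.

Section ContH.
Variables (h q : K -> K).
Hypotheses (ch : forall w, cont cn cn h w) (cq : forall w, cont cn cn q w).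

Lemma cont_h (y s : R) : cont absn cn (fun s => h (s +i* y)) s.
Proof. exact: cont_comp (cont_horiz y s) (ch _). Qed.

Lemma cont_v (x t : R) : cont absn cn (fun t => h (x +i* t)) t.
Proof. exact: cont_comp (cont_vert x t) (ch _). Qed.

End ContH.

Lemma boundaryB h q x x' y y' : (forall w, cont cn cn h w) -> (forall w, cont cn cn q w) ->
  boundary (fun w => h w - q w) x x' y y' = boundary h x x' y y' - boundary q x x' y y'.
Proof.
move=> ch cq; rewrite /boundary.
by rewrite !cintB; [ring|..]; move=> t; try apply: cont_h => //; apply: cont_v.
Qed.

Lemma boundary_bound h x x' y y' B : (forall w, cont cn cn h w) -> x <= x' -> y <= y' ->
  (forall s t, x <= s <= x' -> y <= t <= y' -> cn (h (s +i* t)) <= B) ->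
  cn (boundary h x x' y y') <= 2 * B * ((x' - x) + (y' - y)).
Proof.
move=> ch xx' yy' hB.
have b1 : cn (cint (fun s => h (s +i* y)) x x') <= B * (x' - x).
  by apply: cint_bound => // [t|s hs]; [exact: cont_h|apply: hB; rewrite ?lexx].
have b2 : cn (cint (fun s => h (s +i* y')) x x') <= B * (x' - x).
  by apply: cint_bound => // [t|s hs]; [exact: cont_h|apply: hB; rewrite ?lexx ?yy'].
have b3 : cn (cint (fun t => h (x +i* t)) y y') <= B * (y' - y).
  by apply: cint_bound => // [t|s hs]; [exact: cont_v|apply: hB; rewrite ?lexx].
have b4 : cn (cint (fun t => h (x' +i* t)) y y') <= B * (y' - y).
  by apply: cint_bound => // [t|s hs]; [exact: cont_v|apply: hB; rewrite ?lexx ?xx'].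
rewrite /boundary.
rewrite (le_trans (snormB _ _ _)) // cn_iM.
have t1 := snormB cn (cint (fun s => h (s +i* y)) x x' +
  'i%C * cint (fun t => h (x' +i* t)) y y') (cint (fun s => h (s +i* y')) x x').
have t2 := snormD cn (cint (fun s => h (s +i* y)) x x')
   ('i%C * cint (fun t => h (x' +i* t)) y y').
rewrite cn_iM in t2; lra.
Qed.

Lemma rder_id (t : R) : rder (fun s : R => s%:C) t 1.
Proof.
apply: eq_frechet (frechet_lin (A := fun s : R => s%:C) _ ler01 _ _) => //.
- by move=> k; rewrite mulr1.
- by move=> a b; rewrite rmorphD.
- by move=> k; rewrite cn_real mul1r.
Qed.

Lemma rder_cst c (t : R) : rder (fun=> c) t 0.
Proof. by apply: eq_frechet (frechet_cst c t) => // k; rewrite mulr0. Qed.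

Lemma rderM (u v : R -> K) t a b : rder u t a -> rder v t b ->
  rder (fun s => u s * v s) t (u t * b + a * v t).
Proof. by move=> hu hv; apply: eq_frechet (frechetM hu hv) => // k; ring. Qed.

Lemma rderD (u v : R -> K) t a b : rder u t a -> rder v t b ->
  rder (fun s => u s + v s) t (a + b).
Proof. by move=> hu hv; apply: eq_frechet (frechetD hu hv) => // k; ring. Qed.

Lemma rder_eq (u v : R -> K) t a b : rder u t a -> u =1 v -> a = b -> rder v t b.
Proof. by move=> hu /funext <- <-. Qed.

Lemma pairE (a b : R) : a +i* b = a%:C + 'i%C * b%:C :> K.
Proof. by rewrite [LHS]complexE. Qed.

Lemma rder_affine (c a b : K) (t : R) :
  rder (fun s : R => c * s%:C + a * (s%:C * s%:C) / 2) t (c + a * t%:C).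
Proof.
have h1 := rderZ c (rder_id t).
have h2 := rderZ (a / 2) (rderM (rder_id t) (rder_id t)).
apply: rder_eq (rderD h1 h2) _ _; first by move=> s; field.
by field.
Qed.

Lemma cint_affine (c a : K) (x y : R) :
  cint (fun s : R => c + a * s%:C) x y =
  c * y%:C + a * (y%:C * y%:C) / 2 - (c * x%:C + a * (x%:C * x%:C) / 2).
Proof. by rewrite (cintE _ _ (fun t => rder_affine c a 0 t)). Qed.

(** Affine functions have explicit primitives. *)
Lemma boundary_affine (c a : K) x x' y y' :
  boundary (fun w => c + a * w) x x' y y' = 0.
Proof.
rewrite /boundary.
have H1 (t : R) : (fun s : R => c + a * (s +i* t)) =
   (fun s : R => (c + a * ('i%C * t%:C)) + a * s%:C).
  by apply/funext => s; rewrite pairE; ring.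
have H2 (s : R) : (fun t : R => c + a * (s +i* t)) =
   (fun t : R => (c + a * s%:C) + (a * 'i%C) * t%:C).
  by apply/funext => t; rewrite pairE; ring.
rewrite !H1 !H2 !cint_affine.
by field.
Qed.

End Goursat.

(** * The theorem of Goursat and the Cauchy formula for the derivative *)

Section Cauchy.
Context {R : realType}.
Local Notation K := R[i].
Local Notation absn := (@absn R).
Local Notation cn := (@cn R).

(** Subtracting the affine approximation of h at w0 does not change the
integral, and leaves an integrand of size e (l + m). *)
Lemma boundary_local (h : K -> K) (w0 a : K) (e d x l y m : R) :
  entire h -> (forall k, cn k <= d -> cn (h (w0 + k) - h w0 - a * k) <= e * cn k) ->
  0 <= e -> 0 <= l -> 0 <= m ->
  x <= complex.Re w0 <= x + l -> y <= complex.Im w0 <= y + m -> l + m <= d ->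
  cn (boundary h x (x + l) y (y + m)) <= 2 * e * (l + m) ^+ 2.
Proof.
move=> hh ha e0 l0 m0 /andP[xp px] /andP[yq qy] lmd.
pose q w := (h w0 - a * w0) + a * w.
have ch w : cont cn cn h w by exact: entire_cont.
have cq w : cont cn cn q w.
  apply: contD; first exact: cont_cst.
  apply: (frechet_cont (A := fun k => a * k)).
  apply: (frechet_lin _ (snorm_ge0 cn a)); first by move=> u v; rewrite mulrDr.
  by move=> k; exact: cnM.
have -> : boundary h x (x + l) y (y + m) =
    boundary (fun w => h w - q w) x (x + l) y (y + m).
  by rewrite boundaryB // boundary_affine subr0.
have -> : 2 * e * (l + m) ^+ 2 = 2 * (e * (l + m)) * ((x + l - x) + (y + m - y)) by ring.
apply: boundary_bound; rewrite ?lerDl //.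
  by move=> w; exact: contB.
move=> s t /andP[xs sx] /andP[yt ty].
pose k := s +i* t - w0.
have nk : cn k <= l + m.
  rewrite /k; case: (w0) xp px yq qy => p r /= xp px yq qy; rewrite cnE /=.
  by apply: lerD; rewrite ler_norml; apply/andP; split; lra.
have -> : h (s +i* t) - q (s +i* t) = h (w0 + k) - h w0 - a * k.
  by rewrite /q /k (addrC w0) subrK; ring.
apply: (le_trans (ha k (le_trans nk lmd))).
by rewrite ler_wpM2l.
Qed.

(** Goursat's lemma.  If the integral does not vanish, one of the quarters of the
rectangle carries at least a quarter of it, and so on; but near the limit
point the integral is negligible compared with the area.  Comparing with the
area l m rather than counting the steps gives a property of the rectangle
alone. *)
Theorem boundary_entire (h : K -> K) (x L y H : R) : entire h -> 0 < L -> 0 < H ->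
  boundary h x (x + L) y (y + H) = 0.
Proof.
move=> hh L0 H0; apply: cn_eq0; rewrite leNgt; apply/negP => c0.
set c := cn _ in c0.
pose P (x l y m : R) := c * (l * m) <= L * H * cn (boundary h x (x + l) y (y + m)).
have P0 : P x L y H by rewrite /P -/c mulrC.
have step (x' l y' m : R) : 0 <= l -> 0 <= m -> P x' l y' m ->
   exists i j : bool, P (x' + i%:R * (l / 2)) (l / 2) (y' + j%:R * (m / 2)) (m / 2).
  move=> _ _ hP; apply: contrapT => hn.
  have hi i j : L * H * cn (boundary h (x' + (i : bool)%:R * (l / 2))
     (x' + i%:R * (l / 2) + l / 2) (y' + (j : bool)%:R * (m / 2))
     (y' + j%:R * (m / 2) + m / 2)) < c * (l / 2 * (m / 2)).
    by rewrite ltNge; apply/negP => hij; apply: hn; exists i, j.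
  have := hi false false; have := hi false true; have := hi true false.
  have := hi true true; rewrite /= !mul1r !mul0r !addr0.
  set b1 := boundary _ _ _ _ _; set b2 := boundary _ _ _ _ _.
  set b3 := boundary _ _ _ _ _; set b4 := boundary _ _ _ _ _.
  have E : boundary h x' (x' + l) y' (y' + m) = (b4 + b2) + (b3 + b1).
    have El : x' + l = x' + l / 2 + l / 2 by lra.
    have Em : y' + m = y' + m / 2 + m / 2 by lra.
    rewrite El Em (boundary_hcat _ _ (x' + l / 2)) !(boundary_vcat _ _ _ y' (y' + m / 2) (y' + m / 2 + m / 2)).
    by rewrite /b1 /b2 /b3 /b4; ring.
  move: hP; rewrite /P E.
  have n1 := snormD cn (b4 + b2) (b3 + b1).
  have n2 := snormD cn b4 b2; have n3 := snormD cn b3 b1.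
  have n4 : cn (b4 + b2 + (b3 + b1)) <= cn b4 + cn b2 + (cn b3 + cn b1) by lra.
  have LH : 0 <= L * H by rewrite mulr_ge0 // ltW.
  have := ler_wpM2l LH n4; lra.
have [p [q hpq]] := bisection (ltW L0) (ltW H0) P0 step.
have [a [_ ha]] := hh (p +i* q).
pose e := c / (4 * (L + H) ^+ 2).
have LH2 : 0 < (L + H) ^+ 2 by rewrite exprn_gt0 // addr_gt0.
have e0 : 0 < e by rewrite divr_gt0 // mulr_gt0.
have [d d0 hd] := ha e e0.
have [n hn] := small_pow2 (L + H) d0.
have [x' [y' [hx hy hP]]] := hpq n.
have p2 : 0 < 2 ^+ n :> R by rewrite exprn_gt0.
have Ln : 0 <= L / 2 ^+ n by rewrite divr_ge0 // ltW.
have Hn : 0 <= H / 2 ^+ n by rewrite divr_ge0 // ltW.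
rewrite mulrDl in hn.
have hB := boundary_local hh hd (ltW e0) Ln Hn hx hy hn; rewrite -mulrDl in hB.
have LH : 0 < L * H by rewrite mulr_gt0.
move: hP; rewrite /P; apply/negP; rewrite -ltNge.
apply: (le_lt_trans (ler_wpM2l (ltW LH) hB)).
have -> : c * (L / 2 ^+ n * (H / 2 ^+ n)) = L * H * (c / (2 ^+ n) ^+ 2).
  by field; rewrite gt_eqF.
rewrite ltr_pM2l //.
have -> : 2 * e * ((L + H) / 2 ^+ n) ^+ 2 = c / 2 / (2 ^+ n) ^+ 2.
  rewrite /e; field; rewrite (gt_eqF p2) /=; apply/eqP => h0.
  by move: LH2; rewrite h0 expr0n ltxx.
by rewrite ltr_pM2r ?invr_gt0 ?exprn_gt0 // ltr_pdivrMr // mulr2n; lra.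
Qed.

Definition cexp (w : K) : K :=
  (expR (complex.Re w))%:C * (cos (complex.Im w) +i* sin (complex.Im w)).

Lemma cexpD w k : cexp (w + k) = cexp w * cexp k.
Proof.
case: w k => [a b] [c d]; rewrite /cexp /= expRD cosD sinD rmorphM /=.
have -> : (cos b * cos d - sin b * sin d) +i* (sin b * cos d + cos b * sin d) =
   (cos b +i* sin b) * (cos d +i* sin d) :> K.
  by congr (_ +i* _); rewrite addrC.
by ring.
Qed.

Lemma cexp0 : cexp 0 = 1.
Proof. by rewrite /cexp /= expR0 cos0 sin0 rmorph1 mul1r. Qed.

Lemma cexpN w : cexp w * cexp (- w) = 1.
Proof. by rewrite -cexpD subrr cexp0. Qed.

Lemma cn_cexp w : cn (cexp w) <= 2 * expR (complex.Re w).
Proof.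
case: w => a b; rewrite /cexp cn_realM ger0_norm ?expR_ge0 // mulrC.
rewrite ler_wpM2r ?expR_ge0 // cnE /=.
have := cos_max b; have := sin_max b; lra.
Qed.

(** The three real expansions at 0, of the exponential, the cosine and the
sine, are combined; the factor 9 is a crude total of the error terms. *)
Lemma cexp_small (e : R) : 0 < e -> exists2 d : R, 0 < d &
  forall k, cn k <= d -> cn (cexp k - 1 - k) <= e * cn k.
Proof.
move=> e0; have [e1 [e10 e11 e19]] : exists e1, [/\ 0 < e1, e1 <= 1 & e1 * 9 <= e].
  exists (Num.min 1 (e / 9)); split; first by rewrite lt_min ltr01 divr_gt0.
    by rewrite ge_min lexx.
  by rewrite -ler_pdivlMr // ge_min lexx orbT.
have [_ /(_ _ e10)[d1 d10 h1]] := is_derive_frechet (is_derive_expR (0 : R)).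
have [_ /(_ _ e10)[d2 d20 h2]] := is_derive_frechet (is_derive_cos (0 : R)).
have [_ /(_ _ e10)[d3 d30 h3]] := is_derive_frechet (is_derive_sin (0 : R)).
exists (Num.min (Num.min e1 d1) (Num.min d2 d3)).
  by rewrite !lt_min d10 d20 d30 e10.
move=> [a b]; rewrite !le_min cnE /= => /andP[/andP[n1 nd1] /andP[nd2 nd3]].
have [a0 b0] := (normr_ge0 a, normr_ge0 b).
have := h1 a; have := h2 b; have := h3 b; rewrite /= !add0r expR0 cos0 sin0.
rewrite oppr0 mulr0 mulr1 !subr0 mulr1.
move=> /(_ (le_trans _ nd3)); rewrite lerDr a0 => /(_ isT) r3.
move=> /(_ (le_trans _ nd2)); rewrite lerDr a0 => /(_ isT) r2.
move=> /(_ (le_trans _ nd1)); rewrite lerDl b0 => /(_ isT) r1.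
rewrite /cexp cnE /= !mul0r subr0 addr0.
set E := expR a in r1 *.
have E1 : `|E - 1| <= 2 * `|a|.
  rewrite -[E - 1](subrK a) (le_trans (ler_normD _ _)) //.
  have : e1 * `|a| <= 1 * `|a| by rewrite ler_wpM2r.
  lra.
have EB : `|E| <= 3.
  rewrite -[E](subrK 1) (le_trans (ler_normD _ _)) // normr1; lra.
have R1 : `|E * cos b - 1 - a| <= e1 * `|a| + 3 * (e1 * `|b|).
  have -> : E * cos b - 1 - a = (E - 1 - a) + E * (cos b - 1) by ring.
  rewrite (le_trans (ler_normD _ _)) // lerD // normrM.
  by rewrite ler_pM.
have R2 : `|E * sin b - b| <= 3 * (e1 * `|b|) + 2 * (e1 * `|b|).
  have -> : E * sin b - b = E * (sin b - b) + (E - 1) * b by ring.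
  rewrite (le_trans (ler_normD _ _)) // lerD // normrM.
    by rewrite addr0 in r3; rewrite ler_pM.
  rewrite (le_trans (ler_wpM2r b0 E1)) // -mulrA ler_wpM2l // ler_wpM2r //.
  lra.
have h9 : 9 * e1 * (`|a| + `|b|) <= e * (`|a| + `|b|).
  by rewrite ler_wpM2r ?addr_ge0 //; lra.
have p1 : 0 <= e1 * `|a| by rewrite mulr_ge0 // ltW.
have p2 : 0 <= e1 * `|b| by rewrite mulr_ge0 // ltW.
by rewrite subr0; lra.
Qed.

Lemma frechet_cexp w : frechet cn cn cexp w (fun k => cexp w * k).
Proof.
split; first by exists (cn (cexp w)) => [|k]; [exact: snorm_ge0|exact: cnM].
move=> e e0; have c0 : 0 < cn (cexp w) + 1 by rewrite ltr_wpDl ?snorm_ge0.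
have [d d0 hd] := cexp_small (divr_gt0 e0 c0).
exists d => // k /hd {}hd.
have -> : cexp (w + k) - cexp w - cexp w * k = cexp w * (cexp k - 1 - k).
  by rewrite cexpD; ring.
rewrite (le_trans (cnM _ _)) // (le_trans (ler_wpM2l (snorm_ge0 cn _) hd)) //.
rewrite mulrA ler_wpM2r ?snorm_ge0 // mulrCA ler_piMr ?ltW //.
by rewrite ltr_pdivrMr // mul1r ltrDl.
Qed.

Lemma entire_cexp : entire (R := R) cexp.
Proof. by move=> w; exists (cexp w); exact: frechet_cexp. Qed.

Lemma entire_comp (h q : K -> K) : entire h -> entire q -> entire (q \o h).
Proof.
move=> hh hq w; have [a ha] := hh w; have [b hb] := hq (h w).
exists (b * a); apply: eq_frechet (frechet_comp _ ha hb) => //.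
  by move=> k /=; rewrite mulrA.
by move=> u v; rewrite mulrDr.
Qed.

Lemma entireM (h q : K -> K) : entire h -> entire q -> entire (fun w => h w * q w).
Proof.
move=> hh hq w; have [a ha] := hh w; have [b hb] := hq w.
exists (h w * b + a * q w); apply: eq_frechet (frechetM ha hb) => //.
by move=> k; ring.
Qed.

Lemma entire_cst (c : K) : entire (R := R) (fun=> c).
Proof. by move=> w; exists 0; apply: eq_frechet (frechet_cst c w) => // k; rewrite mul0r. Qed.

Lemma entireB (h q : K -> K) : entire h -> entire q -> entire (fun w => h w - q w).
Proof.
move=> hh hq w; have [a ha] := hh w; have [b hb] := hq w.
exists (a - b); apply: eq_frechet (frechetB ha hb) => //.
by move=> k; ring.
Qed.

Lemma entireN : entire (R := R) (fun w => - w).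
Proof.
move=> w; exists (- 1); apply: eq_frechet (frechet_lin (A := fun w => - w) w ler01 _ _) => //.
- by move=> k; rewrite mulN1r.
- by move=> a b; rewrite opprD.
- by move=> k; rewrite snormN mul1r.
Qed.

Definition tau : R := pi *+ 2.

Lemma tau_gt0 : 0 < tau. Proof. by rewrite mulrn_wgt0 // pi_gt0. Qed.

Lemma cexp_tau (s : R) : cexp (s +i* tau) = cexp (s +i* 0).
Proof. by rewrite /cexp /= cos2pi sin2pi cos0 sin0. Qed.

Lemma cexpN_tau (s : R) : cexp (- (s +i* tau)) = cexp (- (s +i* 0)).
Proof. by rewrite /cexp /= cosN sinN cos2pi sin2pi oppr0 cos0 sin0. Qed.

(** The function h(w) = (g(e^w) - g(0)) e^(-w) has period 2 i pi, so the
horizontal sides of a strip of height 2 pi cancel, and Goursat's lemma says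
that the integral of h over a vertical segment does not depend on the abscissa
s.  When s goes to minus infinity, h(w) tends to a uniformly on the segment. *)
Theorem cauchy_derivative (g : K -> K) (a : K) : entire g ->
  frechet cn cn g 0 (fun k => a * k) ->
  cint (fun t : R => (g (cexp (0 +i* t)) - g 0) * cexp (- (0 +i* t))) 0 tau = a * tau%:C.
Proof.
move=> hg [_ ha].
pose h w := (g (cexp w) - g 0) * cexp (- w).
have hh : entire h.
  apply: entireM; first by apply: entireB; [exact: entire_comp entire_cexp hg|exact: entire_cst].
  exact: entire_comp entireN entire_cexp.
have ch w : cont cn cn h w by exact: entire_cont.
rewrite -/(h _) (_ : (fun t : R => _) = fun t => h (0 +i* t)) //.
have shift (s : R) : s < 0 -> cint (fun t => h (0 +i* t)) 0 tau = cint (fun t => h (s +i* t)) 0 tau.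
  move=> s0; have s0' : 0 < - s by rewrite oppr_gt0.
  have := boundary_entire s 0 hh s0' tau_gt0.
  rewrite subrr add0r /boundary.
  have -> : (fun u => h (u +i* tau)) = (fun u => h (u +i* 0)).
    by apply/funext => u; rewrite /h cexp_tau cexpN_tau.
  set A := cint (fun u => h (u +i* 0)) _ _.
  rewrite addrC (addrC A) addrK addrC -mulrBr => /eqP; rewrite mulf_eq0 subr_eq0.
  by rewrite eq_complex /= oner_eq0 andbF /= => /eqP.
apply/eqP; rewrite -subr_eq0; apply/eqP/cn_eq0/ler_addgt0Pr => e e0; rewrite add0r.
pose e1 := e / (4 * tau).
have e10 : 0 < e1 by rewrite divr_gt0 // mulr_gt0 // tau_gt0.
have [d d0 hd] := ha _ e10.
(* far enough to the left, e^w lies in the disc where g is close to its affine part *)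
pose s := Num.min (-1) (ln (d / 2)).
have s0 : s < 0 by rewrite gt_min; apply/orP; left; lra.
have sd : 2 * expR s <= d.
  have d2 : 0 < d / 2 by lra.
  have : expR s <= d / 2 by rewrite -[X in _ <= X]lnK ?posrE // ler_expR ge_min lexx orbT.
  lra.
rewrite (shift s s0).
have -> : a * tau%:C = cint (fun t : R => a + 0 * t%:C) 0 tau.
  by rewrite cint_affine !mul0r !addr0 mulr0 subr0.
have ca t : cont absn cn (fun t : R => a + 0 * t%:C) t.
  rewrite (_ : (fun t : R => _) = fun=> a); first exact: cont_cst.
  by apply/funext => u; rewrite mul0r addr0.
rewrite -cintB //; last by move=> t; exact: cont_v.
have -> : e = 4 * e1 * (tau - 0).
  rewrite subr0 /e1; have t0 : tau != 0 by rewrite gt_eqF // tau_gt0.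
  by move: (tau) t0 => t t0; field.
apply: cint_bound; rewrite ?ltW ?tau_gt0 //.
  by move=> t; apply: contB => //; exact: cont_v.
move=> t _; rewrite mul0r addr0.
set w := s +i* t; set z := cexp w.
have -> : h w - a = (g (0 + z) - g 0 - a * z) * cexp (- w).
  by rewrite /h add0r -/z [RHS]mulrBl -[a * z * _]mulrA cexpN mulr1.
have zs : cn z <= 2 * expR s by exact: cn_cexp.
have zd : cn z <= d by exact: le_trans zs sd.
(* z has size at most 2 e^s and its inverse at most 2 e^(-s): the product is bounded *)
have zi : cn (cexp (- w)) <= 2 * expR (- s) by exact: cn_cexp.
rewrite (le_trans (cnM _ _)) //.
apply: (@le_trans _ _ (e1 * (2 * expR s) * (2 * expR (- s)))).
  apply: ler_pM; rewrite ?snorm_ge0 //.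
  by rewrite (le_trans (hd _ zd)) // ler_wpM2l // ltW.
rewrite (_ : e1 * _ * _ = 4 * e1 * (expR s * expR (- s))); last by ring.
by rewrite -expRD subrr expR0 mulr1.
Qed.

End Cauchy.

(** * Uniformity over compact parameter intervals *)

Section Tube.
Context {R : realType}.
Local Notation K := R[i].
Local Notation absn := (@absn R).
Local Notation cn := (@cn R).

Lemma tube (V : zmodType) (N : seminorm R V) (Q : V -> R -> Prop) (a b : R) : a <= b ->
  (forall t, a <= t <= b -> exists2 d : R, 0 < d & forall k s, N k <= d ->
      `|s - t| <= d -> Q k s) ->
  exists2 d : R, 0 < d & forall k, N k <= d -> forall t, a <= t <= b -> Q k t.
Proof.
move=> ab hQ.
apply: (@cousin R (fun x y => exists2 d : R, 0 < d & forall k, N k <= d ->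
   forall t, x <= t <= y -> Q k t)) => //.
  move=> x y z _ _ _ _ [d d0 hd] [d' d'0 hd'].
  exists (Num.min d d'); first by rewrite lt_min d0.
  move=> k; rewrite le_min => /andP[kd kd'] t /andP[xt tz].
  by have [ty|yt] := leP t y; [apply: hd|apply: hd'] => //; rewrite ?xt ?ty // tz ltW.
move=> t /hQ[d d0 hd]; exists d => // x y _ xt ty _ yxd; exists d => // k kd s /andP[xs sy].
by apply: hd => //; rewrite ler_norml; apply/andP; split; lra.
Qed.

Lemma cintD u v a b : (forall t, cont absn cn u t) -> (forall t, cont absn cn v t) ->
  cint (fun t => u t + v t) a b = cint u a b + cint v a b.
Proof.
move=> /cprimitive[U hU] /cprimitive[V hV].
rewrite (cintE a b hU) (cintE a b hV) (@cintE _ _ (fun t => U t + V t)); first by ring.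
by move=> t; exact: rderD.
Qed.

Lemma cint_sum (I : Type) (r : seq I) (F : I -> R -> K) a b :
  (forall i t, cont absn cn (F i) t) ->
  cint (fun t => \sum_(i <- r) F i t) a b = \sum_(i <- r) cint (F i) a b.
Proof.
move=> hF; elim: r => [|i r IH].
  rewrite big_nil (@cintE _ _ (fun=> 0)) ?subrr // => t; rewrite big_nil.
  exact: rder_cst.
rewrite big_cons -IH -cintD //; last by move=> t; exact: cont_sum.
by congr cint; apply/funext => t; rewrite big_cons.
Qed.

Lemma finite_min (I : finType) (P : I -> R -> Prop) :
  (forall i d d', 0 < d' -> d' <= d -> P i d -> P i d') ->
  (forall i, exists2 d, 0 < d & P i d) -> exists2 d, 0 < d & forall i, P i d.
Proof.
move=> mono hP.
have /choice[d hd] : forall i, exists d : R, 0 < d /\ P i d.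
  by move=> i; have [d d0 h] := hP i; exists d.
have m0 : 0 < \big[Num.min/1]_i d i.
  by elim/big_ind: _ => // [x y x0 y0|i _]; [rewrite lt_min x0|exact: (hd i).1].
exists (\big[Num.min/1]_i d i) => // i; apply: (mono i (d i)) => //; last exact: (hd i).2.
exact: bigmin_le_cond.
Qed.

End Tube.

(** * Holomorphic functions of several variables *)

Section SeveralVariables.
Context {R : realType} {d : nat}.
Local Notation K := R[i].
Local Notation V := 'cV[K]_d.
Local Notation absn := (@absn R).
Local Notation cn := (@cn R).
Implicit Types (x p k : V) (phi psi u : V -> K).

Definition vnorm x : R := \sum_i cn (x i 0).

Lemma vnorm_ge0 x : 0 <= vnorm x.
Proof. by apply: sumr_ge0 => i _; exact: snorm_ge0. Qed.
Lemma vnormD x y : vnorm (x + y) <= vnorm x + vnorm y.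
Proof.
by rewrite /vnorm -big_split; apply: ler_sum => i _ /=; rewrite !mxE snormD.
Qed.
Lemma vnormN x : vnorm (- x) = vnorm x.
Proof. by apply: eq_bigr => i _; rewrite mxE snormN. Qed.
Lemma vnorm0 : vnorm 0 = 0.
Proof. by rewrite /vnorm big1 // => i _; rewrite mxE snorm0. Qed.

Definition vn : seminorm R V := SemiNorm vnorm_ge0 vnormD vnormN vnorm0.

Lemma vnE x : vn x = \sum_i cn (x i 0). Proof. by []. Qed.

Opaque vn.

Lemma cn_entry x i : cn (x i 0) <= vn x.
Proof.
by rewrite vnE (bigD1 i) //= lerDl; apply: sumr_ge0 => j _; exact: snorm_ge0.
Qed.

Lemma vnZ (c : K) x : vn (c *: x) <= cn c * vn x.
Proof.
by rewrite !vnE mulr_sumr; apply: ler_sum => i _; rewrite mxE cnM.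
Qed.

Lemma vnZr (c : R) x : vn (c%:C *: x) = `|c| * vn x.
Proof.
by rewrite !vnE mulr_sumr; apply: eq_bigr => i _; rewrite mxE cn_realM.
Qed.

Definition lin (g : 'I_d -> K) (k : V) : K := \sum_j g j * k j 0.

Lemma linDr g h k : lin g (h + k) = lin g h + lin g k.
Proof. by rewrite /lin -big_split; apply: eq_bigr => j _; rewrite mxE mulrDr. Qed.

Lemma linZr g c k : lin g (c *: k) = c * lin g k.
Proof. by rewrite /lin mulr_sumr; apply: eq_bigr => j _; rewrite mxE mulrCA. Qed.

Lemma lin_bound g (B : R) k : 0 <= B -> (forall j, cn (g j) <= B) -> cn (lin g k) <= B * vn k.
Proof.
move=> B0 hB; rewrite (le_trans (snorm_sum _ _ _)) // vnE mulr_sumr.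
apply: ler_sum => j _; rewrite (le_trans (cnM _ _)) // ler_wpM2r ?snorm_ge0 //.
Qed.

Definition hol phi := forall x, exists g, frechet vn cn phi x (lin g).

Lemma hol_cont phi x : hol phi -> cont vn cn phi x.
Proof. by move=> /(_ x)[g]; exact: frechet_cont. Qed.

Lemma hol_cst c : hol (fun=> c).
Proof.
move=> x; exists (fun=> 0); apply: eq_frechet (frechet_cst c x) => // k.
by rewrite /lin big1 // => j _; rewrite mul0r.
Qed.

Lemma holD phi psi : hol phi -> hol psi -> hol (fun x => phi x + psi x).
Proof.
move=> hp hq x; have [g hg] := hp x; have [h hh] := hq x.
exists (fun j => g j + h j); apply: eq_frechet (frechetD hg hh) => // k.
by rewrite /lin -big_split; apply: eq_bigr => j _; rewrite mulrDl.
Qed.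

Lemma holM phi psi : hol phi -> hol psi -> hol (fun x => phi x * psi x).
Proof.
move=> hp hq x; have [g hg] := hp x; have [h hh] := hq x.
exists (fun j => phi x * h j + g j * psi x); apply: eq_frechet (frechetM hg hh) => // k.
rewrite /lin mulr_sumr mulr_suml -big_split; apply: eq_bigr => j _ /=; ring.
Qed.

Lemma hol_sum (I : Type) (r : seq I) (F : I -> V -> K) :
  (forall i, hol (F i)) -> hol (fun x => \sum_(i <- r) F i x).
Proof.
move=> hF; elim: r => [|i r IH].
  rewrite (_ : (fun x => _) = fun=> 0); first exact: hol_cst.
  by apply/funext => x; rewrite big_nil.
rewrite (_ : (fun x => _) = fun x => F i x + \sum_(j <- r) F j x); first exact: holD.
by apply/funext => x; rewrite big_cons.
Qed.

Definition basis_vec (j : 'I_d) : V := delta_mx j 0.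

Lemma lin_basis_vec g j : lin g (basis_vec j) = g j.
Proof.
rewrite /lin (bigD1 j) //= big1 => [|i ij]; first by rewrite mxE !eqxx mulr1 addr0.
by rewrite mxE (negbTE ij) mulr0.
Qed.

Lemma hol_coord (j : 'I_d) : hol (fun x => x j 0).
Proof.
move=> x; exists (fun i => (i == j)%:R).
have E k : k j 0 = lin (fun i => (i == j)%:R) k.
  rewrite /lin (bigD1 j) //= eqxx mul1r big1 ?addr0 // => i ij.
  by rewrite (negbTE ij) mul0r.
apply: eq_frechet (frechet_lin (A := fun k : V => k j 0) x ler01 _ _) => //.
- by move=> h k; rewrite mxE.
- by move=> k; rewrite mul1r cn_entry.
Qed.

Lemma frechet_line x v (z : K) :
  frechet cn vn (fun z : K => x + z *: v) z (fun c : K => c *: v).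
Proof.
split; first by exists (vn v) => [|c]; [exact: snorm_ge0|rewrite mulrC vnZ].
move=> e e0; exists 1 => // c _.
rewrite scalerDl addrA (addrC (x + z *: v)) addrK subrr snorm0.
by rewrite mulr_ge0 ?snorm_ge0 // ltW.
Qed.

Lemma frechet_rline x v (t : R) :
  frechet absn vn (fun t : R => x + t%:C *: v) t (fun h : R => h%:C *: v).
Proof.
split; first by exists (vn v) => [|c]; [exact: snorm_ge0|rewrite vnZr mulrC].
move=> e e0; exists 1 => // c _.
rewrite rmorphD scalerDl addrA (addrC (x + t%:C *: v)) addrK subrr snorm0.
by rewrite mulr_ge0 ?snorm_ge0 // ltW.
Qed.

Definition circle (t : R) : K := cexp (0 +i* t).
Definition circleN (t : R) : K := cexp (- (0 +i* t)).

Lemma cont_circle t : cont absn cn circle t.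
Proof. exact: cont_comp (cont_vert 0 t) (entire_cont _ (@entire_cexp R)). Qed.

Lemma cont_circleN t : cont absn cn circleN t.
Proof.
apply: (cont_comp (cont_vert 0 t) (v := fun w => cexp (- w))).
exact: (entire_cont _ (entire_comp (@entireN R) (@entire_cexp R))).
Qed.

Lemma cn_circleN t : cn (circleN t) <= 2.
Proof. by have := cn_cexp (- (0 +i* t)); rewrite /= oppr0 expR0 mulr1. Qed.

(** Up to the factor 2 pi, the mean over the circle of radius 1 around x in the
direction v that the Cauchy formula identifies with the derivative of u along
v.  Unlike the derivative, it makes sense and is continuous in x for every
continuous u. *)
Definition circle_mean v u x : K :=
  cint (fun t => (u (x + circle t *: v) - u x) * circleN t) 0 tau.

Lemma cont_ray v x t : cont absn vn (fun t => x + circle t *: v) t.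
Proof.
apply: (cont_comp (cont_circle t) (v := fun z : K => x + z *: v)).
exact: frechet_cont (frechet_line _ _ _).
Qed.

Lemma cont_circle_integrand v u x t : (forall y, cont vn cn u y) ->
  cont absn cn (fun t => (u (x + circle t *: v) - u x) * circleN t) t.
Proof.
move=> hu; apply: contM; last exact: cont_circleN.
apply: contB; last exact: cont_cst.
exact: (cont_comp (cont_ray v x t) (hu _)).
Qed.

Lemma circle_mean_derivative v phi x g : hol phi -> frechet vn cn phi x (lin g) ->
  circle_mean v phi x = lin g v * tau%:C.
Proof.
move=> hp hg.
pose q (z : K) := phi (x + z *: v).
have q0 : q 0 = phi x by rewrite /q scale0r addr0.
rewrite -(@cauchy_derivative R q (lin g v)).
- by rewrite q0.
- move=> z; have [h hh] := hp (x + z *: v).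
  exists (lin h v); apply: eq_frechet (frechet_comp (linDr h) (frechet_line x v z) hh) => //.
  by move=> k /=; rewrite linZr mulrC.
- rewrite -[x]addr0 -(scale0r v) in hg.
  apply: eq_frechet (frechet_comp (linDr g) (frechet_line x v 0) hg) => //.
  by move=> k /=; rewrite linZr mulrC.
Qed.

(** Defined by the Cauchy formula rather than by a limit, which makes its
regularity accessible. *)
Definition pd phi (j : 'I_d) x : K := circle_mean (basis_vec j) phi x / tau%:C.

Lemma tauC_neq0 : tau%:C != 0 :> K.
Proof. by rewrite (fmorph_eq0 (real_complex R)) gt_eqF // tau_gt0. Qed.

Lemma pdE phi x g j : hol phi -> frechet vn cn phi x (lin g) -> pd phi j x = g j.
Proof.
move=> hp hg; rewrite /pd (circle_mean_derivative (basis_vec j) hp hg) lin_basis_vec mulfK //.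
exact: tauC_neq0.
Qed.

Lemma hol_pd phi x : hol phi -> frechet vn cn phi x (lin (fun j => pd phi j x)).
Proof.
move=> hp; have [g hg] := hp x.
by rewrite (_ : (fun j => pd phi j x) = g) //; apply/funext => j; exact: pdE.
Qed.

Lemma joint_cont u (c : R -> V) x t : cont vn cn u (x + c t) -> cont absn vn c t ->
  forall e : R, 0 < e -> exists2 r : R, 0 < r & forall k s, vn k <= r -> `|s - t| <= r ->
    cn (u (x + k + c s) - u (x + c s)) <= e.
Proof.
move=> hu hc e e0; have e2 : 0 < e / 2 by lra.
have [r r0 hr] := hu _ e2; have r2 : 0 < r / 2 by lra.
have [r' r'0 hr'] := hc _ r2; exists (Num.min (r / 2) r'); first by rewrite lt_min r2.
move=> k s; rewrite !le_min => /andP[kr _] /andP[_ sr].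
have cs : vn (c s - c t) <= r / 2 by have := hr' _ sr; rewrite (addrC t) subrK.
have h1 := hr (c s - c t); have h2 := hr (k + (c s - c t)).
have E1 : x + c t + (c s - c t) = x + c s by rewrite -addrA (addrC (c t)) subrK.
have E2 : x + c t + (k + (c s - c t)) = x + k + c s.
  by rewrite addrACA (addrC (c t)) subrK.
rewrite E1 in h1; rewrite E2 in h2.
have n2 := snormD vn k (c s - c t).
have {}h1 := h1 _; have {}h2 := h2 _.
have -> : u (x + k + c s) - u (x + c s) =
  (u (x + k + c s) - u (x + c t)) - (u (x + c s) - u (x + c t)) by ring.
rewrite (le_trans (snormB _ _ _)) //.
have := h1 ltac:(lra); have := h2 ltac:(lra); lra.
Qed.

Lemma circle_mean_cont v u x : (forall y, cont vn cn u y) -> cont vn cn (circle_mean v u) x.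
Proof.
move=> hu e e0.
pose e1 := e / (4 * tau).
have e10 : 0 < e1 by rewrite divr_gt0 // mulr_gt0 // tau_gt0.
have [r r0 hr] : exists2 r : R, 0 < r & forall k, vn k <= r -> forall t, 0 <= t <= tau ->
   cn ((u (x + k + circle t *: v) - u (x + k)) * circleN t -
       (u (x + circle t *: v) - u x) * circleN t) <= e1 * 4.
  apply: tube => [|t _]; first by rewrite ltW // tau_gt0.
  have cc : cont absn vn (fun t => circle t *: v) t.
    have := cont_ray v 0 t; rewrite (_ : (fun t => 0 + _) = (fun t => circle t *: v)) //.
    by apply/funext => s; rewrite add0r.
  have [r r0 hr] := joint_cont (hu (x + circle t *: v)) cc e10.
  have [r' r'0 hr'] := hu x _ e10.
  exists (Num.min r r'); first by rewrite lt_min r0.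
  move=> k s; rewrite !le_min => /andP[kr kr'] /andP[sr _].
  have := hr k s kr sr; have := hr' k kr'.
  set A := u (x + k + _); set B := u (x + k); set C := u (x + _); set D := u x.
  move=> h1 h2; rewrite -mulrBl (le_trans (cnM _ _)) //.
  have -> : A - B - (C - D) = (A - C) - (B - D) by ring.
  have h3 := snormB cn (A - C) (B - D).
  apply: (@le_trans _ _ ((e1 * 2) * 2)); last by lra.
  apply: ler_pM; rewrite ?snorm_ge0 ?cn_circleN //; lra.
exists r => // k kr; rewrite /circle_mean -cintB; [|by move=> t; exact: cont_circle_integrand..].
have -> : e = e1 * 4 * (tau - 0).
  have t0 : tau != 0 :> R by rewrite gt_eqF // tau_gt0.
  by rewrite subr0 /e1; move: (tau) t0 => t t0; field.
apply: cint_bound; rewrite ?ltW ?tau_gt0 //; last exact: hr.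
by move=> t; apply: contB; exact: cont_circle_integrand.
Qed.

Lemma pd_cont phi j x : hol phi -> cont vn cn (pd phi j) x.
Proof.
move=> hp; apply: contM; last exact: cont_cst.
by apply: circle_mean_cont => y; exact: hol_cont.
Qed.

(** Mean value inequality for t |-> phi (p + t k) - t dphi_p(k), whose derivative
is small because the partial derivatives are continuous at x. *)
Lemma strict_diff phi x (e : R) : hol phi -> 0 < e -> exists2 r : R, 0 < r &
  forall p k, vn (p - x) <= r -> vn k <= r ->
    cn (phi (p + k) - phi p - lin (fun j => pd phi j p) k) <= e * vn k.
Proof.
move=> hp e0; have e2 : 0 < e / 2 by lra.
have [r r0 hr] : exists2 r : R, 0 < r & forall j q, vn q <= r ->
    cn (pd phi j (x + q) - pd phi j x) <= e / 2.
  apply: (finite_min (P := fun j r => forall q, vn q <= r -> _)) => [j r r' _ rr h q qr|j].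
    by apply: h; exact: le_trans qr rr.
  exact: pd_cont.
exists (r / 2) => [|p k pr kr]; first by lra.
pose L := lin (fun j => pd phi j p) k.
pose u (t : R) := phi (p + t%:C *: k) - t%:C * L.
have -> : phi (p + k) - phi p - lin (fun j => pd phi j p) k = u 1 - u 0.
  by rewrite /u -/L rmorph1 rmorph0 scale1r scale0r mul1r mul0r addr0; ring.
rewrite -[X in _ <= X]mulr1 -[X in _ * X](subr0 1).
apply: mean_value => // t /andP[t0 t1].
have H := frechetB (frechet_comp (linDr _) (frechet_rline p k t) (hol_pd _ hp))
   (frechetM (rder_id t) (frechet_cst L t)).
exists (fun h : R => h%:C * (lin (fun j => pd phi j (p + t%:C *: k)) k - L)).
  apply: eq_frechet H => // h /=; rewrite linZr; ring.
move=> h; rewrite cn_realM mulrC ler_wpM2r //.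
have -> : lin (fun j => pd phi j (p + t%:C *: k)) k - L =
   lin (fun j => pd phi j (p + t%:C *: k) - pd phi j p) k.
  by rewrite /L /lin -sumrB; apply: eq_bigr => j _; rewrite mulrBl.
apply: lin_bound; first exact: ltW.
move=> j.
have h1 := hr j (p - x); have h2 := hr j (p - x + t%:C *: k).
rewrite addrA in h2; rewrite (addrC x) subrK in h1 h2.
have n1 := snormD vn (p - x) (t%:C *: k).
have n2 : vn (t%:C *: k) <= r / 2.
  rewrite vnZr ger0_norm // (le_trans _ kr) // ler_piMl ?snorm_ge0 //.
have -> : pd phi j (p + t%:C *: k) - pd phi j p =
  (pd phi j (p + t%:C *: k) - pd phi j x) - (pd phi j p - pd phi j x) by ring.
rewrite (le_trans (snormB _ _ _)) //.
have := h1 ltac:(lra); have := h2 ltac:(lra); lra.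
Qed.

(** Differentiation under the integral sign: strict differentiability provides
a remainder that is uniform over the circle. *)
Lemma circle_mean_frechet v phi x : hol phi ->
  frechet vn cn (circle_mean v phi) x (lin (fun j => circle_mean v (pd phi j) x)).
Proof.
move=> hp; have ch y : cont vn cn phi y by exact: hol_cont.
have cpd j y : cont vn cn (pd phi j) y by exact: pd_cont.
split.
  exists (\sum_j cn (circle_mean v (pd phi j) x)).
    by apply: sumr_ge0 => j _; exact: snorm_ge0.
  move=> k; apply: lin_bound => [|j]; first by apply: sumr_ge0 => j _; exact: snorm_ge0.
  by rewrite (bigD1 j) //= lerDl; apply: sumr_ge0 => i _; exact: snorm_ge0.
move=> e e0.
pose e1 := e / (4 * tau).
have e10 : 0 < e1 by rewrite divr_gt0 // mulr_gt0 // tau_gt0.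
pose G k t := ((phi (x + k + circle t *: v) - phi (x + k)) * circleN t -
  (phi (x + circle t *: v) - phi x) * circleN t) -
  \sum_j k j 0 * ((pd phi j (x + circle t *: v) - pd phi j x) * circleN t).
have [r r0 hr] : exists2 r : R, 0 < r & forall k, vn k <= r -> forall t, 0 <= t <= tau ->
   cn (G k t) <= e1 * 4 * vn k.
  apply: tube => [|t _]; first by rewrite ltW // tau_gt0.
  have [r1 r10 hr1] := strict_diff (x + circle t *: v) hp e10.
  have [r2 r20 hr2] := strict_diff x hp e10.
  have [r3 r30 hr3] := cont_ray v x t r10.
  exists (Num.min r1 (Num.min r2 r3)); first by rewrite !lt_min r10 r20.
  move=> k s; rewrite !le_min => /andP[k1 /andP[k2 _]] /andP[_ /andP[_ s3]].
  have := hr3 _ s3; rewrite (addrC t) subrK => hs.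
  have := hr1 _ k hs k1; have := hr2 x k _ k2; rewrite subrr snorm0 => /(_ (ltW r20)).
  set A := lin _ k; set B := lin _ k => h2 h1.
  have -> : G k s = ((phi (x + circle s *: v + k) - phi (x + circle s *: v) - B) -
     (phi (x + k) - phi x - A)) * circleN s.
    rewrite /G (addrAC x k) /A /B /lin.
    rewrite (_ : \sum_j k j 0 * _ = (\sum_j pd phi j (x + circle s *: v) * k j 0 -
       \sum_j pd phi j x * k j 0) * circleN s); first by ring.
    by rewrite -sumrB mulr_suml; apply: eq_bigr => j _; ring.
  rewrite (le_trans (cnM _ _)) //.
  set P := _ - B in h1 *; set Q := _ - A in h2 *.
  have h3 := snormB cn P Q.
  apply: (@le_trans _ _ ((e1 * 2 * vn k) * 2)); last by lra.
  apply: ler_pM; rewrite ?snorm_ge0 ?cn_circleN //; lra.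
exists r => // k kr.
have c1 t : cont absn cn (fun t => (phi (x + k + circle t *: v) - phi (x + k)) * circleN t -
  (phi (x + circle t *: v) - phi x) * circleN t) t.
  by apply: contB; exact: cont_circle_integrand.
have c2 j t : cont absn cn (fun t => k j 0 * ((pd phi j (x + circle t *: v) - pd phi j x) * circleN t)) t.
  by apply: contZ; exact: cont_circle_integrand.
have c3 t : cont absn cn (fun t => \sum_j k j 0 * ((pd phi j (x + circle t *: v) - pd phi j x) * circleN t)) t.
  by apply: cont_sum => j.
have -> : circle_mean v phi (x + k) - circle_mean v phi x - lin (fun j => circle_mean v (pd phi j) x) k =
   cint (G k) 0 tau.
  rewrite /G cintB // cintB; [|by move=> t; exact: cont_circle_integrand..].
  rewrite cint_sum //; congr (_ - _); apply: eq_bigr => j _.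
  by rewrite cintZ 1?mulrC // => t; exact: cont_circle_integrand.
have -> : e * vn k = e1 * 4 * vn k * (tau - 0).
  have t0 : tau != 0 :> R by rewrite gt_eqF // tau_gt0.
  by rewrite subr0 /e1; move: (tau) t0 => t t0; field.
apply: cint_bound; rewrite ?ltW ?tau_gt0 //; last exact: hr.
by move=> t; exact: contB.
Qed.

(** Partial derivatives are circle means of phi, which inherit the
differentiability of phi; so a single complex derivative yields all of them. *)
Theorem pd_hol phi j : hol phi -> hol (pd phi j).
Proof.
move=> hp x; exists (fun i => tau%:C^-1 * circle_mean (basis_vec j) (pd phi i) x).
apply: eq_frechet (frechetZ (tau%:C^-1) (circle_mean_frechet (basis_vec j) x hp)).
  by move=> y; rewrite /pd mulrC.
by move=> k; rewrite /lin mulr_sumr; apply: eq_bigr => i _; rewrite mulrA.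
Qed.

Definition lie (f : 'I_d -> V -> K) phi x : K := lin (fun j => pd phi j x) (\col_j f j x).

Lemma lie_hol f phi : (forall j, hol (f j)) -> hol phi -> hol (lie f phi).
Proof.
move=> hf hp.
rewrite (_ : lie f phi = fun x => \sum_j pd phi j x * f j x).
  by apply: hol_sum => j; apply: holM => //; exact: pd_hol.
by apply/funext => x; apply: eq_bigr => j _; rewrite mxE.
Qed.

Lemma hol_locally_bounded phi x : hol phi -> exists2 B : R, 0 < B &
  exists2 r : R, 0 < r & forall y, vn (y - x) <= r -> cn (phi y) <= B.
Proof.
move=> hp; have [r r0 hr] := hol_cont x hp ltr01.
exists (cn (phi x) + 1); first by rewrite ltr_wpDl ?snorm_ge0.
exists r => // y /hr; rewrite (addrC x) subrK => h.
rewrite -[phi y](subrK (phi x)) (le_trans (snormD _ _ _)) // addrC lerD2l //.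
Qed.

Lemma hol_locally_lipschitz phi x : hol phi -> exists2 B : R, 0 < B &
  exists2 r : R, 0 < r & forall y z, vn (y - x) <= r -> vn (z - x) <= r ->
    cn (phi z - phi y) <= B * vn (z - y).
Proof.
move=> hp; have [r r0 hr] := strict_diff x hp ltr01.
have [r' r'0 hr'] : exists2 r' : R, 0 < r' & forall j q, vn q <= r' ->
    cn (pd phi j (x + q) - pd phi j x) <= 1.
  apply: (finite_min (P := fun j r => forall q, vn q <= r -> _)) => [j s s' _ rr h q qr|j].
    by apply: h; exact: le_trans qr rr.
  exact: pd_cont.
pose B := \sum_j cn (pd phi j x) + 1.
have B0 : 0 < B by rewrite ltr_wpDl // sumr_ge0 // => j _; exact: snorm_ge0.
exists (B + 1); first by lra.
exists (Num.min (r / 2) r'); first by rewrite lt_min r'0 andbT; lra.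
move=> y z; rewrite !le_min => /andP[y1 y2] /andP[z1 z2].
have zy : vn (z - y) <= r.
  have -> : z - y = (z - x) - (y - x) by rewrite opprB addrA subrK.
  have := snormB vn (z - x) (y - x); lra.
have yr : vn (y - x) <= r by lra.
have := hr y (z - y) yr zy; rewrite (addrC y) subrK => h.
rewrite -[phi z - phi y](subrK (lin (fun j => pd phi j y) (z - y))).
rewrite (le_trans (snormD _ _ _)) // mulrDl addrC lerD //.
apply: lin_bound; first exact: ltW.
move=> j; have := hr' j _ y2; rewrite (addrC x) subrK => h'.
rewrite -[pd phi j y](subrK (pd phi j x)) (le_trans (snormD _ _ _)) //.
rewrite addrC lerD // (bigD1 j) //= lerDl; apply: sumr_ge0 => i _; exact: snorm_ge0.
Qed.

End SeveralVariables.
Global Opaque vn.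

(** * Taylor expansion along solutions *)

Section Expansion.
Context {R : realType} {d : nat}.
Local Notation K := R[i].
Local Notation V := 'cV[K]_d.
Local Notation absn := (@absn R).
Local Notation cn := (@cn R).
Local Notation vn := (@vn R d).

Section Fields.
Variables (f0 f1 : 'I_d -> V -> K).
Hypotheses (hf0 : forall j, hol (f0 j)) (hf1 : forall j, hol (f1 j)).
Implicit Types (c : seq bool -> K) (phi : V -> K) (x y : V).

Definition field (b : bool) := if b then f1 else f0.

Lemma field_hol b j : hol (field b j). Proof. by case: b. Qed.

Definition field_derive b phi := lie (field b) phi.

Lemma field_derive_hol b phi : hol phi -> hol (field_derive b phi).
Proof. by apply: lie_hol => j; exact: field_hol. Qed.

(** Sum of T^|w| c(w) (L_w phi)(x) over the words of length at most n, where the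
first letter of w is the first derivation applied to phi. *)
Fixpoint ser n c phi (T : R) x : K :=
  c [::] * phi x + if n is n'.+1 then
    T%:C * (ser n' (fun w => c (false :: w)) (field_derive false phi) T x +
            ser n' (fun w => c (true :: w)) (field_derive true phi) T x) else 0.

Lemma serS n c phi T x : ser n.+1 c phi T x = c [::] * phi x +
    T%:C * (ser n (fun w => c (false :: w)) (field_derive false phi) T x +
            ser n (fun w => c (true :: w)) (field_derive true phi) T x).
Proof. by []. Qed.

Lemma serZ n a c phi T x : ser n (fun w => a * c w) phi T x = a * ser n c phi T x.
Proof.
elim: n c phi => [|n IH] c phi; first by rewrite /= !addr0 mulrA.
by rewrite !serS !IH; ring.
Qed.

Lemma serD n c c' phi T x :
  ser n (fun w => c w + c' w) phi T x = ser n c phi T x + ser n c' phi T x.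
Proof.
elim: n c c' phi => [|n IH] c c' phi; first by rewrite /= !addr0 mulrDl.
by rewrite !serS !IH; ring.
Qed.

Lemma eq_ser n c c' phi T x : (forall w, (size w <= n)%N -> c w = c' w) ->
  ser n c phi T x = ser n c' phi T x.
Proof.
elim: n c c' phi => [|n IH] c c' phi h; first by rewrite /= h.
rewrite !serS h //; congr (_ + _ * (_ + _)).
  by apply: IH => w hw; apply: h.
by apply: IH => w hw; apply: h.
Qed.

Lemma ser_T0 n c phi x : ser n c phi 0 x = c [::] * phi x.
Proof. by case: n => [|n] /=; rewrite ?addr0 // rmorph0 mul0r addr0. Qed.

(** The recursive form of the product of series matches the substitution of
the expansion of c' into that of c. *)
Lemma ser_smul n c c' phi T x : ser n.+1 (smul c c') phi T x =
  c [::] * ser n.+1 c' phi T x +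
  T%:C * (ser n (smul (fun w => c (false :: w)) c') (field_derive false phi) T x +
          ser n (smul (fun w => c (true :: w)) c') (field_derive true phi) T x).
Proof.
rewrite !serS /= !serD !serZ; ring.
Qed.

(** The coefficients of the m-th iterated integral of the exponential; removing
the first letter of a word raises m by one. *)
Definition sexpm (m : nat) (p q : K) w : K := letters p q w / ((size w + m)`!)%:R.

Lemma sexpm0 p q : sexpm 0 p q = sexp p q.
Proof. by apply/funext => w; rewrite /sexpm addn0. Qed.

Lemma sexpm_cons m p q b :
  (fun w => sexpm m p q (b :: w)) = (fun w => (if b then q else p) * sexpm m.+1 p q w).
Proof.
by apply/funext => w; rewrite /sexpm letters_cons -mulrA /= addSnnS.
Qed.

Lemma rderX (n : nat) (t : R) : rder (fun s : R => s%:C ^+ n.+1) t (n.+1%:R * t%:C ^+ n).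
Proof.
elim: n => [|n IH]; first by rewrite expr0 mulr1; exact: rder_id.
apply: rder_eq (rderM (rder_id t) IH) _ _ => [s|]; first by rewrite [RHS]exprS.
by rewrite !mulrS exprS; ring.
Qed.

(** Every term t^(m+1+|w|) / (m+1+|w|)! differentiates to the term of index m. *)
Lemma rder_ser n m p q phi T x t :
  rder (fun s : R => s%:C ^+ m.+1 * ser n (sexpm m.+1 p q) phi (s * T) x) t
       (t%:C ^+ m * ser n (sexpm m p q) phi (t * T) x).
Proof.
have fm (k : nat) : (k`!%:R : K) != 0 by exact: factr_neq0.
have E0 k : sexpm k p q [::] = (k`!%:R)^-1 by rewrite /sexpm letters_nil mul1r.
have F : (m.+1`!%:R : K)^-1 * m.+1%:R = (m`!%:R)^-1.
  by rewrite factS natrM invfM mulrAC mulVf ?mul1r // pnatr_eq0.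
elim: n m phi F => [|n IH] m phi F.
  apply: rder_eq (rderZ ((m.+1`!%:R)^-1 * phi x) (rderX m t)) _ _ => [s|].
    by rewrite /= addr0 E0 mulrC.
  by rewrite /= addr0 E0 -F; ring.
have F1 : (m.+2`!%:R : K)^-1 * m.+2%:R = (m.+1`!%:R)^-1.
  by rewrite factS natrM invfM mulrAC mulVf ?mul1r // pnatr_eq0.
have h1 := rderZ ((m.+1`!%:R)^-1 * phi x) (rderX m t).
have h2 := rderZ (T%:C * p) (IH m.+1 (field_derive false phi) F1).
have h3 := rderZ (T%:C * q) (IH m.+1 (field_derive true phi) F1).
apply: rder_eq (rderD h1 (rderD h2 h3)) _ _ => [s|].
  rewrite serS E0 !sexpm_cons !serZ rmorphM /= [_ ^+ m.+2]exprS; ring.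
by rewrite serS E0 !sexpm_cons !serZ rmorphM /= -F [_ ^+ m.+1]exprS; ring.
Qed.

Lemma rder_sexp n p q phi T x t :
  rder (fun s : R => ser n.+1 (sexp p q) phi (s * T) x) t
   (T%:C * (p * ser n (sexp p q) (field_derive false phi) (t * T) x +
            q * ser n (sexp p q) (field_derive true phi) (t * T) x)).
Proof.
have h2 := rderZ (T%:C * p) (rder_ser n 0 p q (field_derive false phi) T x t).
have h3 := rderZ (T%:C * q) (rder_ser n 0 p q (field_derive true phi) T x t).
apply: rder_eq (rderD (rder_cst (phi x) t) (rderD h2 h3)) _ _ => [s|].
  rewrite -sexpm0 serS !sexpm_cons !serZ rmorphM /= /sexpm letters_nil.
  by rewrite fact0 divr1; ring.
by rewrite -!sexpm0 expr0; ring.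
Qed.

Definition vfield (T : R) (p q : K) (x : V) : V :=
  T%:C *: (p *: (\col_j f0 j x) + q *: (\col_j f1 j x)).

Definition solution (T : R) (p q : K) (gamma : R -> V) :=
  forall t, 0 <= t <= 1 ->
    frechet absn vn gamma t (fun h : R => h%:C *: vfield T p q (gamma t)).

Lemma rder_solution T p q gamma phi t : solution T p q gamma -> hol phi ->
  0 <= t <= 1 -> rder (fun s => phi (gamma s)) t
    (T%:C * (p * field_derive false phi (gamma t) + q * field_derive true phi (gamma t))).
Proof.
move=> hg hp /hg {}hg.
apply: eq_frechet (frechet_comp (linDr _) hg (hol_pd _ hp)) => // h /=.
by rewrite linZr /vfield linZr linDr !linZr.
Qed.

(** By induction on n: the remainder of order n + 1 vanishes at time 0 and its
derivative is T times a combination of the remainders of order n of the two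
Lie derivatives of phi. *)
Lemma taylor n phi x0 p q : hol phi -> exists2 C : R, 0 <= C & exists2 r : R, 0 < r &
  forall T gamma, 0 <= T -> solution T p q gamma ->
   (forall t, 0 <= t <= 1 -> vn (gamma t - x0) <= r) ->
   forall t, 0 <= t <= 1 ->
   cn (phi (gamma t) - ser n (sexp p q) phi (t * T) (gamma 0)) <= C * T ^+ n.+1.
Proof.
elim: n phi => [|n IH] phi hp.
  have [B0 B00 [r0 r00 h0]] := hol_locally_bounded x0 (field_derive_hol false hp).
  have [B1 B10 [r1 r10 h1]] := hol_locally_bounded x0 (field_derive_hol true hp).
  exists (cn p * B0 + cn q * B1).
    by apply: addr_ge0; apply: mulr_ge0; rewrite ?snorm_ge0 // ltW.
  exists (Num.min r0 r1); first by rewrite lt_min r00.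
  move=> T gamma T0 hg hr t /andP[t0 t1].
  rewrite /= sexp_nil mul1r addr0 expr1 -[X in _ <= X]mulr1.
  rewrite (@le_trans _ _ ((cn p * B0 + cn q * B1) * T * (t - 0))) //; last first.
    rewrite subr0 ler_wpM2l // mulr_ge0 //.
    by apply: addr_ge0; apply: mulr_ge0; rewrite ?snorm_ge0 // ltW.
  apply: (mean_value (u := fun s => phi (gamma s)) (M := cn)) => // s /andP[s0 st].
  have s01 : 0 <= s <= 1 by rewrite s0 (le_trans st).
  exists (fun h : R => h%:C * (T%:C * (p * field_derive false phi (gamma s) + q * field_derive true phi (gamma s)))).
    exact: rder_solution.
  move=> h; rewrite cn_realM mulrC ler_wpM2r // cn_realM ger0_norm // mulrC ler_wpM2r //.
  have := hr s s01; rewrite le_min => /andP[/h0 b0 /h1 b1].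
  rewrite (le_trans (snormD _ _ _)) // lerD // (le_trans (cnM _ _)) // ler_wpM2l //;
    exact: snorm_ge0.
have [C0 C00 [r0 r00 h0]] := IH _ (field_derive_hol false hp).
have [C1 C10 [r1 r10 h1]] := IH _ (field_derive_hol true hp).
exists (cn p * C0 + cn q * C1).
  by apply: addr_ge0; apply: mulr_ge0; rewrite ?snorm_ge0.
exists (Num.min r0 r1); first by rewrite lt_min r00.
move=> T gamma T0 hg hr t /andP[t0 t1].
have hr0 s : 0 <= s <= 1 -> vn (gamma s - x0) <= r0.
  by move=> /hr; rewrite le_min => /andP[].
have hr1 s : 0 <= s <= 1 -> vn (gamma s - x0) <= r1.
  by move=> /hr; rewrite le_min => /andP[].
pose u s := phi (gamma s) - ser n.+1 (sexp p q) phi (s * T) (gamma 0).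
have u0 : u 0 = 0 by rewrite /u mul0r ser_T0 sexp_nil mul1r subrr.
rewrite -/(u t) -[u t]subr0 -u0.
rewrite (@le_trans _ _ ((cn p * C0 + cn q * C1) * T ^+ n.+2 * (t - 0))) //; last first.
  rewrite subr0 ler_piMr // mulr_ge0 ?exprn_ge0 //.
  by apply: addr_ge0; apply: mulr_ge0; rewrite ?snorm_ge0 // ltW.
apply: (mean_value (u := u) (M := cn)) => // s /andP[s0 st].
have s01 : 0 <= s <= 1 by rewrite s0 (le_trans st).
exists (fun h : R => h%:C * (T%:C * (p * field_derive false phi (gamma s) + q * field_derive true phi (gamma s)) -
   (T%:C * (p * ser n (sexp p q) (field_derive false phi) (s * T) (gamma 0) +
            q * ser n (sexp p q) (field_derive true phi) (s * T) (gamma 0))))).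
  exact: (rderB (rder_solution hg hp s01) (rder_sexp n p q phi T (gamma 0) s)).
move=> h; rewrite cn_realM mulrC ler_wpM2r // -mulrBr cn_realM ger0_norm //.
have -> : (cn p * C0 + cn q * C1) * T ^+ n.+2 =
   T * (cn p * (C0 * T ^+ n.+1) + cn q * (C1 * T ^+ n.+1)).
  by rewrite [T ^+ n.+2]exprS; ring.
rewrite ler_wpM2l //.
set A0 := field_derive _ _ _; set A1 := field_derive _ _ _; set S0 := ser _ _ _ _ _; set S1 := ser _ _ _ _ _.
have -> : p * A0 + q * A1 - (p * S0 + q * S1) = p * (A0 - S0) + q * (A1 - S1) by ring.
rewrite (le_trans (snormD _ _ _)) // lerD // (le_trans (cnM _ _)) // ler_wpM2l ?snorm_ge0 //.
  exact: (h0 T gamma T0 hg hr0 s s01).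
exact: (h1 T gamma T0 hg hr1 s s01).
Qed.

Lemma vfield_bound p q x0 : exists2 B : R, 0 <= B & exists2 r : R, 0 < r &
  forall T x, 0 <= T -> vn (x - x0) <= r -> vn (vfield T p q x) <= T * B.
Proof.
have H b : exists2 B : R, 0 <= B & exists2 r : R, 0 < r &
   forall x, vn (x - x0) <= r -> vn (\col_j field b j x) <= B.
  have /choice[B hB] : forall j, exists B : R, 0 < B /\ exists2 r : R, 0 < r &
     forall y, vn (y - x0) <= r -> cn (field b j y) <= B.
    by move=> j; have [B B0 h] := hol_locally_bounded x0 (field_hol b j); exists B.
  exists (\sum_j B j); first by apply: sumr_ge0 => j _; rewrite ltW // (hB j).1.
  have [r r0 hr] := @finite_min R _ (fun j r => forall y, vn (y - x0) <= r -> cn (field b j y) <= B j)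
    ltac:(by move=> j s s' _ ss h y hy; apply: h; exact: le_trans hy ss)
    (fun j => (hB j).2).
  exists r => // x hx; rewrite vnE; apply: ler_sum => j _.
  by rewrite mxE; exact: hr.
have [B0 B00 [r0 r00 h0]] := H false; have [B1 B10 [r1 r10 h1]] := H true.
exists (cn p * B0 + cn q * B1).
  by apply: addr_ge0; apply: mulr_ge0; rewrite ?snorm_ge0.
exists (Num.min r0 r1); first by rewrite lt_min r00.
move=> T x T0; rewrite le_min => /andP[/h0 b0 /h1 b1].
rewrite /vfield vnZr ger0_norm // ler_wpM2l // (le_trans (snormD _ _ _)) //.
by apply: lerD; rewrite (le_trans (vnZ _ _)) // ler_wpM2l ?snorm_ge0.
Qed.

(** As long as the solution is in the ball of radius m / 2, its speed is at most
m / 8, so it is in fact within m / 4 of x0, and continuity carries it a bit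
further.  The argument is an induction over the time interval. *)
Lemma solution_stays p q x0 r : 0 < r -> exists2 s : R, 0 < s &
  forall T gamma, 0 <= T <= s -> solution T p q gamma -> vn (gamma 0 - x0) <= s ->
  forall t, 0 <= t <= 1 -> vn (gamma t - x0) <= r.
Proof.
move=> r0; have [B B0 [r' r'0 hB]] := vfield_bound p q x0.
pose m := Num.min r r'; have m0 : 0 < m by rewrite lt_min r0.
have mr : m <= r by rewrite ge_min lexx.
have mr' : m <= r' by rewrite ge_min lexx orbT.
exists (Num.min (m / 8) (m / 8 / (B + 1))).
  by rewrite lt_min !divr_gt0 // ltr_wpDl.
move=> T gamma /andP[T0]; rewrite !le_min => /andP[T1 T2] hg /andP[g0 _].
have TB : T * B <= m / 8.
  rewrite ler_pdivlMr ?ltr_wpDl // in T2.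
  by rewrite (le_trans _ T2) // ler_wpM2l // lerDl.
suff H : (forall s, 0 <= s <= 0 -> vn (gamma s - x0) <= m / 2) ->
         (forall s, 0 <= s <= 1 -> vn (gamma s - x0) <= m / 2).
  move=> t t01; rewrite (le_trans (H _ _ t01)) //; last by lra.
  move=> s s0; have -> : s = 0 by lra.
  by rewrite (le_trans g0) //; lra.
apply: (@cousin R (fun a b => (forall s, 0 <= s <= a -> vn (gamma s - x0) <= m / 2) ->
   (forall s, 0 <= s <= b -> vn (gamma s - x0) <= m / 2))) => //.
  by move=> a b c _ _ _ _ h1 h2 /h1.
move=> t t01; have m8 : 0 < m / 8 by lra.
have [e e0 he] := frechet_cont (hg t t01) m8.
exists e => // a b a0 at_ tb b1 bae ha s /andP[s0 sb].
have [sa|as_] := leP s a; first by apply: ha; rewrite s0.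
have close z : a <= z <= b -> vn (gamma z - gamma t) <= m / 8.
  move=> /andP[az zb]; have := he (z - t); rewrite (addrC t) subrK; apply.
  by rewrite /= ler_norml; apply/andP; split; lra.
have aB : vn (gamma a - gamma 0) <= m / 8 * (a - 0).
  apply: mean_value => // z /andP[z0 za].
  have z01 : 0 <= z <= 1 by rewrite z0; lra.
  exists (fun h : R => h%:C *: vfield T p q (gamma z)); first exact: hg.
  move=> h; rewrite vnZr mulrC ler_wpM2r // (le_trans _ TB) // hB //.
  by rewrite (le_trans (ha z _)) ?z0 //; lra.
have a1 : m / 8 * (a - 0) <= m / 8.
  by rewrite subr0 ler_piMr ?(ltW m8) //; lra.
have -> : gamma s - x0 = (gamma s - gamma t) - (gamma a - gamma t) +
    ((gamma a - gamma 0) + (gamma 0 - x0)).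
  by rewrite opprB !addrA !subrK.
have n1 := snormD vn ((gamma s - gamma t) - (gamma a - gamma t)) ((gamma a - gamma 0) + (gamma 0 - x0)).
have n2 := snormB vn (gamma s - gamma t) (gamma a - gamma t).
have n3 := snormD vn (gamma a - gamma 0) (gamma 0 - x0).
have c1 : vn (gamma s - gamma t) <= m / 8 by apply: close; rewrite sb ltW.
have c2 : vn (gamma a - gamma t) <= m / 8 by apply: close; lra.
lra.
Qed.

(** P T x y reads: y is an image of x at step T.  The expansion is required for
all y related to x, and locally uniformly in x, which is what composition
needs. *)
Definition expands (P : R -> V -> V -> Prop) c := c [::] = 1 /\
  forall n phi x0, hol phi -> exists2 C : R, 0 <= C & exists2 r : R, 0 < r &
    forall T x y, 0 < T <= r -> vn (x - x0) <= r -> P T x y ->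
      cn (phi y - ser n c phi T x) <= C * T ^+ n.+1.

Definition solvable (P : R -> V -> V -> Prop) := forall x0, exists2 r : R, 0 < r &
  forall T x, 0 < T <= r -> vn (x - x0) <= r -> exists y, P T x y.

Definition flow_rel p q (T : R) (x y : V) := exists gamma : R -> V,
  [/\ gamma 0 = x, solution T p q gamma & gamma 1 = y].

Lemma flow_expands p q : expands (flow_rel p q) (sexp p q).
Proof.
split; first by rewrite sexp_nil.
move=> n phi x0 hp; have [C C0 [r r0 hr]] := taylor n x0 p q hp.
have [s s0 hs] := solution_stays p q x0 r0.
exists C => //; exists s => // T x y /andP[T0 Ts] xs [gamma [g0 hg <-]].
rewrite -g0 in xs *; rewrite -[X in ser _ _ _ X]mul1r; apply: hr => //.
- exact: ltW.
- by apply: (hs T) => //; rewrite (ltW T0).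
- by rewrite ler01 lexx.
Qed.

(** The expansion of order 0 of the coordinates. *)
Lemma expands_near P c x0 (e : R) : expands P c -> 0 < e -> exists2 r : R, 0 < r &
  forall T x y, 0 < T <= r -> vn (x - x0) <= r -> P T x y -> vn (y - x0) <= e.
Proof.
move=> [c1 hP] e0.
pose e1 := e / (2 * d.+1%:R); have e10 : 0 < e1 by rewrite divr_gt0 // mulr_gt0 // ltr0n.
have [r r0 hr] : exists2 r : R, 0 < r & forall (j : 'I_d) T x y, 0 < T <= r ->
    vn (x - x0) <= r -> P T x y -> cn ((y - x) j 0) <= e1.
  apply: (finite_min (P := fun j r => forall T x y, 0 < T <= r -> vn (x - x0) <= r ->
       P T x y -> cn ((y - x) j 0) <= e1)).
    move=> j s s' _ ss h T x y /andP[T0 Ts] xs; apply: h; last exact: le_trans xs ss.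
    by rewrite T0 (le_trans Ts).
  move=> j; have [C C0 [r r0 hr]] := hP 0%N _ x0 (hol_coord j).
  exists (Num.min r (e1 / (C + 1))); first by rewrite lt_min r0 divr_gt0 // ltr_wpDl.
  move=> T x y; rewrite !le_min => /andP[T0 /andP[Tr Te]] /andP[xr _] /hr h.
  have := h ltac:(by rewrite T0) xr; rewrite /= c1 mul1r addr0 expr1 !mxE => h1.
  rewrite (le_trans h1) // (@le_trans _ _ ((C + 1) * T)) //.
    by rewrite ler_wpM2r ?ltW // ltrDl.
  by rewrite mulrC -ler_pdivlMr // ltr_wpDl.
exists (Num.min r (e / 2)); first by rewrite lt_min r0; lra.
move=> T x y; rewrite !le_min => /andP[T0 /andP[Tr _]] /andP[xr xe] hxy.
have h : vn (y - x) <= e / 2.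
  rewrite vnE (@le_trans _ _ (\sum_(j < d) e1)) //.
    by apply: ler_sum => j _; apply: (hr j T x y) => //; rewrite T0.
  rewrite sumr_const card_ord -[e1 *+ d]mulr_natr (@le_trans _ _ (e1 * d.+1%:R)) //.
    by rewrite ler_wpM2l ?(ltW e10) // ler_nat.
  by rewrite /e1 invfM mulrA divfK // pnatr_eq0.
have -> : y - x0 = (y - x) + (x - x0) by rewrite addrA subrK.
rewrite (le_trans (snormD _ _ _)) //; lra.
Qed.

(** Substitution of the expansion at x into the partial sum at u, by recursion
on the words of c. *)
Lemma ser_expands P c' n c phi x0 : expands P c' -> hol phi ->
  exists2 C : R, 0 <= C & exists2 r : R, 0 < r &
    forall T x u, 0 < T <= r -> vn (x - x0) <= r -> P T x u ->
      cn (ser n c phi T u - ser n (smul c c') phi T x) <= C * T ^+ n.+1.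
Proof.
move=> [c1 hP]; elim: n c phi => [|n IH] c phi hp.
  have [C C0 [r r0 hr]] := hP 0%N phi x0 hp.
  exists (cn (c [::]) * C); first by rewrite mulr_ge0 // snorm_ge0.
  exists r => // T x u Tr xr /(hr _ _ _ Tr xr); rewrite /= !addr0 => h.
  rewrite -[c [::] * c' [::] * _]mulrA -mulrBr (le_trans (cnM _ _)) // -mulrA ler_wpM2l //.
  exact: snorm_ge0.
have [C C0 [r r0 hr]] := hP n.+1 phi x0 hp.
have [A A0 [ra ra0 ha]] := IH (fun w => c (false :: w)) _ (field_derive_hol false hp).
have [B B0 [rb rb0 hb]] := IH (fun w => c (true :: w)) _ (field_derive_hol true hp).
exists (cn (c [::]) * C + (A + B)).
  by rewrite !addr_ge0 // mulr_ge0 // snorm_ge0.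
exists (Num.min r (Num.min ra rb)); first by rewrite !lt_min r0 ra0.
move=> T x u; rewrite !le_min => /andP[T0 /andP[T1 /andP[T2 T3]]] /andP[x1 /andP[x2 x3]] hxu.
have {}hr := hr T x u ltac:(by rewrite T0) x1 hxu.
have {}ha := ha T x u ltac:(by rewrite T0) x2 hxu.
have {}hb := hb T x u ltac:(by rewrite T0) x3 hxu.
rewrite ser_smul (serS n c).
set X := ser n.+1 c' _ _ _ in hr *.
set Y := ser n _ _ T u in ha *; set Z := ser n (smul _ _) _ _ x in ha *.
set Y' := ser n _ _ T u in hb *; set Z' := ser n (smul _ _) _ _ x in hb *.
have -> : c [::] * phi u + T%:C * (Y + Y') - (c [::] * X + T%:C * (Z + Z')) =
  c [::] * (phi u - X) + T%:C * ((Y - Z) + (Y' - Z')) by ring.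
rewrite (le_trans (snormD _ _ _)) // mulrDl; apply: lerD.
  by rewrite (le_trans (cnM _ _)) // -mulrA ler_wpM2l // snorm_ge0.
rewrite cn_realM gtr0_norm // exprS mulrCA ler_wpM2l ?(ltW T0) // mulrDl.
by rewrite (le_trans (snormD _ _ _)) // lerD.
Qed.

Definition rel_comp (P P' : R -> V -> V -> Prop) T x z := exists2 u, P' T x u & P T u z.

Lemma expands_comp P P' c c' : expands P c -> expands P' c' ->
  expands (rel_comp P P') (smul c c').
Proof.
move=> hP hP'; have [c1 h] := hP; have [c1' h'] := hP'.
split; first by rewrite smul0 c1 c1' mulr1.
move=> n phi x0 hp.
have [A A0 [ra ra0 ha]] := h n phi x0 hp.
have [B B0 [rb rb0 hb]] := ser_expands n c x0 hP' hp.
have [rc rc0 hc] := expands_near x0 hP' ra0.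
exists (A + B); first exact: addr_ge0.
exists (Num.min ra (Num.min rb rc)); first by rewrite !lt_min ra0 rb0.
move=> T x z; rewrite !le_min => /andP[T0 /andP[T1 /andP[T2 T3]]] /andP[x1 /andP[x2 x3]].
move=> [u xu uz].
have {}hc := hc T x u ltac:(by rewrite T0) x3 xu.
have {}ha := ha T u z ltac:(by rewrite T0) hc uz.
have {}hb := hb T x u ltac:(by rewrite T0) x2 xu.
rewrite -[phi z](subrK (ser n c phi T u)) -addrA mulrDl.
by rewrite (le_trans (snormD _ _ _)) // lerD.
Qed.

Lemma solvable_comp P P' c' : solvable P -> solvable P' -> expands P' c' ->
  solvable (rel_comp P P').
Proof.
move=> sP sP' hP' x0; have [r r0 hr] := sP x0; have [r' r'0 hr'] := sP' x0.
have [rc rc0 hc] := expands_near x0 hP' r0.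
exists (Num.min r (Num.min r' rc)); first by rewrite !lt_min r0 r'0.
move=> T x; rewrite !le_min => /andP[T0 /andP[T1 /andP[T2 T3]]] /andP[x1 /andP[x2 x3]].
have [u xu] := hr' T x ltac:(by rewrite T0) x2.
have ur := hc T x u ltac:(by rewrite T0) x3 xu.
by have [z uz] := hr T u ltac:(by rewrite T0) ur; exists z, u.
Qed.

End Fields.
End Expansion.

(** * Existence of flows *)

Section Picard.
Context {R : realType} {d : nat}.
Local Notation K := R[i].
Local Notation V := 'cV[K]_d.
Local Notation absn := (@absn R).
Local Notation cn := (@cn R).
Local Notation vn := (@vn R d).

Lemma vn_eq0 (x : V) : vn x <= 0 -> x = 0.
Proof.
move=> h; apply/matrixP => i j; rewrite ord1 mxE.
by apply: cn_eq0; apply: le_trans h; exact: cn_entry.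
Qed.

Lemma vn_le_sum (x : V) (e : R) : (forall j, cn (x j 0) <= e) -> vn x <= d%:R * e.
Proof.
move=> h; rewrite vnE (@le_trans _ _ (\sum_(j < d) e)) //; first exact: ler_sum.
by rewrite sumr_const card_ord mulr_natl.
Qed.

Lemma frechet_col (U : 'I_d -> R -> K) (t : R) (v : V) :
  (forall j, rder (U j) t (v j 0)) ->
  frechet absn vn (fun s => \col_j U j s) t (fun h : R => h%:C *: v).
Proof.
move=> hU; split; first by exists (vn v) => [|h]; [exact: snorm_ge0|rewrite vnZr mulrC].
move=> e e0; pose e1 := e / d.+1%:R.
have e10 : 0 < e1 by rewrite divr_gt0 // ltr0n.
have [r r0 hr] : exists2 r : R, 0 < r & forall j k, `|k| <= r ->
   cn (U j (t + k) - U j t - k%:C * v j 0) <= e1 * `|k|.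
  apply: (finite_min (P := fun j (r : R) => forall k, `|k| <= r -> _)).
    by move=> j s s' _ ss h k ks; apply: h; exact: le_trans ss.
  by move=> j; exact: (hU j).2.
exists r => // k kr; apply: le_trans (vn_le_sum (e := e1 * `|k|) _) _.
  by move=> j; rewrite !mxE; exact: hr.
rewrite mulrA ler_wpM2r //= /e1 mulrCA ler_piMr ?(ltW e0) //.
by rewrite ler_pdivrMr ?ltr0n // mul1r ler_nat.
Qed.

Lemma cont_entry (g : R -> V) t j : cont absn vn g t -> cont absn cn (fun s => g s j 0) t.
Proof.
move=> h e e0; have [r r0 hr] := h e e0; exists r => // k /hr hk.
by apply: le_trans hk; have := cn_entry (g (t + k) - g t) j; rewrite !mxE.
Qed.

Lemma vprimitive (g : R -> V) x : (forall t, cont absn vn g t) -> exists G : R -> V,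
  G 0 = x /\ forall t, frechet absn vn G t (fun h : R => h%:C *: g t).
Proof.
move=> cg.
have /choice[U hU] : forall j, exists U : R -> K, forall t, rder U t (g t j 0).
  by move=> j; apply: cprimitive => t; exact: cont_entry.
exists (fun t => \col_j (x j 0 + (U j t - U j 0))); split.
  by apply/matrixP => i j; rewrite ord1 mxE subrr addr0.
move=> t; apply: frechet_col => j.
apply: rder_eq (rderD (rder_cst (x j 0) t) (rderB (hU j t) (rder_cst (U j 0) t))) _ _ => //.
by ring.
Qed.

Lemma geometric_limit (a : nat -> R) (M : R) : 0 <= M ->
  (forall n, `|a n.+1 - a n| <= M / 2 ^+ n) ->
  exists l, forall n, `|a n - l| <= 2 * M / 2 ^+ n.
Proof.
move=> M0 ha.
have E n : M / 2 ^+ n = 2 * (M / 2 ^+ n.+1).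
  by rewrite exprS; field; rewrite expf_neq0.
have [l hl] := @nested_intervals R (fun n => a n - 2 * (M / 2 ^+ n)) (fun n => 4 * (M / 2 ^+ n))
  ltac:(by move=> n; rewrite mulr_ge0 // divr_ge0 // exprn_ge0)
  ltac:(by move=> n; have := ha n; rewrite (E n) ler_norml => /andP[]; lra)
  ltac:(by move=> n; have := ha n; rewrite (E n) ler_norml => /andP[]; lra).
exists l => n; have /andP[h1 h2] := hl n; rewrite ler_norml -mulrA; apply/andP; split; lra.
Qed.

Lemma vgeometric_limit (a : nat -> V) (M : R) : 0 <= M ->
  (forall n, vn (a n.+1 - a n) <= M / 2 ^+ n) ->
  exists l, forall n, vn (a n - l) <= d%:R * (4 * M) / 2 ^+ n.
Proof.
move=> M0 ha.
have hc j n : cn (a n.+1 j 0 - a n j 0) <= M / 2 ^+ n.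
  by apply: le_trans (ha n); have := cn_entry (a n.+1 - a n) j; rewrite !mxE.
have /choice[l1 h1] : forall j, exists l : R, forall n,
    `|complex.Re (a n j 0) - l| <= 2 * M / 2 ^+ n.
  move=> j; apply: geometric_limit => // n; have := hc j n; rewrite cnE.
  case: (a n.+1 j 0) (a n j 0) => [p q] [p' q'] /=; have := normr_ge0 (q - q'); lra.
have /choice[l2 h2] : forall j, exists l : R, forall n,
    `|complex.Im (a n j 0) - l| <= 2 * M / 2 ^+ n.
  move=> j; apply: geometric_limit => // n; have := hc j n; rewrite cnE.
  case: (a n.+1 j 0) (a n j 0) => [p q] [p' q'] /=; have := normr_ge0 (p - p'); lra.
exists (\col_j (l1 j +i* l2 j)) => n; rewrite -mulrA; apply: vn_le_sum => j.
rewrite !mxE; have := h1 j n; have := h2 j n; rewrite cnE.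
by case: (a n j 0) => p q /=; rewrite -!mulrA; lra.
Qed.

Definition clamp (t : R) : R := Num.max 0 (Num.min 1 t).

Lemma clamp01 t : 0 <= clamp t <= 1.
Proof. by rewrite /clamp le_max lexx /= ge_max ler01 ge_min lexx. Qed.

Lemma clamp_id t : 0 <= t <= 1 -> clamp t = t.
Proof. by move=> /andP[t0 t1]; rewrite /clamp (min_idPr t1) (max_idPr t0). Qed.

Lemma clamp_lip s t : `|clamp s - clamp t| <= `|s - t|.
Proof.
rewrite /clamp /Num.max /Num.min.
have h1 := ler_norm (s - t); have h2 := ler_norm (t - s); rewrite distrC in h2.
rewrite ler_norml; apply/andP.
by do 4! case: ifPn; rewrite -?leNgt => *; split; lra.
Qed.

Lemma cont_clamp (W : zmodType) (M : seminorm R W) (g : R -> W) t :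
  (forall s, 0 <= s <= 1 -> cont absn M g s) -> cont absn M (fun s => g (clamp s)) t.
Proof.
move=> hg; apply: (cont_comp (u := clamp) (M := absn)); last exact: hg (clamp01 t).
by move=> e e0; exists e => // k ke; rewrite (le_trans (clamp_lip _ _)) // (addrC t) addrK.
Qed.

(** Picard iteration.  The curves are evaluated at [clamp s], so that all of them
are defined and differentiable on the whole line while only their values on
[0, 1] matter; these stay in the ball of radius r around x0, where G is
a contraction. *)
Theorem picard (G : V -> V) x0 x (r b : R) : (forall y, cont vn vn G y) -> 0 <= b ->
  (forall y, vn (y - x0) <= r -> vn (G y) <= b) ->
  (forall y z, vn (y - x0) <= r -> vn (z - x0) <= r -> vn (G z - G y) <= 2^-1 * vn (z - y)) ->
  vn (x - x0) + b <= r ->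
  exists gamma : R -> V, gamma 0 = x /\
    forall t, 0 <= t <= 1 -> frechet absn vn gamma t (fun h : R => h%:C *: G (gamma t)).
Proof.
move=> cG b0 Gb GL xb.
have /choice[Phi hPhi] : forall g : R -> V, exists F : R -> V,
    (forall t, cont absn vn g t) ->
    F 0 = x /\ forall t, frechet absn vn F t (fun h : R => h%:C *: g t).
  move=> g; have [cg|ncg] := pselect (forall t, cont absn vn g t).
    by have [F hF] := vprimitive x cg; exists F.
  by exists g.
pose step (g : R -> V) := Phi (fun s => G (g (clamp s))).
pose ball_curve (g : R -> V) := (forall t, cont absn vn g t) /\
   forall t, 0 <= t <= 1 -> vn (g t - x0) <= r.
have cGg g : (forall t, cont absn vn g t) -> forall t, cont absn vn (fun s => G (g (clamp s))) t.
  move=> cg t; apply: (cont_comp (u := fun s => g (clamp s)) (M := vn)) => //.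
  exact: cont_clamp.
have step0 g : ball_curve g -> step g 0 = x.
  by move=> [cg _]; have [] := hPhi _ (cGg _ cg).
have stepD g t : ball_curve g ->
    frechet absn vn (step g) t (fun h : R => h%:C *: G (g (clamp t))).
  by move=> [cg _]; have [_] := hPhi _ (cGg _ cg); exact.
have stepB g : ball_curve g -> ball_curve (step g).
  move=> hg; have [cg rg] := hg; split; first by move=> t; exact: frechet_cont (stepD g t hg).
  move=> t /andP[t0 t1].
  have -> : step g t - x0 = (step g t - step g 0) + (x - x0).
    by rewrite (step0 _ hg) addrA subrK.
  rewrite (le_trans (snormD _ _ _)) //.
  have : vn (step g t - step g 0) <= b * (t - 0).
    apply: mean_value => // s _; exists (fun h : R => h%:C *: G (g (clamp s))).
      exact: stepD.
    by move=> h; rewrite vnZr mulrC ler_wpM2r // Gb // rg // clamp01.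
  have : b * t <= b by rewrite ler_piMr.
  lra.
have stepL g g' (D : R) : ball_curve g -> ball_curve g' -> 
    (forall t, 0 <= t <= 1 -> vn (g' t - g t) <= D) ->
    forall t, 0 <= t <= 1 -> vn (step g' t - step g t) <= D / 2.
  move=> hg hg' hD t /andP[t0 t1].
  have D0 : 0 <= D by apply: le_trans (hD 0 _); rewrite ?snorm_ge0 // lexx ler01.
  pose u s := step g' s - step g s.
  have u0 : u 0 = 0 by rewrite /u !step0 // subrr.
  rewrite -/(u t) -[u t]subr0 -u0.
  apply: (@le_trans _ _ (D / 2 * (t - 0))); last by rewrite subr0 ler_piMr // divr_ge0.
  apply: (mean_value (u := u)) => // s _.
  exists (fun h : R => h%:C *: (G (g' (clamp s)) - G (g (clamp s)))).
    apply: eq_frechet (frechetB (stepD _ s hg') (stepD _ s hg)) => // h.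
    by rewrite scalerBr.
  move=> h; rewrite vnZr mulrC ler_wpM2r //.
  have [_ rg] := hg; have [_ rg'] := hg'.
  rewrite (le_trans (GL _ _ _ _)) ?rg ?rg' ?clamp01 // mulrC ler_wpM2r ?invr_ge0 //.
  exact/hD/clamp01.
pose g n := iter n step (fun=> x).
have xr : vn (x - x0) <= r by lra.
have gB n : ball_curve (g n).
  elim: n => [|n IH]; last by rewrite /g iterS; exact: stepB.
  by split => [t|t _] //; exact: cont_cst.
pose M := 2 * r.
have r0 : 0 <= r by have := snorm_ge0 vn (x - x0); lra.
have M0 : 0 <= M by rewrite mulr_ge0.
have gM n t : 0 <= t <= 1 -> vn (g n.+1 t - g n t) <= M / 2 ^+ n.
  elim: n t => [|n IH] t t01.
    rewrite expr0 divr1.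
    have -> : g 1%N t - g 0%N t = (g 1%N t - x0) - (g 0%N t - x0) by rewrite opprB addrA subrK.
    rewrite (le_trans (snormB _ _ _)) //.
    by have := (gB 1%N).2 t t01; have := (gB 0%N).2 t t01; rewrite /M; lra.
  by rewrite exprSr invfM mulrA; exact: (stepL _ _ _ (gB n) (gB n.+1) IH t t01).
have /choice[l hl] : forall t, exists l : V, forall n,
    vn (g n (clamp t) - l) <= d%:R * (4 * M) / 2 ^+ n.
  by move=> t; apply: vgeometric_limit => // n; apply: gM; exact: clamp01.
pose D := d%:R * (4 * M).
have D0 : 0 <= D by rewrite mulr_ge0 // mulr_ge0.
have small (e : R) : 0 < e -> exists n, D / 2 ^+ n <= e by exact: small_pow2.
have cl t : cont absn vn l t.
  move=> e e0; have e4 : 0 < e / 4 by lra.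
  have [n hn] := small _ e4.
  have [s s0 hs] := cont_clamp t (fun s _ => (gB n).1 s) e4.
  exists s => // k /hs.
  have h1 := hl (t + k) n; have h2 := hl t n; rewrite -/D in h1 h2.
  set A := g n _ in h1 *; set B := g n _ in h2 *.
  have -> : l (t + k) - l t = (A - B) - ((A - l (t + k)) - (B - l t)).
    by rewrite opprB addrA (addrA (A - B)) subrK opprB [RHS]addrC addrA subrK.
  move=> h3; rewrite (le_trans (snormB _ _ _)) //.
  have := snormB vn (A - l (t + k)) (B - l t); lra.
have rl t : vn (l t - x0) <= r.
  apply/ler_addgt0Pr => e e0; have [n hn] := small _ e0.
  have -> : l t - x0 = (g n (clamp t) - x0) - (g n (clamp t) - l t).
    by rewrite opprB [RHS]addrC addrA subrK.
  rewrite (le_trans (snormB _ _ _)) // lerD //; first exact/(gB n).2/clamp01.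
  by rewrite (le_trans (hl t n)).
have lB : ball_curve l by split => // t _.
have fixed t : 0 <= t <= 1 -> step l t = l t.
  move=> t01; apply/eqP; rewrite -subr_eq0; apply/eqP/vn_eq0/ler_addgt0Pr => e e0.
  rewrite add0r; have e2 : 0 < e / 2 by lra.
  have [n hn] := small _ e2.
  have h1 := stepL _ _ (D / 2 ^+ n) lB (gB n)
    ltac:(by move=> s s01; have := hl s n; rewrite clamp_id) t t01.
  have h2 := hl t n.+1; rewrite clamp_id // -/D exprSr invfM mulrA in h2.
  have -> : step l t - l t = (g n.+1 t - l t) - (step (g n) t - step l t).
    by rewrite opprB [RHS]addrC addrA subrK.
  rewrite (le_trans (snormB _ _ _)) //; lra.
exists (step l); split; first exact: step0.
move=> t t01; apply: eq_frechet (stepD l t lB) => // h.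
by rewrite clamp_id // fixed.
Qed.

Lemma cont_col (f : 'I_d -> V -> K) y : (forall j, cont vn cn (f j) y) ->
  cont vn vn (fun x => \col_j f j x) y.
Proof.
move=> hf e e0; pose e1 := e / d.+1%:R.
have e10 : 0 < e1 by rewrite divr_gt0 // ltr0n.
have [r r0 hr] := @finite_min R _ (fun j (r : R) => forall k, vn k <= r ->
    cn (f j (y + k) - f j y) <= e1)
  ltac:(by move=> j s s' _ ss h k ks; apply: h; exact: le_trans ks ss)
  (fun j => hf j e1 e10).
exists r => // k kr; apply: le_trans (vn_le_sum (e := e1) _) _.
  by move=> j; rewrite !mxE; exact: hr.
rewrite /e1 mulrCA ler_piMr ?(ltW e0) //.
by rewrite ler_pdivrMr ?ltr0n // mul1r ler_nat.
Qed.

Section Existence.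
Variables (f0 f1 : 'I_d -> V -> K).
Hypotheses (hf0 : forall j, hol (f0 j)) (hf1 : forall j, hol (f1 j)).

Lemma col_lipschitz (f : 'I_d -> V -> K) x0 : (forall j, hol (f j)) ->
  exists2 B : R, 0 <= B & exists2 r : R, 0 < r & forall y z,
    vn (y - x0) <= r -> vn (z - x0) <= r ->
    vn (\col_j f j z - \col_j f j y) <= B * vn (z - y).
Proof.
move=> hf.
have /choice[B hB] : forall j, exists B : R, 0 < B /\ exists2 r : R, 0 < r &
   forall y z, vn (y - x0) <= r -> vn (z - x0) <= r ->
    cn (f j z - f j y) <= B * vn (z - y).
  by move=> j; have [B B0 h] := hol_locally_lipschitz x0 (hf j); exists B.
exists (\sum_j B j); first by apply: sumr_ge0 => j _; rewrite ltW // (hB j).1.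
have [r r0 hr] := @finite_min R _ (fun j r => forall y z, vn (y - x0) <= r ->
   vn (z - x0) <= r -> cn (f j z - f j y) <= B j * vn (z - y))
  ltac:(by move=> j s s' _ ss h y z hy hz; apply: h; [exact: le_trans hy ss|exact: le_trans hz ss])
  (fun j => (hB j).2).
exists r => // y z hy hz; rewrite vnE mulr_suml; apply: ler_sum => j _.
by rewrite !mxE; exact: hr.
Qed.

(** For small T the field T (p f0 + q f1) is bounded by r / 2 and has Lipschitz
constant 1 / 2 on a ball of radius r. *)
Theorem flow_solvable p q : solvable (flow_rel f0 f1 p q).
Proof.
move=> x0.
have [B B0 [r1 r10 hB]] := vfield_bound hf0 hf1 p q x0.
have [L0 L00 [r2 r20 hL0]] := col_lipschitz x0 hf0.
have [L1 L10 [r3 r30 hL1]] := col_lipschitz x0 hf1.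
pose r := Num.min r1 (Num.min r2 r3).
have r0 : 0 < r by rewrite !lt_min r10 r20.
have rr1 : r <= r1 by rewrite ge_min lexx.
have rr2 : r <= r2 by rewrite !ge_min lexx orbT.
have rr3 : r <= r3 by rewrite !ge_min lexx !orbT.
pose L := cn p * L0 + cn q * L1.
have L_ge0 : 0 <= L by apply: addr_ge0; apply: mulr_ge0; rewrite ?snorm_ge0.
exists (Num.min (r / 2) (Num.min (r / 2 / (B + 1)) (2^-1 / (L + 1)))).
  by rewrite !lt_min !divr_gt0 // ?ltr_wpDl // invr_gt0.
move=> T x; rewrite !le_min => /andP[T0 /andP[_ /andP[T1 T2]]] /andP[xr _].
have TB : T * B <= r / 2.
  rewrite ler_pdivlMr ?ltr_wpDl // in T1.
  by rewrite (le_trans _ T1) // ler_wpM2l ?(ltW T0) // lerDl.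
have TL : T * L <= 2^-1.
  rewrite ler_pdivlMr ?ltr_wpDl // in T2.
  by rewrite (le_trans _ T2) // ler_wpM2l ?(ltW T0) // lerDl.
have cG y : cont vn vn (vfield f0 f1 T p q) y.
  rewrite (_ : vfield f0 f1 T p q = (fun x => \col_j (T%:C * (p * f0 j x + q * f1 j x)))).
    apply: cont_col => j; apply: contZ; apply: contD; apply: contZ; exact: hol_cont.
  by apply/funext => z; apply/matrixP => i j; rewrite !mxE.
have GL y z : vn (y - x0) <= r -> vn (z - x0) <= r ->
    vn (vfield f0 f1 T p q z - vfield f0 f1 T p q y) <= 2^-1 * vn (z - y).
  move=> yr zr.
  have h0 := hL0 y z (le_trans yr rr2) (le_trans zr rr2).
  have h1 := hL1 y z (le_trans yr rr3) (le_trans zr rr3).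
  apply: (@le_trans _ _ (T * L * vn (z - y))); last by rewrite ler_wpM2r // snorm_ge0.
  rewrite /vfield -scalerBr vnZr gtr0_norm // -mulrA ler_wpM2l ?(ltW T0) //.
  rewrite opprD addrACA -!scalerBr (le_trans (snormD _ _ _)) // mulrDl.
  by apply: lerD; rewrite (le_trans (vnZ _ _)) // -mulrA ler_wpM2l ?snorm_ge0.
have Gb y : vn (y - x0) <= r -> vn (vfield f0 f1 T p q y) <= T * B.
  by move=> yr; apply: hB; [exact: ltW|exact: le_trans yr rr1].
have TB0 : 0 <= T * B by rewrite mulr_ge0 // ltW.
have xb : vn (x - x0) + T * B <= r by lra.
have [gamma [g0 hg]] := picard cG TB0 Gb GL xb.
by exists (gamma 1), gamma.
Qed.

End Existence.

End Picard.

(** * Comparison of norms, velocities and flows *)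

Section Bridge.
Context {R : realType}.
Local Notation K := R[i].
Local Notation absn := (@absn R).
Local Notation cn := (@cn R).

Lemma normr_le_cn (z : K) : `|z| <= (cn z)%:C.
Proof.
rewrite normc_def lecR cnE.
have h0 : 0 <= `|complex.Re z| + `|complex.Im z| by rewrite addr_ge0.
rewrite -[leRHS]ger0_norm // -sqrtr_sqr ler_wsqrtr //.
rewrite sqrrD !real_normK ?num_real //.
rewrite -addrA lerD2l lerDr.
by rewrite mulrn_wge0 // mulr_ge0.
Qed.

Lemma cn_le_normr (z : K) (e : R) : `|z| <= e%:C -> cn z <= 2 * e.
Proof.
rewrite normc_def lecR cnE => h.
have hr : `|complex.Re z| <= e.
  by rewrite (le_trans _ h) // -sqrtr_sqr ler_wsqrtr // lerDl sqr_ge0.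
have hi : `|complex.Im z| <= e.
  by rewrite (le_trans _ h) // -sqrtr_sqr ler_wsqrtr // lerDr sqr_ge0.
lra.
Qed.

Lemma Re_of_ge0 (e : K) : 0 <= e -> e = (complex.Re e)%:C.
Proof. by move=> /ger0_Im; case: e => a b /= ->. Qed.

Lemma Re_gt0 (e : K) : 0 < e -> 0 < complex.Re e.
Proof. by rewrite ltcE => /andP[_]. Qed.

Section Dim.
Context {d : nat}.
Local Notation V := 'cV[K]_d.
Local Notation vn := (@vn R d).

Lemma mx_norm_le_vn (x : V) : `|x| <= (vn x)%:C.
Proof.
have [->|x0] := eqVneq `|x| 0; first by rewrite lecR snorm_ge0.
have [[i j] /= E] := mx_norm_neq0 x0.
rewrite [`|x|]E ord1 (le_trans (normr_le_cn _)) // lecR.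
exact: cn_entry.
Qed.

Lemma entry_le_mx_norm (x : V) i : `|x i 0| <= `|x|.
Proof.
rewrite [`|x|]mx_normE -[leLHS]nngE num_le.
exact: (le_bigmax _ (fun ij : 'I_d * 'I_1 => `|x ij.1 ij.2|%:nng) (i, 0)).
Qed.

Lemma vn_le_mx_norm (x : V) (e : R) : `|x| <= e%:C -> vn x <= d%:R * (2 * e).
Proof.
move=> h; apply: vn_le_sum => j; apply: cn_le_normr.
exact: le_trans (entry_le_mx_norm _ _) h.
Qed.

Lemma col_delta (k : V) : k = \sum_j k j 0 *: basis_vec j.
Proof.
apply/matrixP => i j; rewrite ord1 summxE (bigD1 i) //= !mxE !eqxx mulr1.
rewrite big1 ?addr0 // => l li; rewrite !mxE eq_sym (negbTE li) mulr0 //.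
Qed.

(** The matrix norm and the l1 norm are equivalent, and a linear map is
determined by the images of the basis vectors. *)
Lemma holomorphic_hol (f : V -> V) j : holomorphic f -> hol (fun x => f x j 0).
Proof.
move=> hf x; have df := hf x.
pose g i := ('d f x (basis_vec i)) j 0.
exists g; split.
  exists (\sum_i cn (g i)); first by apply: sumr_ge0 => i _; exact: snorm_ge0.
  move=> k; apply: lin_bound => [|i]; first by apply: sumr_ge0 => i _; exact: snorm_ge0.
  by rewrite (bigD1 i) //= lerDl; apply: sumr_ge0 => l _; exact: snorm_ge0.
have gE k : lin g k = ('d f x k) j 0.
  rewrite [in RHS](col_delta k) linear_sum summxE; apply: eq_bigr => i _.
  by rewrite linearZ mxE mulrC.
move=> e e0.
have /eqaddoP /(_ ((e / 2)%:C)) := diff_locally df.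
have e2 : 0 < (e / 2)%:C :> K by rewrite ltcR divr_gt0.
move=> /(_ e2) /nbhs_ballP [/= r r0 hr].
exists (complex.Re r / 2); first by rewrite divr_gt0 // Re_gt0.
move=> k kr.
have kr' : `|k| < r.
  rewrite (Re_of_ge0 (ltW r0)) (le_lt_trans (mx_norm_le_vn k)) // ltcR.
  by rewrite (le_lt_trans kr) // ltr_pdivrMr // mulr2n; have := Re_gt0 r0; lra.
have := hr k; rewrite /= mx_norm_ball /= sub0r normrN => /(_ kr') h.
rewrite gE.
pose w := f (x + k) - f x - 'd f x k.
have -> : f (x + k) j 0 - f x j 0 - ('d f x k) j 0 = w j 0 by rewrite /w !mxE.
have hw : `|w| <= (e / 2 * vn k)%:C.
  rewrite /w (addrC x k) -addrA -opprD rmorphM; apply: le_trans h _.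
  by rewrite ler_wpM2l ?(ltW e2) // mx_norm_le_vn.
have := cn_le_normr (le_trans (entry_le_mx_norm w j) hw); lra.
Qed.

Lemma has_velocity_frechet (gamma : R -> V) t v : has_velocity gamma t v ->
  frechet absn vn gamma t (fun h : R => h%:C *: v).
Proof.
move=> hv; split; first by exists (vn v) => [|h]; [exact: snorm_ge0|rewrite vnZr mulrC].
move=> e e0; pose e1 := e / (2 * d.+1%:R).
have e10 : 0 < e1 by rewrite divr_gt0 // mulr_gt0 // ltr0n.
have e1C : 0 < e1%:C :> K by rewrite ltcR.
move/cvgrPdist_le: hv => /(_ _ e1C) [r /= r0 hr].
exists (r / 2); first by rewrite divr_gt0.
move=> k kr; have [->|k0] := eqVneq k 0.
  by rewrite rmorph0 scale0r addr0 !subrr snorm0 /= normr0 mulr0.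
have := hr k; rewrite /= sub0r normrN => /(_ _ k0) h.
have {}h := h ltac:(by rewrite (le_lt_trans kr) // ltr_pdivrMr // mulr2n; lra).
have := vn_le_mx_norm h; rewrite -snormN opprB => {}h.
have kC : k%:C != 0 :> K by rewrite (fmorph_eq0 (real_complex R)).
have -> : gamma (t + k) - gamma t - k%:C *: v =
    k%:C *: ((k^-1)%:C *: (gamma (t + k) - gamma t) - v).
  by rewrite scalerBr scalerA -rmorphM mulfV // rmorph1 scale1r.
rewrite vnZr mulrC ler_wpM2r // (le_trans h) //.
have dn : d.+1%:R != 0 :> R by rewrite pnatr_eq0.
have -> : e = d.+1%:R * (2 * e1).
  by rewrite /e1; move: (d.+1%:R) dn => D D0; field.
by rewrite ler_wpM2r ?ler_nat // mulr_ge0 // ltW.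
Qed.

Lemma frechet_has_velocity (gamma : R -> V) t v :
  frechet absn vn gamma t (fun h : R => h%:C *: v) -> has_velocity gamma t v.
Proof.
move=> [_ hg]; apply/cvgrPdist_le => e e0.
have eR := Re_gt0 e0; have [r r0 hr] := hg _ eR.
exists r => // k /=; rewrite sub0r normrN => kr k0.
have kC : k%:C != 0 :> K by rewrite (fmorph_eq0 (real_complex R)).
rewrite distrC (le_trans (mx_norm_le_vn _)) // (Re_of_ge0 (ltW e0)) lecR.
have -> : (k^-1)%:C *: (gamma (t + k) - gamma t) - v =
   (k^-1)%:C *: (gamma (t + k) - gamma t - k%:C *: v).
  by rewrite [in RHS]scalerBr scalerA -rmorphM mulVf // rmorph1 scale1r.
rewrite vnZr normfV mulrC ler_pdivrMr ?normr_gt0 //.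
by apply: hr; exact: ltW.
Qed.

Section Flows.
Variables (f0 f1 : V -> V).

Definition component (f : V -> V) (j : 'I_d) (x : V) : K := f x j 0.

Lemma componentK f x : \col_j component f j x = f x.
Proof. by apply/matrixP => i j; rewrite ord1 mxE. Qed.

Local Notation flow := (flow_rel (component f0) (component f1)).

(** Velocities and real derivatives are the same thing up to the choice of the
norm. *)
Lemma is_flow_rel g T p q x y :
  (forall z, g z = T%:C *: (p *: f0 z + q *: f1 z)) ->
  is_flow g x y <-> flow p q T x y.
Proof.
move=> gE; have gE' z : g z = vfield (component f0) (component f1) T p q z.
  by rewrite gE /vfield !componentK.
split=> [[gamma [g0 hg g1]]|[gamma [g0 hg g1]]]; exists gamma; split => // t t01.
  by rewrite -gE'; apply: has_velocity_frechet; exact: hg.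
by rewrite gE'; apply: frechet_has_velocity; exact: hg.
Qed.

Fixpoint splitting_rel (ab : seq (R * K)) : R -> V -> V -> Prop :=
  if ab is (a, b) :: ab' then
    rel_comp (flow a%:C 0) (rel_comp (flow 0 b) (splitting_rel ab'))
  else fun _ x z => z = x.

Lemma is_splitting_rel T ab x z :
  is_splitting f0 f1 T ab x z <-> splitting_rel ab T x z.
Proof.
elim: ab z => [|[a b] ab IH] z //=.
have E1 u v : is_flow (fun p => (b * T%:C) *: f1 p) u v <-> flow 0 b T u v.
  by apply: is_flow_rel => p; rewrite scale0r add0r scalerA mulrC.
have E0 u v : is_flow (fun p => (a * T)%:C *: f0 p) u v <-> flow a%:C 0 T u v.
  by apply: is_flow_rel => p; rewrite scale0r addr0 scalerA -rmorphM mulrC.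
split.
  move=> [u [v [/IH h /E1 h1 /E0 h0]]]; exists v => //; by exists u.
by move=> [v [u /IH h /E1 h1] /E0 h0]; exists u, v.
Qed.

Hypotheses (hf0 : holomorphic f0) (hf1 : holomorphic f1).

Let hc0 j : hol (component f0 j). Proof. exact: holomorphic_hol. Qed.
Let hc1 j : hol (component f1 j). Proof. exact: holomorphic_hol. Qed.

Lemma splitting_expands ab :
  expands (component f0) (component f1) (splitting_rel ab) (split_series ab) /\
  solvable (splitting_rel ab).
Proof.
elim: ab => [|[a b] ab [IHe IHs]] /=.
  split; last by move=> x0; exists 1 => // T x _ _; exists x.
  split; first by rewrite /unit_series eqxx.
  move=> n phi x0 _; exists 0 => //; exists 1 => // T x y _ _ ->.
  suff -> : ser (component f0) (component f1) n unit_series phi T x = phi x.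
    by rewrite subrr snorm0 mul0r.
  rewrite -sexp00; case: n => [|n]; first by rewrite /= sexp_nil mul1r addr0.
  have Z b c : ser (component f0) (component f1) n (fun w => sexp 0 0 (b :: w)) c T x = 0.
    rewrite (@eq_ser _ _ _ _ n _ (fun w => 0 * sexp 0 0 w)) ?serZ ?mul0r //.
    by move=> w _; rewrite sexp00 mul0r.
  by rewrite !serS !Z addr0 mulr0 addr0 sexp_nil mul1r.
have e1 := flow_expands hc0 hc1 0 b; have e0 := flow_expands hc0 hc1 a%:C 0.
have s1 := flow_solvable hc0 hc1 0 b; have s0 := flow_solvable hc0 hc1 a%:C 0.
split; first exact: (expands_comp hc0 hc1 e0 (expands_comp hc0 hc1 e1 IHe)).
apply: (solvable_comp s0 _ (expands_comp hc0 hc1 e1 IHe)).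
exact: (solvable_comp s1 IHs IHe).
Qed.

(** Both maps have the same truncated series, so the coordinates of their
images have the same expansion at x0. *)
Lemma splitting_error N ab x0 :
  (forall w, (size w <= N)%N -> split_series ab w = sexp 1 1 w) ->
  exists C : R, \forall T \near (0 : R)^'+,
        [/\ exists y, is_flow (fun p => T%:C *: (f0 p + f1 p)) x0 y,
            exists z, is_splitting f0 f1 T ab x0 z &
            forall y z,
              is_flow (fun p => T%:C *: (f0 p + f1 p)) x0 y ->
              is_splitting f0 f1 T ab x0 z ->
              `|y - z| <= (C * T ^+ N.+1)%:C].
Proof.
move=> hab; have [[_ he] hs] := splitting_expands ab.
have [_ ge] := flow_expands hc0 hc1 1 1; have gs := flow_solvable hc0 hc1 1 1.
have EF T x y : is_flow (fun p => T%:C *: (f0 p + f1 p)) x y <-> flow 1 1 T x y.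
  by apply: is_flow_rel => p; rewrite !scale1r.
have /choice[C hC] : forall j : 'I_d, exists C : R, exists2 r : R, 0 < r &
    forall T y z, 0 < T <= r -> flow 1 1 T x0 y -> splitting_rel ab T x0 z ->
    cn ((y - z) j 0) <= C * T ^+ N.+1.
  move=> j; have [A A0 [r r0 hr]] := ge N _ x0 (hol_coord j).
  have [B B0 [s s0 hs']] := he N _ x0 (hol_coord j).
  exists (A + B); exists (Num.min r s); first by rewrite lt_min r0.
  move=> T y z; rewrite le_min => /andP[T0 /andP[Tr Ts]] hy hz.
  have h1 := hr T x0 y ltac:(by rewrite T0) ltac:(by rewrite subrr snorm0 ltW) hy.
  have h2 := hs' T x0 z ltac:(by rewrite T0) ltac:(by rewrite subrr snorm0 ltW) hz.
  rewrite (eq_ser _ _ _ _ _ hab) in h2; rewrite !mxE.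
  set S := ser _ _ _ _ _ _ _ in h1 h2.
  have -> : y j 0 - z j 0 = (y j 0 - S) - (z j 0 - S) by ring.
  by rewrite (le_trans (snormB _ _ _)) // mulrDl lerD.
have [r r0 hr] := @finite_min R _ (fun j r => forall T y z, 0 < T <= r ->
    flow 1 1 T x0 y -> splitting_rel ab T x0 z -> cn ((y - z) j 0) <= C j * T ^+ N.+1)
   ltac:(by move=> j s s' _ ss h T y z /andP[T0 Ts]; apply: h; rewrite T0 (le_trans Ts)) hC.
have [r1 r10 h1] := gs x0; have [r2 r20 h2] := hs x0.
exists (\sum_j C j).
near=> T.
have T0 : 0 < T by near: T; exact: nbhs_right_gt.
have Tr : T <= r by near: T; exact: nbhs_right_le.
have Tr1 : T <= r1 by near: T; exact: nbhs_right_le.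
have Tr2 : T <= r2 by near: T; exact: nbhs_right_le.
split.
- have [y hy] := h1 T x0 ltac:(by rewrite T0) ltac:(by rewrite subrr snorm0 ltW).
  by exists y; apply/EF.
- have [z hz] := h2 T x0 ltac:(by rewrite T0) ltac:(by rewrite subrr snorm0 ltW).
  by exists z; apply/is_splitting_rel.
- move=> y z /EF hy /is_splitting_rel hz.
  rewrite (le_trans (mx_norm_le_vn _)) // lecR vnE mulr_suml; apply: ler_sum => j _.
  by apply: hr => //; rewrite T0.
Unshelve. all: by end_near. Qed.

End Flows.
End Dim.
End Bridge.

Theorem theorem1p11 (R : realType) (N : nat) (hN : (1 <= N)%N) :
  exists (k : nat) (alpha : k.-tuple R) (beta : k.-tuple R[i]),
    [/\ (1 <= k)%N,
        (forall i : 'I_k, 0 <= tnth alpha i) &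
        splitting_order_at_least N alpha beta].
Proof.
have G1 : generated (sexp 1 1 : seq bool -> R[i]).
  by have := gen_sexpd (1 : R); rewrite rmorph1.
have t1 : 0 < time (sexp 1 1 : seq bool -> R[i]).
  by rewrite -[X in sexp X](rmorph1 (real_complex R)) time_sexp.
have [_ [ab hab ->] hs] := generated_reachable hN G1 t1.
have ab0 : (0 < size ab)%N.
  case: ab hab hs => // _ /(_ [:: false] hN).
  by rewrite sexp_false => /esym/eqP; rewrite oner_eq0.
have s1 : size (unzip1 ab) == size ab by rewrite size_map.
have s2 : size (unzip2 ab) == size ab by rewrite size_map.
exists (size ab), (Tuple s1), (Tuple s2); split => //.
  move=> i; rewrite (tnth_nth 0) /= (nth_map (0, 0)) //.
  by have /all_nthP := hab; apply.
move=> d f0 f1 _ hf0 hf1 x0; rewrite /= zip_unzip.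
exact: splitting_error.
Qed.
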